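(* Let $1\leq p<\infty$ and $0<\alpha<d$. Then there is a constant $C_{d,\alpha,p}$ depending only on $d,\alpha,p$ such that for all $f\in W^{1,p}(\mathbb{R}^d)$, \[ \Biggl(\sum_{Q\in\mathcal{Q}_\alpha}\bigl(\ell(Q)^{\frac dp-1}f_Q\bigr)^p\Biggr)^{\frac1p}\leq C_{d,\alpha,p}\|\nabla f\|_{L^p(\mathbb{R}^d)}. \] For $p=1$, the same holds for all $f\in\mathrm{BV}(\mathbb{R}^d)$ with $\|\nabla f\|_1$ replaced by $\operatorname{var} f$. The endpoint $p=\infty$ also holds: $\sup_{Q\in\mathcal{Q}_\alpha}\ell(Q)^{-1}f_Q\le C_{d,\alpha}\|\nabla f\|_{L^\infty}$.
   Context: Dyadic cubes are the cubes $[x_1,x_1+2^n)\times\dots\times[x_d,x_d+2^n)$ with $n\in\mathbb{Z}$ and $x_i\in2^n\mathbb{Z}$; $\ell(Q)$ denotes the sidelength of $Q$. For a cube $Q$, $f_Q=\frac1{|Q|}\int_Q|f|$. $\mathcal{Q}_\alpha$ is the set of all dyadic cubes $Q$ such that for every dyadic cube $P\supsetneq Q$ we have $\ell(P)^\alpha f_P<\ell(Q)^\alpha f_Q$. $\operatorname{var} f$ is the total variation of $f\in\mathrm{BV}(\mathbb{R}^d)$. *)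

(* Defs.v *)
(* Points of R^d are represented as d.-tuple R,
   which carries the library's product (= Borel) sigma-algebra. *)
From HB Require Import structures.
From mathcomp Require Import all_boot all_order all_algebra.
From mathcomp Require Import all_classical all_reals all_analysis.

Set Implicit Arguments.
Unset Strict Implicit.
Unset Printing Implicit Defensive.
Import Order.TTheory GRing.Theory Num.Theory.
Import numFieldNormedType.Exports.
Local Open Scope classical_set_scope.
Local Open Scope ring_scope.

Section Defs.
Variables (R : realType) (d : nat).

Definition shift (x : d.-tuple R) (i : 'I_d) (t : R) : d.-tuple R :=
  [tuple (tnth x j + (if j == i then t else 0)) | j < d].

Definition partial (i : 'I_d) (phi : d.-tuple R -> R) : d.-tuple R -> R :=
  fun x => derive1 (fun t => phi (shift x i t)) 0.

Fixpoint dpart (s : seq 'I_d) (phi : d.-tuple R -> R) : d.-tuple R -> R :=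
  if s is i :: s' then partial i (dpart s' phi) else phi.

(** continuity on R^d (all norms on R^d are equivalent; sup-norm used) *)
Definition tcontinuous (g : d.-tuple R -> R) :=
  forall x e, 0 < e -> exists2 del, 0 < del &
    forall y, (forall i, `|tnth y i - tnth x i| < del) -> `|g y - g x| < e.

Definition smooth (phi : d.-tuple R -> R) :=
  forall s, tcontinuous (dpart s phi) /\
    forall i x, derivable (fun t => dpart s phi (shift x i t)) 0 1.

Definition compact_support (phi : d.-tuple R -> R) :=
  exists M : R, forall x, (exists i, M < `|tnth x i|) -> phi x = 0.

Definition test_fun (phi : d.-tuple R -> R) := smooth phi /\ compact_support phi.

(** mu is Lebesgue measure on (the Borel sets of) R^d: it gives boxes
    their volume; such a measure exists and is unique. *)
Definition is_lebesgue (mu : {measure set (d.-tuple R) -> \bar R}) :=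
  forall a b : d.-tuple R, (forall i, tnth a i <= tnth b i) ->
    mu [set x | forall i, tnth a i <= tnth x i < tnth b i] =
    (\prod_(i < d) (tnth b i - tnth a i))%:E.

Variable mu : {measure set (d.-tuple R) -> \bar R}.

Definition in_Lp (p : \bar R) (f : d.-tuple R -> R) :=
  measurable_fun setT f /\ ('N[mu]_p[EFin \o f] < +oo)%E.

Definition weak_grad (f : d.-tuple R -> R) (g : 'I_d -> d.-tuple R -> R) :=
  forall phi, test_fun phi -> forall i,
    (\int[mu]_x (f x * partial i phi x)%:E = - \int[mu]_x (g i x * phi x)%:E)%E.

Definition gradnorm (g : 'I_d -> d.-tuple R -> R) : d.-tuple R -> R :=
  fun x => Num.sqrt (\sum_(i < d) g i x ^+ 2).

Definition W1p (p : \bar R) (f : d.-tuple R -> R) (g : 'I_d -> d.-tuple R -> R) :=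
  in_Lp p f /\ (forall i, in_Lp p (g i)) /\ weak_grad f g.

Definition divergence (phi : 'I_d -> d.-tuple R -> R) : d.-tuple R -> R :=
  fun x => \sum_(i < d) partial i (phi i) x.

Definition var (f : d.-tuple R -> R) : \bar R :=
  ereal_sup [set (\int[mu]_x (f x * divergence phi x)%:E)%E |
    phi in [set phi : 'I_d -> d.-tuple R -> R |
      (forall i, test_fun (phi i)) /\ forall x, \sum_(i < d) phi i x ^+ 2 <= 1]].

Definition BV (f : d.-tuple R -> R) := in_Lp 1%:E f /\ (var f < +oo)%E.

Definition side (n : int) : R := 2 ^ n.

Definition dcube (n : int) (k : d.-tuple int) : set (d.-tuple R) :=
  [set x | forall i, (tnth k i)%:~R * side n <= tnth x i < ((tnth k i)%:~R + 1) * side n].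

Definition avg (f : d.-tuple R -> R) (n : int) (k : d.-tuple int) : \bar R :=
  (((side n ^+ d)^-1)%:E * \int[mu]_(x in dcube n k) (`|f x|)%:E)%E.

Definition Qalpha (alpha : R) (f : d.-tuple R -> R) : set (int * d.-tuple int) :=
  [set nk | forall (m : int) (k' : d.-tuple int),
     dcube nk.1 nk.2 `<=` dcube m k' -> dcube nk.1 nk.2 <> dcube m k' ->
     ((powR (side m) alpha)%:E * avg f m k' <
      (powR (side nk.1) alpha)%:E * avg f nk.1 nk.2)%E].

End Defs.

(* Main.v *)
(** Let [P] be the dyadic parent of a cube [Q] of [Qalpha].  Since
    [f_P <= 2^-alpha f_Q], the function oscillates on [P] on the scale of [f_P].
    A Sobolev-Poincare inequality for the truncated power
    [max (|f|, c f_P)^(1/q)], with [1 < q < d / (d - 1)], then yields, up to constants,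
      [l(P)^(d-p) f_P^p <= \int_(P, |f| > c f_P) ((f_P / |f|)^e |grad f|)^p].
    At a fixed point the averages [f_P] of the cubes containing it decrease
    geometrically in [l(P)], so those below [|f| / c] contribute a geometric series
    to the sum of the weights [(f_P / |f|)^(e p)], and summing over [Q] gives the claim.

    No Sobolev theory for [f] is required: given finitely many cubes, one replaces
    [f] by its integrals over the cells of a grid that is so fine that these
    integrals retain most of the mass of [|f|], and [grad f] by differences of
    neighbouring cells.  These differences are bounded by testing the weak gradient
    or the variation against a smoothed tent, whose derivative in direction [i] is
    the difference of the indicators of two neighbouring cells. *)

Require Import Defs.
From HB Require Import structures.
From mathcomp Require Import all_boot all_order all_algebra.
From mathcomp Require Import all_classical all_reals.
From mathcomp Require Import normedtype.
Import numFieldNormedType.Exports.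
From mathcomp Require Import all_analysis.
From mathcomp Require Import measurable_realfun ess_sup_inf.
From mathcomp Require Import zify ring lra.

Set Implicit Arguments.
Unset Strict Implicit.
Unset Printing Implicit Defensive.
Import Order.TTheory GRing.Theory Num.Theory.
Local Open Scope classical_set_scope.
Local Open Scope ring_scope.

(** Applying a Poincare inequality to [f] itself on every parent and adding up fails: a point may
    lie in cubes of many scales, so the energies on the right overlap without bound. The root and
    the truncation are there to produce a summable weight: the truncation removes the gradient where
    [|f|] is small, and the root contributes [|f|^(1/q - 1)] where it is large. The price is that
    averages of [|f|] become averages of [H^q], where [H] is the root, so the [L^q] oscillation of
    [H] must be controlled by the [L^1] norm of its gradient; this is what limits [q]. The
    truncation must not destroy the oscillation either, so [c] is a fraction of the relative gap
    between the averages on [Q] and [P]. Cell integrals of [f] carry signs and lose mass by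
    cancellation. The factor [2^alpha] between [Q] and [P] is therefore split into two equal
    factors: one absorbs the lost mass, the other remains as the gap. The bounds do not depend on
    the grid, because the powers of its mesh size cancel once differences of cells are compared with
    the gradient. *)

Lemma le_sum_subseq (R : numDomainType) (T : eqType) (s t : seq T) (F : T -> R) :
  uniq s -> {subset s <= t} -> (forall x, 0 <= F x) ->
  \sum_(x <- s) F x <= \sum_(x <- t) F x.
Proof.
elim: s t => [|x s IH] t /=; first by move=> *; rewrite big_nil sumr_ge0.
move=> /andP[xs us] st F0.
rewrite big_cons (perm_big _ (perm_to_rem (st x (mem_head _ _)))) /= big_cons.
rewrite lerD2l; apply: IH => // y ys.
have : y \in t by apply: st; rewrite inE ys orbT.
rewrite (perm_mem (perm_to_rem (st x (mem_head _ _)))) inE => /orP[/eqP yx|//].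
by rewrite -yx ys in xs.
Qed.

Lemma sum_mem_subseq (R : numDomainType) (T : eqType) (s t : seq T) (F : T -> R) :
  uniq s -> uniq t -> {subset s <= t} ->
  \sum_(x <- s) F x = \sum_(x <- t | x \in s) F x.
Proof.
move=> us ut st; rewrite -[RHS]big_filter; apply: perm_big; apply: uniq_perm => //.
  exact: filter_uniq.
move=> x; rewrite mem_filter; case: (boolP (x \in s)) => //= xs.
by rewrite st.
Qed.

(** * Dyadic cubes as sets of lattice cells *)

Section Grid.
Variable d : nat.
Local Notation Z := (d.-tuple int).
Implicit Types (x k lo : Z) (i : 'I_d) (M : nat).

Definition zshift i (j : int) x : Z :=
  [tuple tnth x l + (if l == i then j else 0) | l < d].

Lemma tnth_zshift i j x l : tnth (zshift i j x) l = tnth x l + (if l == i then j else 0).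
Proof. exact: tnth_mktuple. Qed.

Lemma zshiftD i (a b : int) x : zshift i a (zshift i b x) = zshift i (a + b) x.
Proof.
apply: eq_from_tnth => l; rewrite !tnth_zshift; case: ifP => _; last by rewrite !addr0.
by rewrite -addrA [b + a]addrC.
Qed.

Lemma zshift0 i x : zshift i 0 x = x.
Proof. by apply: eq_from_tnth => l; rewrite tnth_zshift if_same addr0. Qed.

Lemma zshift_inj i j : injective (zshift i j).
Proof. by apply: (can_inj (g := zshift i (- j))) => x; rewrite zshiftD addNr zshift0. Qed.

Definition box (lo : Z) (L : nat) : seq Z :=
  [seq ([tuple tnth lo l + (nat_of_ord (r l))%:Z | l < d] : Z) | r : {ffun 'I_d -> 'I_L} <- enum {: {ffun 'I_d -> 'I_L}}].

Lemma mem_box lo L x :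
  reflect (forall l, tnth lo l <= tnth x l < tnth lo l + L%:Z) (x \in box lo L).
Proof.
rewrite /box; apply: (iffP mapP) => [[r _ ->] l|H].
  rewrite tnth_mktuple; have := ltn_ord (r l); move: (tnth lo l) (nat_of_ord (r l)) => a b; lia.
have P l : (`|tnth x l - tnth lo l|%N < L)%N by have := H l; lia.
exists [ffun l => Ordinal (P l)]; first by rewrite mem_enum.
apply: eq_from_tnth => l; rewrite tnth_mktuple ffunE /=; have := H l; lia.
Qed.

Lemma box_uniq lo L : uniq (box lo L).
Proof.
rewrite map_inj_uniq ?enum_uniq // => r s /(congr1 (fun t => tnth t)) E.
apply/ffunP => l; have := congr1 (fun t => t l) E.
rewrite !tnth_mktuple => h; apply: val_inj => /=; lia.
Qed.

Lemma size_box lo L : size (box lo L) = (L ^ d)%N.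
Proof. by rewrite size_map -cardE card_ffun !card_ord. Qed.

(* The unit cells, identified with their lower corners, that make up the dyadic
   cube of side [2 ^ M] and index [k]. *)
Definition cells M k : seq Z := box [tuple tnth k l * (2 ^ M)%N%:Z | l < d] (2 ^ M).

Lemma mem_cells M k x : reflect
  (forall l, tnth k l * (2 ^ M)%N%:Z <= tnth x l < (tnth k l + 1) * (2 ^ M)%N%:Z)
  (x \in cells M k).
Proof.
by apply: (iffP (mem_box _ _ _)) => H l; have := H l; rewrite tnth_mktuple mulrDl mul1r.
Qed.

Lemma cells_uniq M k : uniq (cells M k). Proof. exact: box_uniq. Qed.

Lemma size_cells M k : size (cells M k) = ((2 ^ M) ^ d)%N.
Proof. exact: size_box. Qed.

Lemma cells0 k : cells 0 k = [:: k].
Proof.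
have kk : k \in cells 0 k by apply/mem_cells => l; lia.
have : size (cells 0 k) = 1%N by rewrite size_cells expn0 exp1n.
by case: (cells 0 k) kk => [|y [|]] //; rewrite inE => /eqP ->.
Qed.

Definition child k (b : {ffun 'I_d -> bool}) : Z :=
  [tuple 2 * tnth k l + (b l)%:Z | l < d].

Lemma mem_cells_child M k b x : x \in cells M (child k b) -> x \in cells M.+1 k.
Proof.
move=> /mem_cells H; apply/mem_cells => l; have := H l.
rewrite tnth_mktuple expnS; case: (b l) => /=; move: (tnth k l) (tnth x l) (2 ^ M)%N; nia.
Qed.

Lemma child_inj k b b' : child k b = child k b' -> b = b'.
Proof.
move=> /(congr1 (fun t => tnth t)) E; apply/ffunP => l.
have := congr1 (fun t => t l) E; rewrite !tnth_mktuple.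
by case: (b l); case: (b' l) => //=; lia.
Qed.

Lemma cells_inj M k k' x : x \in cells M k -> x \in cells M k' -> k = k'.
Proof.
move=> /mem_cells H /mem_cells H'; apply: eq_from_tnth => l.
have := H l; have := H' l; have : (0 < 2 ^ M)%N by rewrite expn_gt0.
by move: (tnth k l) (tnth k' l) (tnth x l) (2 ^ M)%N; nia.
Qed.

Lemma mem_cellsS M k x : x \in cells M.+1 k -> exists b, x \in cells M (child k b).
Proof.
move=> /mem_cells H.
exists [ffun l => (2 * tnth k l + 1) * (2 ^ M)%N%:Z <= tnth x l].
apply/mem_cells => l; have := H l; rewrite tnth_mktuple ffunE expnS.
case: (lerP ((2 * tnth k l + 1) * (2 ^ M)%N%:Z) (tnth x l)) => /=;
  move: (tnth k l) (tnth x l) (2 ^ M)%N; nia.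
Qed.

Lemma perm_cellsS M k :
  perm_eq (cells M.+1 k) (flatten [seq cells M (child k b) | b : {ffun 'I_d -> bool}]).
Proof.
apply: uniq_perm; first exact: cells_uniq.
  apply: (@count_mem_uniq _ _) => x; rewrite count_flatten -map_comp.
  rewrite sumnE big_map big_enum /=.
  under eq_bigr do rewrite /= count_uniq_mem ?cells_uniq//.
  have -> : (x \in flatten [seq cells M (child k b) | b : {ffun 'I_d -> bool}]) =
            [exists b, x \in cells M (child k b)].
    apply/flatten_imageP/existsP => [[b _ h]|[b h]]; first by exists b.
    by exists b.
  case: (boolP [exists b, _]) => [/existsP[b xb]|/existsPn nx].
    rewrite (bigD1 b) //= xb big1 // => b' bb'.
    case: (boolP (x \in _)) => // xb'.
    by rewrite (child_inj (cells_inj xb xb')) eqxx in bb'.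
  by rewrite big1 // => b _; rewrite (negbTE (nx b)).
move=> x; apply/idP/flatten_imageP => [/mem_cellsS[b xb]|[b _ /mem_cells_child//]].
by exists b.
Qed.

(** * Sums over cubes and the oscillation between neighbours *)

Section Csum.
Variable R : realType.
Implicit Types v H : Z -> R.

Definition csum M k v : R := \sum_(x <- cells M k) v x.

Lemma csum0 k v : csum 0 k v = v k.
Proof. by rewrite /csum cells0 big_seq1. Qed.

Lemma csumS M k v : csum M.+1 k v = \sum_b csum M (child k b) v.
Proof.
rewrite /csum (perm_big _ (perm_cellsS M k)) /= big_flatten /= big_map.
by rewrite big_enum.
Qed.

Lemma csum_shift M k i (j : int) v :
  csum M (zshift i j k) v = csum M k (v \o zshift i (j * (2 ^ M)%N%:Z)).
Proof.
rewrite /csum -[RHS](big_map (zshift i (j * (2 ^ M)%N%:Z)) xpredT v).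
apply: perm_big; apply: uniq_perm; first exact: cells_uniq.
  by rewrite map_inj_uniq ?cells_uniq//; exact: zshift_inj.
move=> x; apply/idP/mapP => [/mem_cells h|[y /mem_cells h ->]].
  exists (zshift i (- (j * (2 ^ M)%N%:Z)) x).
    apply/mem_cells => l; have := h l; rewrite !tnth_mktuple.
    by case: eqP => _; rewrite ?addr0 // !mulrDl => ?; lia.
  by rewrite zshiftD addrN zshift0.
apply/mem_cells => l; have := h l; rewrite !tnth_mktuple.
by case: eqP => _; rewrite ?addr0 // !mulrDl => ?; lia.
Qed.

(** A translate by at most the side length stays inside the cube and its neighbour, and translation
    is injective, so no cell is counted twice. *)
Lemma csum_translate_le M k i (j : nat) v : (j <= 2 ^ M)%N -> (forall x, 0 <= v x) ->
  csum M k (v \o zshift i j%:Z) <= csum M k v + csum M (zshift i 1 k) v.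
Proof.
move=> jM v0.
rewrite /csum -[leLHS](big_map (zshift i j%:Z) xpredT v) -big_cat.
apply: le_sum_subseq => //.
  by rewrite map_inj_uniq ?cells_uniq//; exact: zshift_inj.
move=> _ /mapP[y /mem_cells h ->]; rewrite mem_cat; apply/orP.
have hi := h i.
case: (leP ((tnth k i + 1) * (2 ^ M)%N%:Z) (tnth y i + j%:Z)) => c; [right|left];
  apply/mem_cells => l; have := h l; rewrite !tnth_mktuple;
  (case: (l =P i) => [->|_]; rewrite ?addr0 // !mulrDl; move: c hi; rewrite !mulrDl);
  move: (tnth k i) (tnth y i) jM; clear; move: (2 ^ M)%N => m a b jm; lia.
Qed.

Definition diffi H i x : R := `|H (zshift i 1 x) - H x|.
Definition osc H x : R := \sum_i diffi H i x.

Lemma diffi_ge0 H i x : 0 <= diffi H i x. Proof. exact: normr_ge0. Qed.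
Lemma osc_ge0 H x : 0 <= osc H x.
Proof. by apply: sumr_ge0 => i _; exact: diffi_ge0. Qed.
Lemma diffi_le_osc H i x : diffi H i x <= osc H x.
Proof.
by rewrite /osc (bigD1 i)//= lerDl; apply: sumr_ge0 => j _; exact: diffi_ge0.
Qed.
Hint Resolve diffi_ge0 osc_ge0 : core.

Lemma csum_ge0 M k v : (forall x, 0 <= v x) -> 0 <= csum M k v.
Proof. by move=> v0; apply: sumr_ge0. Qed.

Lemma diff_telescope H i x n :
  `|H (zshift i n%:Z x) - H x| <= \sum_(j < n) diffi H i (zshift i j%:Z x).
Proof.
elim: n => [|n IH]; first by rewrite zshift0 subrr normr0 big_ord0.
rewrite big_ord_recr /=.
have -> : H (zshift i n.+1%:Z x) - H x =
  (H (zshift i n%:Z x) - H x) + (H (zshift i 1 (zshift i n%:Z x)) - H (zshift i n%:Z x)).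
  by rewrite zshiftD intS; ring.
by apply: le_trans (ler_normD _ _) _; rewrite lerD.
Qed.

(** Telescoping in direction [i] takes [2 ^ M] unit steps, and by [csum_translate_le] each of them
    costs at most the differences in the two cubes. *)
Lemma csum_neighbour_le M k i H :
  `|csum M (zshift i 1 k) H - csum M k H| <=
  (2 ^+ M) * (csum M k (diffi H i) + csum M (zshift i 1 k) (diffi H i)).
Proof.
rewrite csum_shift mul1r /csum -sumrB.
apply: le_trans (ler_norm_sum _ _ _) _.
apply: (@le_trans _ _ (\sum_(x <- cells M k) \sum_(j < 2 ^ M) diffi H i (zshift i j%:Z x))).
  by apply: ler_sum => x _; exact: diff_telescope.
rewrite exchange_big /= .
apply: (@le_trans _ _ (\sum_(j < 2 ^ M) (csum M k (diffi H i) + csum M (zshift i 1 k) (diffi H i)))).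
  by apply: ler_sum => j _; apply: csum_translate_le => //; exact: ltnW.
by rewrite sumr_const card_ord -[leLHS]mulr_natl natrX.
Qed.

Lemma csum_child_le M k b v : (forall x, 0 <= v x) -> csum M (child k b) v <= csum M.+1 k v.
Proof.
move=> v0; rewrite csumS (bigD1 b)//= lerDl; apply: sumr_ge0 => c _; exact: csum_ge0.
Qed.

Lemma csum_child2_le M k b c v : b != c -> (forall x, 0 <= v x) ->
  csum M (child k b) v + csum M (child k c) v <= csum M.+1 k v.
Proof.
move=> bc v0; rewrite csumS (bigD1 b)//= lerD2l (bigD1 c) 1?eq_sym//= lerDl.
by apply: sumr_ge0 => e _; exact: csum_ge0.
Qed.

(** Children that differ in one coordinate are neighbours; as they are disjoint inside the parent,
    their sums of [osc] add up to at most that of the parent. *)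
Lemma csum_flip_le M k (b c : {ffun 'I_d -> bool}) i H :
  (forall l, l != i -> b l = c l) ->
  `|csum M (child k b) H - csum M (child k c) H| <= 2 ^+ M * csum M.+1 k (osc H).
Proof.
wlog : b c / (b i <= c i)%N => [hw bc|bci bc].
  have [h|h] := leqP (b i) (c i); first exact: hw.
  by rewrite distrC; apply: hw => [|l li]; [exact: ltnW|rewrite bc].
have [<-|nbc] := eqVneq b c.
  by rewrite subrr normr0 mulr_ge0 ?exprn_ge0 ?csum_ge0.
have bi : b i = false /\ c i = true.
  have : b i <> c i.
    move=> h; move/eqP: nbc; apply; apply/ffunP => l.
    by have [->|/bc] := eqVneq l i.
  by move: bci; case: (b i); case: (c i).
have -> : child k c = zshift i 1 (child k b).
  apply: eq_from_tnth => l; rewrite !tnth_mktuple.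
  have [->|li] := eqVneq l i; first by case: bi => -> -> /=; lia.
  by rewrite bc// addr0.
rewrite distrC; apply: le_trans (csum_neighbour_le _ _ _ _) _.
rewrite ler_wpM2l ?exprn_ge0//.
apply: (@le_trans _ _ (csum M (child k b) (osc H) + csum M (zshift i 1 (child k b)) (osc H))).
  by apply: lerD; apply: ler_sum => x _; exact: diffi_le_osc.
have <- : child k c = zshift i 1 (child k b).
  apply: eq_from_tnth => l; rewrite !tnth_mktuple.
  have [->|li] := eqVneq l i; first by case: bi => -> -> /=; lia.
  by rewrite bc// addr0.
exact: csum_child2_le.
Qed.

Lemma csum_children_le M k (b c : {ffun 'I_d -> bool}) H :
  `|csum M (child k b) H - csum M (child k c) H| <=
  d%:R * 2 ^+ M * csum M.+1 k (osc H).
Proof.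
suff gen (s : seq 'I_d) (b' : {ffun 'I_d -> bool}) : (forall l, l \notin s -> b' l = c l) ->
  `|csum M (child k b') H - csum M (child k c) H| <=
    (size s)%:R * (2 ^+ M * csum M.+1 k (osc H)).
  have := gen (enum 'I_d) b; rewrite size_enum_ord -mulrA; apply => l.
  by rewrite mem_enum.
elim: s b' => [|i s IH] b' bc.
  have -> : b' = c by apply/ffunP => l; rewrite bc.
  by rewrite subrr normr0 mul0r.
(* The coordinates are changed one at a time: [e] agrees with [c] at [i] and with [b'] elsewhere. *)
pose e : {ffun 'I_d -> bool} := [ffun l => if l == i then c l else b' l].
have -> : csum M (child k b') H - csum M (child k c) H =
  (csum M (child k b') H - csum M (child k e) H) +
  (csum M (child k e) H - csum M (child k c) H) by ring.
apply: le_trans (ler_normD _ _) _.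
rewrite /= mulrS mulrDl mul1r; apply: lerD.
  by apply: (@csum_flip_le M k _ _ i) => l /negbTE li; rewrite ffunE li.
apply: IH => l ls; rewrite ffunE; case: eqVneq => // li.
by rewrite bc// inE negb_or li.
Qed.

End Csum.
End Grid.

(** * Inequalities for real powers *)

Section Powers.
Variable R : realType.
Implicit Types a b p q s : R.

Lemma le_powR a b q : 0 <= q -> 0 <= a -> a <= b -> a `^ q <= b `^ q.
Proof. by move=> q0 a0 ab; apply: ge0_ler_powR => //; rewrite nnegrE// (le_trans a0). Qed.

Lemma powR_splitl a q : 1 <= q -> 0 <= a -> a `^ q = a * a `^ (q - 1).
Proof. by move=> q1 a0; rewrite mulr_powRB1// (lt_le_trans ltr01). Qed.

Lemma sum_powR_le (I : finType) (a : I -> R) q : 1 <= q -> (forall i, 0 <= a i) ->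
  \sum_i (a i) `^ q <= (\sum_i a i) `^ q.
Proof.
move=> q1 a0; rewrite powR_splitl ?sumr_ge0// mulr_suml; apply: ler_sum => i _.
rewrite powR_splitl// ler_wpM2l// le_powR// ?subr_ge0//.
by rewrite (bigD1 i)//= lerDl sumr_ge0.
Qed.

(** Either [b <= del * a] or [a < del^-1 * b], and one term suffices. For small [del] the factor of
    [a^q] is close to 1, which keeps the induction in [sobolev_poincare] contracting. *)
Lemma powR_add_le a b q del : 0 < del -> 0 <= q -> 0 <= a -> 0 <= b ->
  (a + b) `^ q <= (1 + del) `^ q * a `^ q + (1 + del^-1) `^ q * b `^ q.
Proof.
move=> d0 q0 a0 b0.
have di : 0 < del^-1 by rewrite invr_gt0.
have d1 : 0 <= 1 + del by rewrite addr_ge0// ltW.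
have i1 : 0 <= 1 + del^-1 by rewrite addr_ge0// ltW.
rewrite -!powRM//.
have [h|h] := leP b (del * a).
  by apply: ler_wpDr; rewrite ?powR_ge0// le_powR ?addr_ge0// mulrDl mul1r lerD2l.
apply: ler_wpDl; rewrite ?powR_ge0// le_powR ?addr_ge0// mulrDl mul1r addrC lerD2l//.
by rewrite mulrC ler_pdivlMr// mulrC ltW.
Qed.

(** If [s < a], then [a^(1-p) <= s^(1-p)]. For fixed [s] the bound is affine in [a^p], so it can be
    summed or integrated; choosing [s] afterwards gives Jensen's inequality. *)
Lemma young_shift a s p : 1 <= p -> 0 <= a -> 0 < s -> a <= s `^ (1 - p) * a `^ p + s.
Proof.
move=> p1 a0 s0; have [as_|sa] := leP a s.
  by apply: le_trans as_ _; rewrite lerDr mulr_ge0 ?powR_ge0.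
apply: (@le_trans _ _ (s `^ (1 - p) * a `^ p)); last by rewrite lerDl ltW.
rewrite (powR_splitl p1 a0) mulrCA ler_peMr//.
rewrite -[1 - p]opprB powRN ler_pdivlMl ?powR_gt0// mulr1.
by rewrite le_powR ?subr_ge0// ltW.
Qed.

(* Jensen's inequality up to a constant: integrate [young_shift] and take [s = I / (2 V)]. *)
Lemma jensen_of_young p (I J V : R) : 1 <= p -> 0 <= I -> 0 < V ->
  (forall s, 0 < s -> I <= s `^ (1 - p) * J + s * V) ->
  I `^ p <= 2 `^ p * V `^ (p - 1) * J.
Proof.
move=> p1 I0 V0 H.
(* [H] itself forces this: for negative [J] its right side is negative at the small [s] below, since
   there [s^(1-p) >= 1] and [s * V <= - J / 2]. *)
have J0 : 0 <= J.
  rewrite leNgt; apply/negP => J0.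
  have := H 1 ltr01; rewrite powR1 !mul1r => h1.
  pose s := Num.min 1 (- J / (2 * V)).
  have s0 : 0 < s.
    by rewrite lt_min ltr01 divr_gt0 ?mulr_gt0// oppr_gt0.
  have := H s s0.
  have s1 : s <= 1 by rewrite ge_min lexx.
  have : s * V <= - J / 2.
    have : s <= - J / (2 * V) by rewrite ge_min lexx orbT.
    by rewrite -(ler_pM2r V0) => /le_trans; apply; rewrite invfM -!mulrA mulVf ?mulr1 ?gt_eqF.
  have : 1 <= s `^ (1 - p).
    rewrite -[1 - p]opprB powRN -[leLHS]invr1 lef_pV2 ?posrE ?powR_gt0//.
    apply: (@le_trans _ _ (1 `^ (p - 1))); last by rewrite powR1.
    by rewrite le_powR ?subr_ge0// ltW.
  move: (s `^ (1 - p)) (s * V) => a b; nra.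
have [->|nI] := eqVneq I 0.
  rewrite powR0 ?gt_eqF ?(lt_le_trans ltr01)//.
  by rewrite !mulr_ge0 ?powR_ge0.
have Ip : 0 < I by rewrite lt_def nI.
pose s := I / (2 * V).
have s0 : 0 < s by rewrite divr_gt0 ?mulr_gt0.
have := H s s0.
have -> : s * V = I / 2 by rewrite /s invfM -!mulrA mulVf ?mulr1 ?gt_eqF.
move=> h; have {}h : I <= s `^ (1 - p) * (2 * J).
  by move: h; move: (s `^ _) => a; lra.
have {}h : I * s `^ (p - 1) <= 2 * J.
  by move: h; rewrite -[1 - p]opprB powRN mulrC ler_pdivlMr ?powR_gt0.
have e : I `^ p = (2 * V) `^ (p - 1) * (I * s `^ (p - 1)).
  rewrite (powR_splitl p1 I0) mulrCA -powRM ?(ltW s0) ?mulr_ge0 ?(ltW V0)//.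
  by rewrite /s mulrCA divff ?mulr1// mulf_neq0 ?gt_eqF.
rewrite e; apply: (@le_trans _ _ ((2 * V) `^ (p - 1) * (2 * J))).
  by rewrite ler_wpM2l ?powR_ge0.
rewrite powRM ?(ltW V0)// (@powR_splitl 2 p p1)// le_eqVlt; apply/orP; left; apply/eqP.
by ring.
Qed.

Lemma jensen_sum (T : eqType) (s : seq T) (a : T -> R) p (n : R) : 1 <= p ->
  (forall x, 0 <= a x) -> 0 < n -> (size s)%:R <= n ->
  (\sum_(x <- s) a x) `^ p <= 2 `^ p * n `^ (p - 1) * \sum_(x <- s) (a x) `^ p.
Proof.
move=> p1 a0 n0 sn; apply: jensen_of_young => //; first exact: sumr_ge0.
move=> t t0; rewrite mulr_sumr.
apply: (@le_trans _ _ (\sum_(x <- s) (t `^ (1 - p) * a x `^ p + t))).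
  by apply: ler_sum => x _; exact: young_shift.
rewrite big_split /= lerD2l big_const_seq count_predT iter_addr_0.
by rewrite -[leLHS]mulr_natr ler_wpM2l// ltW.
Qed.

(** This is the tangent line of a convex function. Young's inequality for the product [a^(q-1) * b],
    with the conjugate exponents [q / (q - 1)] and [q], covers both orders of [a] and [b] at
    once. *)
Lemma powR_tangent a b q : 1 < q -> 0 <= a -> 0 <= b ->
  a `^ q - b `^ q <= q * a `^ (q - 1) * (a - b).
Proof.
move=> q1 a0 b0.
have q0 : 0 < q by apply: lt_trans q1.
have qm : 0 < q - 1 by rewrite subr_gt0.
have := @conjugate_powR R (a `^ (q - 1)) b (q / (q - 1)) q (powR_ge0 _ _) b0.
rewrite divr_gt0// q0 => /(_ isT isT).
have -> : (q / (q - 1))^-1 + q^-1 = 1 by field; rewrite ?gt_eqF.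
move=> /(_ erefl); rewrite -powRrM.
have -> : (q - 1) * (q / (q - 1)) = q by field; rewrite gt_eqF.
have -> : a `^ q / (q / (q - 1)) + b `^ q / q = ((q - 1) * a `^ q + b `^ q) / q.
  by field; rewrite ?gt_eqF.
rewrite ler_pdivlMr// => h.
have e : a `^ q = a * a `^ (q - 1) by rewrite powR_splitl// ltW.
move: h; rewrite e; move: (a `^ (q - 1)) (b `^ q) => x y; nra.
Qed.

(** The mean value bound has the derivative at the larger number [m]. Since [m <= 2 * b] or
    [m <= 2 * |a - b|], it can be moved to [b], which in the application is an average and hence
    constant on the cube. *)
Lemma powR_diff_le a b q : 1 < q -> 0 <= a -> 0 <= b ->
  `|a `^ q - b `^ q| <= q * 2 `^ q * (b `^ (q - 1) * `|a - b| + `|a - b| `^ q).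
Proof.
move=> q1 a0 b0.
have q0 : 0 < q by apply: lt_trans q1.
have qm : 0 < q - 1 by rewrite subr_gt0.
pose m := Num.max a b.
have m0 : 0 <= m by rewrite le_max a0.
apply: (@le_trans _ _ (q * m `^ (q - 1) * `|a - b|)).
  have gen x y : 0 <= x -> 0 <= y -> y <= x ->
      `|x `^ q - y `^ q| <= q * x `^ (q - 1) * `|x - y|.
    move=> x0 y0 yx; rewrite !ger0_norm ?subr_ge0 ?le_powR ?(ltW q0)//.
    exact: powR_tangent.
  rewrite /m; have [ba|ab] := leP b a; first exact: gen.
  by rewrite distrC (distrC a); apply: gen => //; exact: ltW.
rewrite -!mulrA ler_pM2l//.
have mle : m `^ (q - 1) <= 2 `^ (q - 1) * (b `^ (q - 1) + `|a - b| `^ (q - 1)).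
  have : m <= 2 * b \/ m <= 2 * `|a - b|.
    rewrite /m /Num.max; case: ifP => _; first by left; lra.
    have [h|h] := leP a (2 * b); first by left.
    right; rewrite ger0_norm; lra.
  rewrite mulrDr -!powRM// => -[h|h].
    by apply: ler_wpDr; rewrite ?powR_ge0// le_powR// ltW.
  by apply: ler_wpDl; rewrite ?powR_ge0// le_powR// ltW.
apply: (@le_trans _ _ (2 `^ (q - 1) * (b `^ (q - 1) + `|a - b| `^ (q - 1)) * `|a - b|)).
  by rewrite ler_wpM2r.
rewrite (powR_splitl (ltW q1) (normr_ge0 (a - b))) (powR_splitl (ltW q1) (ler0n R 2)).
have := powR_ge0 2 (q - 1); have := powR_ge0 b (q - 1); have := powR_ge0 `|a - b| (q - 1).
have := normr_ge0 (a - b).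
move: (2 `^ _) (b `^ _) => x y; move: (`|a - b| `^ _) => z; move: `|a - b| => t t0 z0 y0 x0.
have : 0 <= x * (y * t + t * z) by rewrite mulr_ge0// addr_ge0// mulr_ge0.
lra.
Qed.

(* [a^(1/q) - s^(1/q) <= a^(1/q - 1) (a - s)], because [s^(1/q) >= s a^(1/q - 1)]. *)
Lemma root_diff_le a s r : 0 < r -> r <= 1 -> 0 < a -> 0 <= s -> s <= a ->
  a `^ r - s `^ r <= a `^ (r - 1) * (a - s).
Proof.
move=> r0 r1 a0 s0 sa.
have -> : a `^ r = a `^ (r - 1) * a.
  by rewrite -[X in _ * X](powRr1 (ltW a0)) -powRD ?subrK// (gt_eqF a0) implybT.
rewrite mulrBr lerD2l lerN2.
have [->|nz] := eqVneq s 0; first by rewrite mulr0 powR_ge0.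
have sp : 0 < s by rewrite lt_def nz.
have -> : s `^ r = s `^ (r - 1) * s.
  by rewrite -[X in _ * X](powRr1 s0) -powRD ?subrK// (gt_eqF sp) implybT.
rewrite ler_wpM2r// -[r - 1]opprB !powRN lef_pV2 ?posrE ?powR_gt0//.
by rewrite le_powR ?subr_ge0.
Qed.

End Powers.

(** * A discrete Sobolev-Poincare inequality *)

Section SobolevPoincare.
Variables (R : realType) (d : nat).
Hypothesis d_gt0 : (0 < d)%N.
Local Notation Z := (d.-tuple int).
Implicit Types (k : Z) (M : nat) (H u v : Z -> R).

Local Notation W := (2 ^+ d : R).

Definition cavg M k v : R := csum M k v / W ^+ M.

(* The side length times the average of the discrete gradient of [H]. *)
Definition cosc M k H : R := 2 ^+ M / W ^+ M * csum M k (osc H).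

Let W_gt0 : 0 < W. Proof. by rewrite exprn_gt0. Qed.
Let WM_gt0 M : 0 < W ^+ M. Proof. by rewrite exprn_gt0. Qed.
Let W2 : W / 2 = 2 ^+ d.-1.
Proof. by rewrite -{1}(prednK d_gt0) exprSr mulfK. Qed.

Lemma card_children : #|{: {ffun 'I_d -> bool}}| = (2 ^ d)%N.
Proof. by rewrite card_ffun card_bool card_ord. Qed.

Lemma sum_children_const (x : R) : \sum_(b : {ffun 'I_d -> bool}) x = W * x.
Proof. by rewrite sumr_const card_children -[LHS]mulr_natl natrX. Qed.

Lemma csum_const M k (c : R) : csum M k (fun=> c) = c * W ^+ M.
Proof.
rewrite /csum big_const_seq count_predT iter_addr_0 size_cells -[LHS]mulr_natr.
by rewrite !natrX -!exprM mulnC.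
Qed.

Lemma cosc_ge0 M k H : 0 <= cosc M k H.
Proof.
by rewrite mulr_ge0 ?csum_ge0 ?divr_ge0 ?exprn_ge0// => x; exact: osc_ge0.
Qed.

(** A child has half the side and the fraction [1 / W] of the volume, while the sums of [osc] over
    the children add up to that of the parent. *)
Lemma cosc_children M k H :
  \sum_b cosc M (child k b) H = W / 2 * cosc M.+1 k H.
Proof.
rewrite /cosc -mulr_sumr -csumS mulrA; congr (_ * _).
by rewrite (exprS W M) (exprS 2 M); field; rewrite !gt_eqF// exprn_gt0.
Qed.

Lemma cavg_child_diff M k b H :
  `|cavg M (child k b) H - cavg M.+1 k H| <= d%:R * (W / 2) * cosc M.+1 k H.
Proof.
have e : cavg M (child k b) H - cavg M.+1 k H =
    (\sum_c (csum M (child k b) H - csum M (child k c) H)) / W ^+ M.+1.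
  rewrite sumrB sum_children_const -(csumS M k H) /cavg (exprS W M).
  by field; rewrite !gt_eqF// exprn_gt0.
rewrite e normrM (ger0_norm (x := _^-1)) ?invr_ge0 ?exprn_ge0//.
rewrite ler_pdivrMr//; apply: le_trans (ler_norm_sum _ _ _) _.
apply: (@le_trans _ _ (\sum_(c : {ffun 'I_d -> bool}) d%:R * 2 ^+ M * csum M.+1 k (osc H))).
  by apply: ler_sum => c _; exact: csum_children_le.
rewrite sum_children_const /cosc le_eqVlt; apply/orP; left.
by apply/eqP; rewrite (exprS W M) (exprS 2 M); field; rewrite !gt_eqF// exprn_gt0.
Qed.

(* The number (2^(d-1))^q / 2^d, which is the factor gained in each step of the
   induction, is less than 1 exactly below the Sobolev exponent d / (d - 1). *)
Lemma sobolev_poincare (q : R) : 1 <= q -> (d%:R - 1) * q < d%:R ->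
  exists2 K : R, 0 <= K & forall M k H,
    csum M k (fun x => `|H x - cavg M k H| `^ q) <= W ^+ M * (K * cosc M k H `^ q).
Proof.
move=> q1 qd.
have q0 : 0 < q by apply: lt_le_trans q1.
pose lam : R := (W / 2) `^ q / W.
have lam0 : 0 < lam by rewrite divr_gt0 ?powR_gt0// divr_gt0.
have lam1 : lam < 1.
  rewrite ltr_pdivrMr// mul1r W2 -!powR_mulrn// -powRrM.
  rewrite -subn1 natrB//.
  rewrite /powR !ifF ?gt_eqF// ltr_expR ltr_pM2r// ln_gt0// ltr1n//.
(* With this [del] the product [(1 + del)^q * lam] is the square root of [lam], still less than
   1. *)
pose del : R := lam `^ (- (2 * q)^-1) - 1.
have del0 : 0 < del.
  rewrite subr_gt0 /powR gt_eqF// -[ltLHS]expR0 ltr_expR.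
  by rewrite nmulr_rgt0 ?ln_lt0 ?lam0// oppr_lt0 invr_gt0 mulr_gt0.
have dl : (1 + del) `^ q * lam = lam `^ 2^-1.
  rewrite /del addrC subrK -powRrM.
  have -> : - (2 * q)^-1 * q = - 2^-1 :> R by field; rewrite gt_eqF.
  rewrite -{2}(powRr1 (ltW lam0)) -powRD ?(gt_eqF lam0) ?implybT//.
  by congr (_ `^ _); field.
pose rho := lam `^ 2^-1.
have rho1 : rho < 1.
  by rewrite /rho /powR gt_eqF// -[ltRHS]expR0 ltr_expR pmulr_rlt0 ?ln_lt0 ?lam0 ?invr_gt0.
pose C2 : R := (1 + del^-1) `^ q * (d%:R * (W / 2)) `^ q.
have C20 : 0 <= C2 by rewrite mulr_ge0 ?powR_ge0.
(* The fixed point of [K = rho * K + C2]: the constant reproduces itself at every level. *)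
exists (C2 / (1 - rho)); first by rewrite divr_ge0// subr_ge0 ltW.
set K := C2 / _.
have K0 : 0 <= K by rewrite divr_ge0// subr_ge0 ltW.
have Ke : rho * K + C2 = K by rewrite /K; field; rewrite gt_eqF// subr_gt0.
elim=> [|M IH] k H.
  rewrite csum0 /cavg csum0 expr0 divr1 subrr normr0 powR0 ?gt_eqF// mul1r.
  by rewrite mulr_ge0 ?powR_ge0.
set A := cavg M.+1 k H; set G := cosc M.+1 k H.
have G0 : 0 <= G by exact: cosc_ge0.
rewrite csumS.
apply: (@le_trans _ _ (\sum_(b : {ffun 'I_d -> bool})
   ((1 + del) `^ q * (W ^+ M * (K * cosc M (child k b) H `^ q)) +
     W ^+ M * (C2 * G `^ q)))).
  apply: ler_sum => b _.
  set B := cavg M (child k b) H.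
  apply: (@le_trans _ _ (csum M (child k b)
     (fun x => (1 + del) `^ q * `|H x - B| `^ q + (1 + del^-1) `^ q * `|B - A| `^ q))).
    apply: ler_sum => x _.
    apply: le_trans (powR_add_le del0 (ltW q0) (normr_ge0 _) (normr_ge0 _)).
    rewrite le_powR// ?(ltW q0)//.
    have -> : H x - A = (H x - B) + (B - A) by ring.
    exact: ler_normD.
  rewrite /csum big_split /= -mulr_sumr; apply: lerD.
    by rewrite ler_wpM2l ?powR_ge0//; exact: IH.
  rewrite -/(csum M (child k b) (fun=> _)) csum_const mulrC ler_wpM2l ?(ltW (WM_gt0 _))//.
  rewrite /C2 -mulrA ler_wpM2l ?powR_ge0// -powRM ?cosc_ge0// ?mulr_ge0// ?divr_ge0 ?(ltW W_gt0)//.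
  rewrite le_powR// ?(ltW q0)//; exact: cavg_child_diff.
rewrite big_split /= sum_children_const -mulr_sumr -mulr_sumr -mulr_sumr.
(* As [q >= 1], the sum of the [q]-th powers over the children is at most the [q]-th power of the
   sum, which is [W / 2 * G]. This produces [lam]. *)
apply: (@le_trans _ _ ((1 + del) `^ q * (W ^+ M * (K * (W / 2 * G) `^ q)) +
    W * (W ^+ M * (C2 * G `^ q)))).
  rewrite lerD2r !ler_wpM2l ?powR_ge0 ?(ltW (WM_gt0 _))//.
  rewrite -cosc_children; apply: sum_powR_le => // b; exact: cosc_ge0.
rewrite powRM ?divr_ge0 ?(ltW W_gt0)//.
have -> : (W / 2) `^ q = lam * W by rewrite /lam divfK// gt_eqF.
rewrite -[in leRHS]Ke /rho exprS -dl le_eqVlt; apply/orP; left; apply/eqP; ring.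
Qed.

End SobolevPoincare.

(** * The discrete energy inequality *)

Section CubeEnergy.
Variables (R : realType) (d : nat).
Hypothesis d_gt0 : (0 < d)%N.
Local Notation Z := (d.-tuple int).
Implicit Types (k : Z) (M : nat) (H u v : Z -> R).

Local Notation W := (2 ^+ d : R).

Let W_gt0 : 0 < W. Proof. by rewrite exprn_gt0. Qed.
Let WM_gt0 M : 0 < W ^+ M. Proof. by rewrite exprn_gt0. Qed.

Lemma ler_cavg M k u v : (forall x, u x <= v x) -> cavg M k u <= cavg M k v.
Proof. by move=> uv; rewrite ler_pM2r ?invr_gt0//; apply: ler_sum. Qed.

Lemma cavgD M k u v : cavg M k (fun x => u x + v x) = cavg M k u + cavg M k v.
Proof. by rewrite /cavg /csum big_split mulrDl. Qed.

Lemma cavgZ M k (a : R) u : cavg M k (fun x => a * u x) = a * cavg M k u.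
Proof. by rewrite /cavg /csum -mulr_sumr mulrA. Qed.

Lemma cavg_const M k (a : R) : cavg M k (fun=> a) = a.
Proof. by rewrite /cavg csum_const mulfK// gt_eqF. Qed.

Lemma cavg_ge0 M k u : (forall x, 0 <= u x) -> 0 <= cavg M k u.
Proof. by move=> u0; rewrite divr_ge0 ?csum_ge0// ltW. Qed.

Lemma cavg_child_le M k b u : (forall x, 0 <= u x) ->
  cavg M (child k b) u <= W * cavg M.+1 k u.
Proof.
move=> u0; have -> : W * cavg M.+1 k u = csum M.+1 k u / W ^+ M.
  by rewrite /cavg (exprS W M); field; rewrite !gt_eqF// exprn_gt0.
by rewrite ler_pM2r ?invr_gt0//; exact: csum_child_le.
Qed.

(** The jump from parent to child makes [F = max (u, c m)] oscillate in mean by a multiple of [m].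
    As [F = H^q], the bound [powR_diff_le] and the Sobolev-Poincare inequality with exponents 1 and
    [q] estimate that oscillation by a multiple of [t^(q-1) * G], where [t = m^(1/q)] and [G] is
    [cosc] of [H]. Since [m = t^q], dividing by [t^(q-1)] leaves a bound of [t] by [G]. *)
Lemma truncated_oscillation (A0 : R) : 1 < A0 ->
  exists c r C : R, [/\ 0 < c, 0 < r, r < 1, 0 <= C &
    forall u M k b, (forall x, 0 <= u x) -> 0 < cavg M.+1 k u ->
      A0 * cavg M.+1 k u <= cavg M (child k b) u ->
      cavg M.+1 k u `^ r <=
      C * cosc M.+1 k (fun x => Num.max (u x) (c * cavg M.+1 k u) `^ r)].
Proof.
move=> A01.
(* any exponent strictly between [1] and [d / (d - 1)] *)
pose q : R := 1 + (2 * d%:R)^-1.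
have dR : 0 < d%:R :> R by rewrite ltr0n.
have q1 : 1 < q by rewrite ltrDl invr_gt0 mulr_gt0.
have q0 : 0 < q by exact: lt_trans q1.
have qd : (d%:R - 1) * q < d%:R.
  have h : d%:R * (2 * d%:R)^-1 = 2^-1 :> R by field; rewrite gt_eqF.
  have h0 : 0 < (2 * d%:R)^-1 :> R by rewrite invr_gt0 mulr_gt0.
  rewrite /q; move: h h0; move: (2 * d%:R)^-1 => a h h0; nra.
have [K1 K10 SP1] := sobolev_poincare d_gt0 (lexx 1) (ltac:(lra) : (d%:R - 1) * 1 < d%:R :> R).
have [Kq Kq0 SPq] := sobolev_poincare d_gt0 (ltW q1) qd.
(* Truncation raises the parent's average to at most [(1 + c) * m], while the child's is at least
   [A0 * m = (1 + 2 c) * m]; a gap of [c * m] is left. *)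
pose c := (A0 - 1) / 2.
have c0 : 0 < c by rewrite divr_gt0// subr_gt0.
pose B := (2 + c) `^ (q - 1) * K1 + Kq.
have B0 : 0 <= B by rewrite addr_ge0// mulr_ge0// powR_ge0.
pose C2 := (W + 1) * (q * 2 `^ q) * B.
have C20 : 0 <= C2.
  by rewrite !mulr_ge0 ?powR_ge0// ?(ltW q0)// addr_ge0// (ltW W_gt0).
exists c, q^-1, (Num.max 1 (2 * C2 / c)); split => //.
- by rewrite invr_gt0.
- by rewrite invf_lt1.
- by rewrite le_max ler01.
move=> u M k b u0 m0 hm.
set m := cavg M.+1 k u in m0 hm *.
pose F x := Num.max (u x) (c * m).
pose H x := F x `^ q^-1.
rewrite -/H.
have F0 x : 0 <= F x by rewrite le_max u0.
have H0 x : 0 <= H x by exact: powR_ge0.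
have HF x : H x `^ q = F x by rewrite -powRrM mulVf ?gt_eqF// powRr1.
set A := cavg M.+1 k H; set G := cosc M.+1 k H.
have G0 : 0 <= G by exact: cosc_ge0.
have A0' : 0 <= A by exact: cavg_ge0.
pose t := m `^ q^-1; rewrite -/t.
have t0 : 0 < t by exact: powR_gt0.
have tq : m = t `^ q by rewrite -powRrM mulVf ?gt_eqF// powRr1// ltW.
have FP : cavg M.+1 k F <= (1 + c) * m.
  rewrite mulrDl mul1r -[X in _ + X](cavg_const M.+1 k (c * m)) -cavgD.
  apply: ler_cavg => x; rewrite /F ge_max lerDl lerDr u0.
  by rewrite mulr_ge0 ?(ltW c0) ?(ltW m0).
have FQ : A0 * m <= cavg M (child k b) F.
  by apply: le_trans hm _; apply: ler_cavg => x; rewrite le_max lexx.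
pose D x : R := `|F x - A `^ q|.
have D0 x : 0 <= D x by exact: normr_ge0.
(* Both averages are compared with the constant [A^q]; the mean deviation on the child is at most
   [W] times that on the parent. *)
have S2 : c * m <= (W + 1) * cavg M.+1 k D.
  have h1 : cavg M (child k b) F <= A `^ q + cavg M (child k b) D.
    rewrite -[X in X + _](cavg_const M (child k b) (A `^ q)) -cavgD.
    by apply: ler_cavg => x; rewrite -lerBlDl ler_norm.
  have h2 : A `^ q <= cavg M.+1 k F + cavg M.+1 k D.
    rewrite -[leLHS](cavg_const M.+1 k (A `^ q)) -cavgD.
    by apply: ler_cavg => x; rewrite -lerBlDl /D distrC ler_norm.
  have h3 := cavg_child_le M k b D0.
  have : A0 = 1 + 2 * c by rewrite /c; field.
  move: h1 h2 h3 FP FQ => + + + + + e; rewrite e.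
  move: (cavg M (child k b) F) (cavg M.+1 k F) (cavg M (child k b) D) (cavg M.+1 k D).
  by move: (A `^ q) W => a1 a2 a3 a4 a5 a6; lra.
(* This averages [y^(1/q) <= 1 + y] for [y = F x / m]. *)
have At : A <= (2 + c) * t.
  apply: (@le_trans _ _ (cavg M.+1 k (fun x => t + t / m * F x))).
    apply: ler_cavg => x; rewrite /H.
    have -> : F x = m * (F x / m) by rewrite mulrC divfK// gt_eqF.
    have y0 : 0 <= F x / m by rewrite divr_ge0// ltW.
    rewrite powRM// ?(ltW m0)// -/t.
    have -> : t + t / m * (m * (F x / m)) = t * (1 + F x / m).
      by field; rewrite gt_eqF.
    rewrite ler_wpM2l ?(ltW t0)//.
    move: y0; move: (F x / m) => y y0; have [y1|y1] := leP y 1.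
      apply: (@le_trans _ _ (1 `^ q^-1)); last by rewrite powR1 lerDl.
      by rewrite le_powR// invr_ge0 ltW.
    apply: (@le_trans _ _ y); last by rewrite lerDr.
    by apply: ler1_powR; rewrite ?ltW// invf_lt1.
  rewrite cavgD cavg_const cavgZ.
  have : t / m * cavg M.+1 k F <= t / m * ((1 + c) * m).
    by rewrite ler_wpM2l// divr_ge0// ltW.
  have -> : t / m * ((1 + c) * m) = (1 + c) * t by field; rewrite gt_eqF.
  lra.
have S3 : cavg M.+1 k D <= q * 2 `^ q * (A `^ (q - 1) * (K1 * G) + Kq * G `^ q).
  apply: (@le_trans _ _ (cavg M.+1 k (fun x =>
     q * 2 `^ q * (A `^ (q - 1) * `|H x - A| `^ 1 + `|H x - A| `^ q)))).
    apply: ler_cavg => x; rewrite /D -HF powRr1//.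
    exact: powR_diff_le.
  rewrite cavgZ cavgD cavgZ ler_wpM2l ?mulr_ge0 ?powR_ge0 ?(ltW q0)//.
  apply: lerD; first rewrite ler_wpM2l ?powR_ge0//.
    by rewrite /cavg ler_pdivrMr// mulrC; have := SP1 M.+1 k H; rewrite powRr1.
  by rewrite /cavg ler_pdivrMr// mulrC; exact: SPq.
rewrite maxr_pMl//.
(* If [t <= G], the 1 in the constant suffices. Otherwise [G^q <= t^(q-1) * G], and both terms of
   [S3] take the same form. *)
have [tG|Gt] := leP t G; first by rewrite le_max mul1r tG.
have tq1 : t `^ q = t * t `^ (q - 1) by rewrite powR_splitl ?(ltW q1)// ltW.
have S4 : A `^ (q - 1) * (K1 * G) + Kq * G `^ q <= B * (t `^ (q - 1) * G).
  rewrite /B mulrDl; apply: lerD.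
    have -> : (2 + c) `^ (q - 1) * K1 * (t `^ (q - 1) * G) =
       ((2 + c) `^ (q - 1) * t `^ (q - 1)) * (K1 * G) by ring.
    apply: ler_wpM2r; first exact: mulr_ge0.
    rewrite -powRM; [|by rewrite addr_ge0// ltW|exact: ltW].
    by rewrite le_powR// subr_ge0 ltW.
  rewrite ler_wpM2l// (powR_splitl (ltW q1) G0) mulrC ler_wpM2r//.
  by rewrite le_powR ?subr_ge0// ltW.
rewrite le_max; apply/orP; right.
have tp : 0 < t `^ (q - 1) by exact: powR_gt0.
have : c * (t * t `^ (q - 1)) <= C2 * (t `^ (q - 1) * G).
  rewrite -tq1 -tq; apply: le_trans S2 _; rewrite /C2 -!mulrA.
  rewrite ler_wpM2l ?addr_ge0 ?(ltW W_gt0)//.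
  apply: le_trans S3 _; rewrite -mulrA !ler_wpM2l ?powR_ge0 ?(ltW q0)//.
have -> : C2 * (t `^ (q - 1) * G) = C2 * G * t `^ (q - 1) by ring.
rewrite mulrA ler_pM2r// => h.
have ht : t <= C2 * G / c by rewrite ler_pdivlMr// mulrC.
apply: le_trans ht _.
have -> : 2 * C2 / c * G = C2 * G / c + C2 * G / c by ring.
rewrite lerDl; apply: divr_ge0; [exact: mulr_ge0|exact: ltW].
Qed.

(* The factor that the chain rule for [u `^ r] produces on [u > c m], with [e = 1 - r]. *)
Definition wt (c e m A : R) : R := if c * m < A then (m / A) `^ e else 0.

Lemma wt_ge0 c e m A : 0 <= wt c e m A.
Proof. by rewrite /wt; case: ifP => // _; exact: powR_ge0. Qed.

(** The larger end value of an edge: [root_diff_le] lets the chain rule factor be taken there. *)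
Definition umax u (i : 'I_d) x : R := Num.max (u x) (u (zshift i 1 x)).

(** A discrete chain rule. If both ends are at most [c * m], the truncated function is constant on
    the edge. Otherwise the roots are compared at the larger end, and [m^(1-r)] completes the
    weight. *)
Lemma diffi_trunc_le u i x (c m r : R) : 0 < c -> 0 < m -> 0 < r -> r < 1 ->
  (forall y, 0 <= u y) ->
  m `^ (1 - r) * diffi (fun x => Num.max (u x) (c * m) `^ r) i x <=
  wt c (1 - r) m (umax u i x) * diffi u i x.
Proof.
move=> c0 m0 r0 r1 u0; rewrite /wt /diffi /umax.
set y := zshift i 1 x.
have cm : 0 < c * m by rewrite mulr_gt0.
case: ifP => [h|/negbT]; last first.
  rewrite -leNgt ge_max => /andP[h1 h2].
  by rewrite !max_r// subrr normr0 mulr0 mul0r.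
wlog yx : x y h / u y <= u x => [hw|].
  case/orP: (le_total (u y) (u x)) => [yx|xy]; first exact: hw.
  by rewrite (maxC (u x) (u y)) distrC (distrC (u y)); apply: hw; rewrite // maxC.
move: h; rewrite (max_l yx) => h.
rewrite (max_l (ltW h)).
have ux : 0 < u x by exact: lt_trans h.
set s := Num.max (u y) _.
have s0 : 0 <= s by rewrite le_max u0.
have sx : s <= u x by rewrite ge_max yx ltW.
have -> : `|s `^ r - u x `^ r| = u x `^ r - s `^ r.
  by rewrite distrC ger0_norm// subr_ge0 le_powR// ltW.
have -> : (m / u x) `^ (1 - r) = m `^ (1 - r) * u x `^ (r - 1).
  rewrite powRM ?invr_ge0 ?(ltW m0)//; congr (_ * _).
  by rewrite -powR_inv1// -powRrM mulN1r opprB.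
rewrite -mulrA ler_wpM2l ?powR_ge0//.
apply: le_trans (root_diff_le r0 (ltW r1) ux s0 sx) _.
rewrite ler_wpM2l ?powR_ge0// distrC ger0_norm ?subr_ge0//.
by rewrite lerD2l lerN2 le_max lexx.
Qed.

(** Writing [m = m^(1-r) * m^r] brings the weight into the sum of differences and bounds [m]
    linearly; Jensen's inequality over the cells and over the directions raises this to the power
    [p]. *)
Lemma cube_energy (A0 p : R) : 1 < A0 -> 1 <= p ->
  exists c e C : R, [/\ 0 < c, 0 < e, 0 <= C &
    forall u M k b, (forall x, 0 <= u x) -> 0 < cavg M.+1 k u ->
      A0 * cavg M.+1 k u <= cavg M (child k b) u ->
      (2 ^+ M.+1) `^ (d%:R - p) * cavg M.+1 k u `^ p <=
      C * \sum_(x <- cells M.+1 k) \sum_i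
        (wt c e (cavg M.+1 k u) (umax u i x) * diffi u i x) `^ p].
Proof.
move=> A01 p1; have [c [r [C [c0 r0 r1 C0 HC]]]] := truncated_oscillation A01.
have p0 : 0 < p by exact: lt_le_trans p1.
have dR : 0 < d%:R :> R by rewrite ltr0n.
exists c, (1 - r), (C `^ p * 2 `^ p * (2 `^ p * d%:R `^ (p - 1))).
split => //; rewrite ?subr_gt0 ?mulr_ge0 ?powR_ge0//.
move=> u M' k b u0 m0 hm; have {HC} := HC u M' k b u0 m0 hm.
set M := M'.+1; set m := cavg M k u in m0 hm * => HC.
pose X i x := wt c (1 - r) m (umax u i x) * diffi u i x.
have X0 i x : 0 <= X i x by rewrite mulr_ge0 ?wt_ge0 ?diffi_ge0.
pose S := \sum_(x <- cells M k) \sum_i X i x.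
have S0 : 0 <= S by apply: sumr_ge0 => x _; apply: sumr_ge0.
have mS : m <= C * (2 ^+ M / W ^+ M) * S.
  have -> : m = m `^ (1 - r) * m `^ r.
    by rewrite -powRD ?subrK ?powRr1 ?(ltW m0)// (gt_eqF m0) implybT.
  apply: (@le_trans _ _ (m `^ (1 - r) * (C * cosc M k (fun x => Num.max (u x) (c * m) `^ r)))).
    by rewrite ler_wpM2l ?powR_ge0.
  set H := (fun x => _ `^ r).
  have -> : m `^ (1 - r) * (C * cosc M k H) =
    C * (2 ^+ M / W ^+ M) * (m `^ (1 - r) * csum M k (osc H)) by rewrite /cosc; ring.
  apply: ler_wpM2l; first by rewrite mulr_ge0 ?divr_ge0 ?exprn_ge0.
  rewrite /csum mulr_sumr; apply: ler_sum => x _.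
  rewrite /osc mulr_sumr; apply: ler_sum => i _; exact: diffi_trunc_le.
have Sp : S `^ p <= 2 `^ p * (W ^+ M) `^ (p - 1) *
    (2 `^ p * d%:R `^ (p - 1) * \sum_(x <- cells M k) \sum_i X i x `^ p).
  apply: (@le_trans _ _ (2 `^ p * (W ^+ M) `^ (p - 1) *
      \sum_(x <- cells M k) (\sum_i X i x) `^ p)).
    apply: jensen_sum => //; first by move=> x; exact: sumr_ge0.
    by rewrite size_cells !natrX -!exprM mulnC.
  rewrite ler_wpM2l ?mulr_ge0 ?powR_ge0// mulr_sumr.
  apply: ler_sum => x _; apply: jensen_sum => //.
  by rewrite /index_enum -enumT size_enum_ord.
have : m `^ p <= (C * (2 ^+ M / W ^+ M) * S) `^ p by rewrite le_powR// ltW.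
have h20 : 0 <= 2 ^+ M / W ^+ M by rewrite divr_ge0 ?exprn_ge0.
rewrite powRM ?mulr_ge0// (powRM p C0 h20) => h.
apply: (@le_trans _ _ ((2 ^+ M) `^ (d%:R - p) * (C `^ p * (2 ^+ M / W ^+ M) `^ p *
   (2 `^ p * (W ^+ M) `^ (p - 1) *
    (2 `^ p * d%:R `^ (p - 1) * \sum_(x <- cells M k) \sum_i X i x `^ p))))).
  rewrite ler_wpM2l ?powR_ge0// (le_trans h)// ler_wpM2l// mulr_ge0 ?powR_ge0//.
rewrite /X; move: (\sum_(x <- _) _) => Y.
have T0 : 0 < 2 ^+ M :> R by rewrite exprn_gt0.
have WT : W ^+ M = (2 ^+ M) `^ d%:R by rewrite powR_mulrn -?exprM 1?mulnC// ltW.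
(* The powers of the side length cancel: [(d - p) + p (1 - d) + d (p - 1) = 0]. *)
have e : (2 ^+ M) `^ (d%:R - p) * (2 ^+ M / W ^+ M) `^ p * (W ^+ M) `^ (p - 1) = 1.
  rewrite WT powRM ?invr_ge0 ?powR_ge0 ?(ltW T0)// -powR_inv1 ?powR_ge0//.
  rewrite -!powRrM -!powRD ?(gt_eqF T0) ?implybT//.
  by rewrite [X in _ `^ X](_ : _ = 0) ?powRr0//; ring.
move: e; move: (_ `^ (d%:R - p)) ((2 ^+ M / W ^+ M) `^ p) ((W ^+ M) `^ (p - 1)).
move=> a1 a2 a3 e.
have -> : a1 * (C `^ p * a2 * (2 `^ p * a3 * (2 `^ p * d%:R `^ (p - 1) * Y))) =
  (a1 * a2 * a3) * (C `^ p * 2 `^ p * (2 `^ p * d%:R `^ (p - 1)) * Y) by ring.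
by rewrite e mul1r.
Qed.

Lemma sum_geometric_le (s : seq nat) (rho : R) : uniq s -> 0 <= rho -> rho < 1 ->
  \sum_(j <- s) rho ^+ j <= (1 - rho)^-1.
Proof.
move=> us r0 r1; pose n := (\max_(j <- s) j).+1.
apply: (@le_trans _ _ (\sum_(j <- iota 0 n) rho ^+ j)).
  apply: le_sum_subseq => // [j js|j]; last exact: exprn_ge0.
  by rewrite mem_iota add0n /= ltnS (@leq_bigmax_seq _ s xpredT id).
have -> : iota 0 n = index_iota 0 n by rewrite /index_iota subn0.
rewrite big_mkord -[leRHS]mul1r ler_pdivlMr ?subr_gt0//.
have := subrX1 rho n; have := exprn_ge0 n r0; move: (rho ^+ n) (\sum_(_ < _) _) => a b; nra.
Qed.

(* If [P0] is the smallest index with [c * m P0 < A], then [m P / A] is at most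
   [C0 / c * lam ^+ (lev P - lev P0)]: a geometric series. *)
Lemma wt_sum_le (I : eqType) (s : seq I) (lev : I -> nat) (m : I -> R) (c e p A C0 lam : R) :
  uniq s -> {in s &, injective lev} -> (forall P, P \in s -> 0 < m P) ->
  0 < c -> 0 < e -> 1 <= p -> 0 < lam -> lam < 1 -> 1 <= C0 ->
  {in s &, forall P P', (lev P < lev P')%N -> m P' <= C0 * lam ^+ (lev P' - lev P) * m P} ->
  \sum_(P <- s) wt c e (m P) A `^ p <=
   (C0 / c) `^ (e * p) * (1 - lam `^ (e * p))^-1.
Proof.
move=> us inj m0 c0 e0 p1 l0 l1 C01 hm.
have p0 : 0 < p by exact: lt_le_trans p1.
have ep : 0 < e * p by rewrite mulr_gt0.
have rho1 : lam `^ (e * p) < 1.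
  by rewrite /powR gt_eqF// -[ltRHS]expR0 ltr_expR pmulr_rlt0 ?ln_lt0 ?l0.
pose t := [seq P <- s | c * m P < A].
have -> : \sum_(P <- s) wt c e (m P) A `^ p = \sum_(P <- t) (m P / A) `^ (e * p).
  rewrite big_filter [RHS]big_mkcond; apply: eq_bigr => P _.
  by rewrite /wt; case: ifP => _; rewrite ?powR0 ?gt_eqF// powRrM.
have ut : uniq t by exact: filter_uniq.
have tP P : P \in t -> c * m P < A /\ P \in s by rewrite mem_filter => /andP.
have [t0|[P1 P1t]] : t = [::] \/ exists P, P \in t.
- by case: (t) => [|P ?]; [left|right; exists P; rewrite mem_head].
- by rewrite t0 big_nil mulr_ge0 ?powR_ge0// invr_ge0 subr_ge0 ltW.
have : exists n, [exists i : 'I_(size t), lev (nth P1 t i) == n].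
  have i1 : (index P1 t < size t)%N by rewrite index_mem.
  by exists (lev P1); apply/existsP; exists (Ordinal i1); rewrite /= nth_index.
case/ex_minnP => n0 /existsP[i0 /eqP i0E] min0.
set P0 := nth P1 t i0 in i0E.
have P0t : P0 \in t by rewrite mem_nth.
have P0min P : P \in t -> (lev P0 <= lev P)%N.
  move=> Pt; rewrite i0E; apply: min0; apply/existsP.
  have i1 : (index P t < size t)%N by rewrite index_mem.
  by exists (Ordinal i1); rewrite /= nth_index.
have [cA P0s] := tP _ P0t.
have mP0 := m0 _ P0s.
have A0 : 0 < A by apply: lt_trans cA; rewrite mulr_gt0.
apply: (@le_trans _ _ (\sum_(P <- t) (C0 / c) `^ (e * p) * (lam `^ (e * p)) ^+ (lev P - lev P0))).
  rewrite big_seq [leRHS]big_seq; apply: ler_sum => P Pt.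
  have [cP Ps] := tP _ Pt.
  have -> : (lam `^ (e * p)) ^+ (lev P - lev P0) = (lam ^+ (lev P - lev P0)) `^ (e * p).
    by rewrite -(powR_mulrn _ (powR_ge0 lam (e * p))) -(powR_mulrn _ (ltW l0)) powRAC.
  rewrite -powRM ?divr_ge0 ?exprn_ge0 ?(ltW l0) ?(ltW c0)//; last by apply: le_trans C01.
  apply: le_powR; rewrite ?(ltW ep) ?divr_ge0 ?(ltW A0) ?(ltW (m0 _ Ps))//.
  rewrite ler_pdivrMr//.
  have mP : m P <= C0 * lam ^+ (lev P - lev P0) * m P0.
    have := P0min _ Pt; rewrite leq_eqVlt => /orP[/eqP ll|ll]; last exact: hm.
    rewrite (inj _ _ P0s Ps ll) subnn expr0 mulr1.
    by rewrite -[leLHS]mul1r ler_wpM2r// ltW// m0.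
  apply: le_trans mP _.
  have -> : C0 / c * lam ^+ (lev P - lev P0) * A = C0 * lam ^+ (lev P - lev P0) * (A / c) by ring.
  rewrite ler_wpM2l ?mulr_ge0 ?exprn_ge0 ?(ltW l0)//; first by apply: le_trans C01.
  by rewrite ler_pdivlMr// mulrC ltW.
rewrite -mulr_sumr ler_wpM2l ?powR_ge0//.
(* Distinct indices have distinct levels, so no exponent repeats and the full geometric series is a
   bound. *)
rewrite -(big_map (fun P => lev P - lev P0)%N xpredT (fun j => lam `^ (e * p) ^+ j)).
apply: sum_geometric_le; rewrite ?powR_ge0//.
rewrite map_inj_in_uniq// => P Q Pt Qt h.
have [_ Ps] := tP _ Pt; have [_ Qs] := tP _ Qt.
apply: (inj P Q Ps Qs); move: h (P0min _ Pt) (P0min _ Qt).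
move: (lev P) (lev Q) (lev P0); clear; lia.
Qed.

(* [P = (M, k)] stands for the cube of side [2 ^ M.+1] with index [k]. *)
Lemma discrete_energy (A0 p C0 lam : R) : 1 < A0 -> 1 <= p -> 0 < lam -> lam < 1 ->
  exists C : R, 0 <= C /\ forall (u : Z -> R) (Ps : seq (nat * Z)) (X : seq Z),
    (forall x, 0 <= u x) -> uniq Ps -> uniq X ->
    (forall P, P \in Ps -> {subset cells P.1.+1 P.2 <= X}) ->
    (forall P, P \in Ps -> 0 < cavg P.1.+1 P.2 u) ->
    (forall P, P \in Ps -> exists b, A0 * cavg P.1.+1 P.2 u <= cavg P.1 (child P.2 b) u) ->
    {in Ps &, forall P P' : nat * Z, (P.1 < P'.1)%N ->
       forall x, x \in cells P.1.+1 P.2 -> x \in cells P'.1.+1 P'.2 ->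
       cavg P'.1.+1 P'.2 u <= C0 * lam ^+ (P'.1 - P.1) * cavg P.1.+1 P.2 u} ->
    \sum_(P <- Ps) (2 ^+ P.1.+1) `^ (d%:R - p) * cavg P.1.+1 P.2 u `^ p <=
    C * \sum_(x <- X) \sum_i diffi u i x `^ p.
Proof.
move=> A01 p1 l0 l1; have [c [e [C [c0 e0 C0' HC]]]] := cube_energy A01 p1.
(* At least 1, so that the decay bound also covers the comparison of a cube with itself. *)
pose C1 := Num.max 1 C0.
pose K := (C1 / c) `^ (e * p) * (1 - lam `^ (e * p))^-1.
have ep : 0 < e * p by rewrite mulr_gt0// (lt_le_trans ltr01).
have rho1 : lam `^ (e * p) < 1.
  by rewrite /powR gt_eqF// -[ltRHS]expR0 ltr_expR pmulr_rlt0 ?ln_lt0 ?l0.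
have K0 : 0 <= K by rewrite mulr_ge0 ?powR_ge0// invr_ge0 subr_ge0 ltW.
exists (C * K); split; first exact: mulr_ge0.
move=> u Ps X u0 uPs uX sX m0 hb hm.
pose m (P : nat * Z) := cavg P.1.+1 P.2 u.
pose Y (P : nat * Z) x := \sum_i (wt c e (m P) (umax u i x) * diffi u i x) `^ p.
apply: (@le_trans _ _ (\sum_(P <- Ps) C * \sum_(x <- cells P.1.+1 P.2) Y P x)).
  rewrite big_seq [leRHS]big_seq; apply: ler_sum => P Pin.
  by have [b hPb] := hb _ Pin; apply: HC hPb => //; exact: m0.
rewrite -mulr_sumr -mulrA ler_wpM2l//.
(* After the exchange each cell sees only the cubes that contain it, at most one per level; this is
   the situation of [wt_sum_le]. *)
have -> : \sum_(P <- Ps) \sum_(x <- cells P.1.+1 P.2) Y P x =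
   \sum_(x <- X) \sum_(P <- Ps | x \in cells P.1.+1 P.2) Y P x.
  rewrite big_seq; under eq_bigr => P Pin.
    rewrite (sum_mem_subseq _ (cells_uniq _ _) uX (sX _ Pin)) big_mkcond; over.
  rewrite -big_seq exchange_big; apply: eq_bigr => x _.
  by rewrite -big_mkcond.
rewrite mulr_sumr; apply: ler_sum => x _.
rewrite /Y exchange_big mulr_sumr; apply: ler_sum => i _ /=.
under eq_bigr do rewrite powRM ?wt_ge0 ?diffi_ge0//.
rewrite -mulr_suml ler_wpM2r ?powR_ge0// -big_filter.
have sub P : P \in [seq P <- Ps | x \in cells P.1.+1 P.2] ->
   x \in cells P.1.+1 P.2 /\ P \in Ps by rewrite mem_filter => /andP.
apply: (@wt_sum_le _ _ fst) => //.
- exact: filter_uniq.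
- move=> [M1 k1] [M2 k2] /sub[/= h1 _] /sub[/= h2 _] E; rewrite E in h1 *.
  by rewrite (cells_inj h1 h2).
- by move=> P /sub[_]; exact: m0.
- by rewrite le_max lexx.
move=> P P' /sub[xP Pin] /sub[xP' Pin'] PP'.
apply: le_trans (hm _ _ Pin Pin' PP' _ xP xP') _.
have mP := m0 _ Pin.
rewrite ler_wpM2r ?(ltW mP)// ler_wpM2r ?exprn_ge0 ?(ltW l0)//.
by rewrite le_max lexx orbT.
Qed.

End CubeEnergy.

(** * Smooth functions of one variable *)

Section Smooth1.
Variable R : realType.
Implicit Types (f g : R -> R) (t x : R).

(** The derivatives are existential witnesses, so closure under products and inverses is an
    induction without formulas for higher derivatives. *)
Fixpoint smooth_n (n : nat) f : Prop :=
  if n is n'.+1 then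
    exists f', (forall t, is_derive t (1 : R) f (f' t)) /\ smooth_n n' f'
  else True.

Definition smooth1 f := forall n, smooth_n n f.

Lemma smooth_nW n f : smooth_n n.+1 f -> smooth_n n f.
Proof.
elim: n f => [|n IH] f //= [f' [df sf']]; exists f'; split => //.
exact: IH.
Qed.

Lemma smooth_n_cst n (c : R) : smooth_n n (fun=> c).
Proof.
elim: n c => [|n IH] c //=; exists (fun=> 0); split; last exact: IH.
by move=> t; exact: is_derive_cst.
Qed.

Lemma smooth_nD n f g : smooth_n n f -> smooth_n n g -> smooth_n n (fun t => f t + g t).
Proof.
elim: n f g => [|n IH] f g //= [f' [df sf]] [g' [dg sg]].
exists (fun t => f' t + g' t); split; last exact: IH.
by move=> t; apply: is_deriveD.
Qed.

Lemma smooth_nM n f g : smooth_n n f -> smooth_n n g -> smooth_n n (fun t => f t * g t).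
Proof.
elim: n f g => [|n IH] f g // sf sg.
have [f' [df sf']] := sf; have [g' [dg sg']] := sg.
exists (fun t => f t * g' t + g t * f' t); split.
  by move=> t; exact: is_deriveM.
by apply: smooth_nD; apply: IH => //; exact: smooth_nW.
Qed.

Lemma smooth_nV n f : (forall t, f t != 0) -> smooth_n n f -> smooth_n n (fun t => (f t)^-1).
Proof.
move=> f0; elim: n => [|n IH] // sf.
have [f' [df sf']] := sf.
exists (fun t => (-1) * ((f t)^-1 * (f t)^-1) * f' t); split.
  move=> t; apply: (is_derive_eq (is_deriveV (f0 t) (df t))).
  by rewrite /GRing.scale /= -exprVn expr2 mulN1r.
apply: smooth_nM => //; apply: smooth_nM; first exact: smooth_n_cst.
by apply: smooth_nM; apply: IH; exact: smooth_nW.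
Qed.

Lemma smooth_n_id n : smooth_n n (@id R).
Proof.
by case: n => [|n] //=; exists (fun=> 1); split; [move=> t; exact: is_derive_id|exact: smooth_n_cst].
Qed.

Lemma is_derive_mull (K : R) f t df : is_derive t (1 : R) f df ->
  is_derive t (1 : R) (fun x => K * f x) (K * df).
Proof.
move=> h; apply: (is_derive_eq (is_deriveM (is_derive_cst K t (1 : R)) h)).
by rewrite /GRing.scale /= mulr0 addr0.
Qed.

Lemma is_derive_add f g t df dg : is_derive t (1 : R) f df -> is_derive t (1 : R) g dg ->
  is_derive t (1 : R) (fun x => f x + g x) (df + dg).
Proof. by move=> hf hg; exact: is_deriveD. Qed.

Lemma is_derive_affine (a b t : R) : is_derive t (1 : R) (fun t => a * t + b) a.
Proof.
pose h := is_deriveM (is_derive_cst a t (1 : R)) (is_derive_id t (1 : R)).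
apply: (is_derive_eq (is_deriveD h (is_derive_cst b t (1 : R)))).
by rewrite /GRing.scale /= mulr1 mulr0 !addr0.
Qed.

Lemma smooth_n_affine n f (a b : R) : smooth_n n f -> smooth_n n (fun t => f (a * t + b)).
Proof.
elim: n f => [|n IH] f //= [f' [df sf]].
exists (fun t => f' (a * t + b) * a); split; last first.
  by apply: smooth_nM; [exact: IH|exact: smooth_n_cst].
by move=> t; apply: (@is_derive1_comp _ f (fun t => a * t + b)) => //; exact: is_derive_affine.
Qed.

Lemma smooth1_is_derive f t : smooth1 f -> is_derive t (1 : R) f (derive1 f t).
Proof.
move=> sf; have [f' [df _]] := sf 1%N.
have [d1 d2] := df t; by rewrite derive1E d2.
Qed.

Lemma smooth1_derive1 f : smooth1 f -> smooth1 (derive1 f).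
Proof.
move=> sf n; have [f' [df sf']] := sf n.+1.
have -> // : derive1 f = f'.
by apply/funext => t; rewrite derive1E; have [d1 ->] := df t.
Qed.

Lemma smooth1_continuous f : smooth1 f -> continuous f.
Proof.
move=> sf t; apply: differentiable_continuous; apply/derivable1_diffP.
by have [] := smooth1_is_derive t sf.
Qed.

(** * The flat function [exp (- 1 / t)] and a smooth positive part *)

(** The span of this family contains [exp (- 1 / t)] and is closed under differentiation, so one
    induction covers all orders and only the point 0 needs an argument. *)
Definition flat (k : nat) (t : R) : R := if 0 < t then t ^- k * expR (- t^-1) else 0.

(** One term of the exponential series suffices: [exp (1 / t) >= 1 + (1 / t)^(k+1) / (k+1)!]. The
    spare power of [t] gives continuity at 0 for every [k]. *)
Lemma flat_le k t : `|flat k t| <= (k.+1)`!%:R * `|t|.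
Proof.
rewrite /flat; case: ifP => t0; last by rewrite normr0 mulr_ge0.
have ti : 0 < t^-1 by rewrite invr_gt0.
rewrite !ger0_norm ?mulr_ge0 ?expR_ge0 ?invr_ge0 ?exprn_ge0 ?(ltW t0)//.
rewrite expRN ler_pdivrMr ?expR_gt0//.
have := expR_ge1Dxn k (ltW ti).
have F0 : 0 < (k.+1)`!%:R :> R by rewrite ltr0n fact_gt0.
rewrite exprS -(ler_pM2l (x := (k.+1)`!%:R * t)); last by rewrite mulr_gt0.
apply: le_trans; rewrite mulrDr mulr1 -exprVn.
have -> : (k.+1)`!%:R * t * (t^-1 * t^-1 ^+ k / (k.+1)`!%:R) = t^-1 ^+ k.
  by move: (t^-1 ^+ k) => z; field; rewrite !gt_eqF.
by rewrite lerDr mulr_ge0 ?(ltW t0)// ltW.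
Qed.

Lemma flat_cvg0 k : flat k t @[t --> (0 : R)] --> flat k 0.
Proof.
have -> : flat k 0 = 0 by rewrite /flat ltxx.
have F0 : 0 < (k.+1)`!%:R :> R by rewrite ltr0n fact_gt0.
apply/cvgr0Pnorm_le => e e0.
near=> t.
apply: le_trans (flat_le k t) _.
rewrite mulrC -ler_pdivlMr//.
near: t; exact: (@nbhs0_le _ R^o _ (divr_gt0 e0 F0)).
Unshelve. all: by end_near.
Qed.

Lemma is_derive_flat k t :
  is_derive t (1 : R) (flat k) (- k%:R * flat k.+1 t + flat k.+2 t).
Proof.
have [t0|t0|->] := ltgtP t 0.
- rewrite /flat !ifF ?(ltW t0) ?le_gtF ?(ltW t0)// mulr0 addr0.
  apply: near_eq_is_derive (is_derive_cst 0 t 1).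
  near=> x; rewrite ifF//; apply/negbTE; rewrite -leNgt ltW//.
  by near: x; exact: lt_nbhsl.
- have tn : t != 0 by rewrite gt_eqF.
  have h : is_derive t (1 : R) (fun x => (x ^+ k)^-1 * expR (- x^-1))
     ((t ^+ k)^-1 * (expR (- t^-1) * t ^- 2) + expR (- t^-1) * (- t ^+ k ^- 2 * (k%:R * t ^+ k.-1))).
    have hid := is_derive_id t (1 : R).
    have hV : is_derive t (1 : R) (fun x => x^-1) (- t ^- 2 *: (1 : R)).
      exact: (@is_deriveV _ id).
    have hN : is_derive t (1 : R) (fun x => - x^-1) (t ^- 2).
      by apply: (is_derive_eq (is_deriveN hV)); rewrite /GRing.scale /= mulr1 opprK.
    have hE : is_derive t (1 : R) (fun x => expR (- x^-1)) (expR (- t^-1) * t ^- 2).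
      by apply: (@is_derive1_comp _ expR (fun x => - x^-1)).
    have hX : is_derive t (1 : R) (fun x => x ^+ k) (k%:R * t ^+ k.-1).
      have hk := is_deriveX k hid.
      rewrite (_ : (fun x : R => x ^+ k) = (@id R) ^+ k); last by apply/funext => x; rewrite exprfctE.
      by apply: (is_derive_eq hk); rewrite /GRing.scale /= mulr1.
    have hXV : is_derive t (1 : R) (fun x => (x ^+ k)^-1) (- t ^+ k ^- 2 * (k%:R * t ^+ k.-1)).
      by apply: (@is_deriveV _ (fun x => x ^+ k)); rewrite ?expf_neq0.
    exact: is_deriveM.
  rewrite /flat t0; apply: near_eq_is_derive (is_derive_eq h _).
    near=> x; rewrite ifT//; near: x; exact: lt_nbhsr.
  case: k h => [|k] h.
    by rewrite /=; field.
  rewrite /= !exprS; field; rewrite ?expf_neq0//.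
- have -> : - k%:R * flat k.+1 0 + flat k.+2 0 = 0 by rewrite /flat ltxx mulr0 addr0.
  (* The difference quotient of [flat k] at 0 is [flat k.+1], which is continuous there with value
     0. *)
  apply/is_derive1_caratheodory; exists (flat k.+1); split.
  + move=> z; rewrite subr0 /flat ltxx subr0; case: ifP => [z0|_]; last by rewrite mul0r.
    by rewrite exprS; field; rewrite ?expf_neq0 ?gt_eqF.
  + exact: flat_cvg0.
  + by rewrite /flat ltxx.
Unshelve. all: by end_near.
Qed.

Lemma smooth1_flat k : smooth1 (flat k).
Proof.
move=> n; elim: n k => [|n IH] k //=.
exists (fun t => - k%:R * flat k.+1 t + flat k.+2 t); split; first exact: is_derive_flat.
by apply: smooth_nD => //; apply: smooth_nM => //; exact: smooth_n_cst.
Qed.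

Lemma flat_ge0 k t : 0 <= flat k t.
Proof.
rewrite /flat; case: ifP => // t0.
by rewrite mulr_ge0 ?expR_ge0// invr_ge0 exprn_ge0// ltW.
Qed.

(** The quotient [flat 0 t / den t] is the usual smooth transition from 0 on [t <= 0] to 1 on
    [t >= 1]. *)
Let den t := flat 0 t + flat 0 (-1 * t + 1).

Let den_gt0 t : 0 < den t.
Proof.
have [t0|t0] := ltP 0 t.
  by rewrite ltr_pwDl ?flat_ge0// /flat t0 expr0 invr1 mul1r expR_gt0.
rewrite ltr_wpDl ?flat_ge0// /flat ifT ?expr0 ?invr1 ?mul1r ?expR_gt0//.
by rewrite mulN1r addrC subr_gt0 (le_lt_trans t0).
Qed.

(* A smooth version of the positive part. *)
Definition ramp (t : R) : R := t * (flat 0 t * (den t)^-1).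

Lemma smooth1_ramp : smooth1 ramp.
Proof.
move=> n; apply: smooth_nM; first exact: smooth_n_id.
apply: smooth_nM; first exact: smooth1_flat.
apply: smooth_nV; first by move=> t; rewrite gt_eqF.
apply: smooth_nD; first exact: smooth1_flat.
by apply: smooth_n_affine; exact: smooth1_flat.
Qed.

Lemma ramp_le0 t : t <= 0 -> ramp t = 0.
Proof. by move=> t0; rewrite /ramp /flat ltNge t0 /= mul0r mulr0. Qed.

Lemma ramp_ge1 t : 1 <= t -> ramp t = t.
Proof.
move=> t1; rewrite /ramp /den [flat 0 (_ * _ + _)]/flat ifF; last first.
  by apply/negbTE; rewrite -leNgt mulN1r addrC subr_le0.
rewrite addr0 mulfV ?mulr1// /flat ifT ?(lt_le_trans ltr01)//.
by rewrite expr0 invr1 mul1r gt_eqF// expR_gt0.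
Qed.

Lemma ramp_bounds t : 0 <= ramp t <= Num.max t 0.
Proof.
have [t0|t0] := leP t 0; first by rewrite ramp_le0// lexx.
have h : 0 <= flat 0 t / den t <= 1.
  rewrite divr_ge0 ?flat_ge0 ?(ltW (den_gt0 _))//= ler_pdivrMr// mul1r.
  by rewrite lerDl flat_ge0.
case/andP: h => h0 h1.
by rewrite /ramp mulr_ge0 ?(ltW t0)//= -[leRHS]mulr1 ler_wpM2l// ltW.
Qed.

Definition step : R -> R := derive1 ramp.

Lemma smooth1_step : smooth1 step.
Proof. exact: smooth1_derive1 smooth1_ramp. Qed.

Lemma step_lt0 t : t < 0 -> step t = 0.
Proof.
move=> t0; have h : is_derive t (1 : R) ramp 0.
  apply: near_eq_is_derive (is_derive_cst 0 t 1).
  near=> x; rewrite ramp_le0// ltW//; near: x; exact: lt_nbhsl.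
by rewrite /step derive1E; have [_ ->] := h.
Unshelve. all: by end_near.
Qed.

Lemma step_gt1 t : 1 < t -> step t = 1.
Proof.
move=> t0; have h : is_derive t (1 : R) ramp 1.
  apply: near_eq_is_derive (is_derive_id t 1).
  near=> x; rewrite ramp_ge1// ltW//; near: x; exact: lt_nbhsr.
by rewrite /step derive1E; have [_ ->] := h.
Unshelve. all: by end_near.
Qed.

(** Outside [[-1, 2]] only the values 0 and 1 occur, and on this compact interval a continuous
    function attains its maximum. *)
Lemma step_bounded : exists2 B : R, 1 <= B & forall t, `|step t| <= B.
Proof.
have cs : {within `[(-1 : R), 2], continuous (fun t => `|step t|)}.
  apply: continuous_subspaceT => t; apply: cvg_norm.
  exact: (smooth1_continuous smooth1_step).
have [|c _ hc] := EVT_max _ cs; first lra.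
exists (Num.max 1 `|step c|); first by rewrite le_max lexx.
move=> t; have [t0|t0] := ltP t (-1); first by rewrite step_lt0 ?normr0 ?le_max ?ler01//; lra.
have [t1|t1] := ltP 2 t; first by rewrite step_gt1 ?normr1 ?le_max ?lexx//; lra.
by rewrite le_max hc ?orbT// in_itv /= t0 t1.
Qed.

End Smooth1.

(** * Tensor products as test functions *)

Section TestFunctions.
Variables (R : realType) (d : nat).
Local Notation pt := (d.-tuple R).
Implicit Types (x y : pt) (i : 'I_d).

Definition tensor (F : 'I_d -> R -> R) (y : pt) : R := \prod_j F j (tnth y j).

Definition dtensor i (F : 'I_d -> R -> R) : 'I_d -> R -> R :=
  fun j => if j == i then derive1 (F j) else F j.

(** Finite combinations of tensor products are closed under partial derivatives, which reduces
    smoothness in [d] variables to one variable. *)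
Definition combo (T : Type) (s : seq T) (c : T -> R) (F : T -> 'I_d -> R -> R) (y : pt) : R :=
  \sum_(p <- s) c p * tensor (F p) y.

Lemma is_derive_tensor F i y : (forall j, smooth1 (F j)) ->
  is_derive (0 : R) (1 : R) (fun t => tensor F (Defs.shift y i t)) (tensor (dtensor i F) y).
Proof.
move=> sF; set K := \prod_(j | j != i) F j (tnth y j).
have -> : (fun t => tensor F (Defs.shift y i t)) = (fun t => K * F i (1 * t + tnth y i)).
  apply/funext => t; rewrite /tensor (bigD1 i)//= mulrC tnth_mktuple eqxx mul1r addrC.
  congr (_ * F i _); apply: eq_bigr => j /negbTE ji.
  by rewrite tnth_mktuple ji addr0.
have -> : tensor (dtensor i F) y = K * derive1 (F i) (1 * 0 + tnth y i).
  rewrite /tensor (bigD1 i)//= mulrC /dtensor eqxx mulr0 add0r; congr (_ * _).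
  by apply: eq_bigr => j /negbTE ->.
have h := @is_derive1_comp _ (F i) (fun t => 1 * t + tnth y i) 0 _ _
  (smooth1_is_derive (1 * 0 + tnth y i) (sF i)) (is_derive_affine 1 (tnth y i) 0).
by apply: (is_derive_eq (is_derive_mull K h)); rewrite mulr1.
Qed.

Lemma smooth1_dtensor i F : (forall j, smooth1 (F j)) -> forall j, smooth1 (dtensor i F j).
Proof. by move=> sF j; rewrite /dtensor; case: ifP => _ //; exact: smooth1_derive1. Qed.

Lemma is_derive_combo (T : Type) (s : seq T) c F i y : (forall p j, smooth1 (F p j)) ->
  is_derive (0 : R) (1 : R) (fun t => combo s c F (Defs.shift y i t))
    (combo s c (fun p => dtensor i (F p)) y).
Proof.
move=> sF; rewrite /combo; elim: s => [|p s IH].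
  rewrite big_nil; have -> : (fun t => \sum_(p <- [::]) c p * tensor (F p) (Defs.shift y i t)) = cst 0.
    by apply/funext => t; rewrite big_nil.
  exact: is_derive_cst.
rewrite big_cons.
have -> : (fun t => \sum_(p <- p :: s) c p * tensor (F p) (Defs.shift y i t)) =
   (fun t => c p * tensor (F p) (Defs.shift y i t)) +
   (fun t => \sum_(p <- s) c p * tensor (F p) (Defs.shift y i t)).
  by apply/funext => t; rewrite big_cons.
apply: is_deriveD => //.
exact: is_derive_mull (is_derive_tensor i y (sF p)).
Qed.

Lemma partial_combo (T : Type) (s : seq T) c F i : (forall p j, smooth1 (F p j)) ->
  partial i (combo s c F) = combo s c (fun p => dtensor i (F p)).
Proof.
move=> sF; apply/funext => y; have [_ h] := is_derive_combo s c i y sF.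
by rewrite -h /partial derive1E.
Qed.

(** The neighbourhood filter that corresponds to [tcontinuous]; through it the limit laws for sums
    and products apply. *)
Definition tnbhs x : set_system pt :=
  [set A | exists2 del, 0 < del & forall y, (forall i, `|tnth y i - tnth x i| < del) -> A y].

Instance tnbhs_filter x : Filter (tnbhs x).
Proof.
split.
- by exists 1.
- move=> A B [d1 d10 h1] [d2 d20 h2]; exists (Num.min d1 d2); first by rewrite lt_min d10.
  by move=> y hy; split; [apply: h1|apply: h2] => i; have := hy i; rewrite lt_min => /andP[].
- by move=> A B AB [d1 d10 h1]; exists d1 => // y hy; apply/AB/h1.
Qed.

Lemma tcontinuousP (g : pt -> R) :
  (forall x, g y @[y --> tnbhs x] --> g x) -> tcontinuous g.
Proof.
move=> h x e e0; have := h x => /cvgrPdist_lt /(_ e e0) [del d0 hd].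
by exists del => // y hy; rewrite distrC; exact: hd.
Qed.

Lemma tnth_cvg x i : tnth y i @[y --> tnbhs x] --> tnth x i.
Proof.
apply/cvgrPdist_lt => e e0; exists e => // y hy; rewrite /= distrC; exact: hy.
Qed.

Lemma tensor_cvg F x : (forall j, smooth1 (F j)) ->
  tensor F y @[y --> tnbhs x] --> tensor F x.
Proof.
move=> sF; rewrite /tensor; elim: (index_enum _) => [|j s IH].
  by rewrite big_nil; under eq_cvg do rewrite big_nil; exact: cvg_cst.
rewrite big_cons; under eq_cvg do rewrite big_cons.
apply: cvgM => //; apply: (@cvg_comp _ _ _ (fun y => tnth y j) (F j)); first exact: tnth_cvg.
exact: smooth1_continuous.
Qed.

Lemma tcontinuous_combo (T : Type) (s : seq T) c F : (forall p j, smooth1 (F p j)) ->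
  tcontinuous (combo s c F).
Proof.
move=> sF; apply: tcontinuousP => x; rewrite /combo.
elim: s => [|p s IH].
  by rewrite big_nil; under eq_cvg do rewrite big_nil; exact: cvg_cst.
rewrite big_cons; under eq_cvg do rewrite big_cons.
by apply: cvgD => //; apply: cvgM; [exact: cvg_cst|exact: tensor_cvg].
Qed.

Lemma smooth_combo (T : Type) (s : seq T) c F : (forall p j, smooth1 (F p j)) ->
  smooth (combo s c F).
Proof.
move=> sF l.
have [G sG ->] : exists2 G, (forall p j, smooth1 (G p j)) & dpart l (combo s c F) = combo s c G.
  elim: l => [|i l [G sG IH]]; first by exists F.
  exists (fun p => dtensor i (G p)); first by move=> p; exact: smooth1_dtensor.
  by rewrite /= IH partial_combo.
split; first exact: tcontinuous_combo.
by move=> i x; have [] := is_derive_combo s c i x sG.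
Qed.

Lemma measurable_tensor F : (forall j, smooth1 (F j)) -> measurable_fun setT (tensor F).
Proof.
move=> sF; rewrite /tensor; apply: measurable_prod => j _.
apply: (@measurableT_comp _ _ _ _ _ _ (F j)); last exact: measurable_tnth.
by apply: continuous_measurable_fun; exact: smooth1_continuous.
Qed.

Lemma measurable_combo (T : Type) (s : seq T) c F : (forall p j, smooth1 (F p j)) ->
  measurable_fun setT (combo s c F).
Proof.
move=> sF; rewrite /combo; apply: measurable_sum => p.
by apply: measurable_funM => //; exact: measurable_tensor.
Qed.

(* [window n a h] and [hat n a h] are smooth and tend, as [n] grows, to the indicator
   of [[a, a + h[] and to the tent over [[a, a + 2 h]]; the derivative of [hat] is the
   difference of two adjacent windows. *)
Definition hat (n : nat) (a h t : R) : R :=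
  (ramp (n.+1%:R * (t - a) + 2) - 2 * ramp (n.+1%:R * (t - a - h) + 2)
   + ramp (n.+1%:R * (t - a - 2 * h) + 2)) / n.+1%:R.

Definition window (n : nat) (a h t : R) : R :=
  step (n.+1%:R * (t - a) + 2) - step (n.+1%:R * (t - a - h) + 2).

Lemma smooth1_affine_arg f (n : nat) (a : R) : smooth1 f -> smooth1 (fun t => f (n.+1%:R * (t - a) + 2)).
Proof.
move=> sf m; have := smooth_n_affine n.+1%:R (2 - n.+1%:R * a) (sf m).
by congr smooth_n; apply/funext => t; congr f; ring.
Qed.

Lemma smooth1_hat n a h : smooth1 (hat n a h).
Proof.
rewrite /hat => m; apply: smooth_nM; last exact: smooth_n_cst.
have r (b : R) : smooth_n m (fun t => ramp (n.+1%:R * (t - b) + 2)).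
  exact: (smooth1_affine_arg n b (@smooth1_ramp R) m).
have -> : (fun t => ramp (n.+1%:R * (t - a) + 2) - 2 * ramp (n.+1%:R * (t - a - h) + 2)
   + ramp (n.+1%:R * (t - a - 2 * h) + 2)) =
   (fun t => ramp (n.+1%:R * (t - a) + 2) + (- 2) * ramp (n.+1%:R * (t - (a + h)) + 2)
   + ramp (n.+1%:R * (t - (a + 2 * h)) + 2)).
  by apply/funext => t; rewrite mulNr !opprD !addrA.
apply: smooth_nD => //; apply: smooth_nD => //.
by apply: smooth_nM => //; exact: smooth_n_cst.
Qed.

Lemma smooth1_window n a h : smooth1 (window n a h).
Proof.
rewrite /window => m.
have r (b : R) : smooth_n m (fun t => step (n.+1%:R * (t - b) + 2)).
  exact: (smooth1_affine_arg n b (@smooth1_step R) m).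
have -> : (fun t => step (n.+1%:R * (t - a) + 2) - step (n.+1%:R * (t - a - h) + 2)) =
   (fun t => step (n.+1%:R * (t - a) + 2) + (- 1) * step (n.+1%:R * (t - (a + h)) + 2)).
  by apply/funext => t; rewrite mulN1r !opprD !addrA.
apply: smooth_nD => //; by apply: smooth_nM => //; exact: smooth_n_cst.
Qed.

Lemma derive1_hat n a h t : derive1 (hat n a h) t = window n a h t - window n (a + h) h t.
Proof.
have r (b : R) : is_derive t (1 : R) (fun t => ramp (n.+1%:R * (t - b) + 2))
    (step (n.+1%:R * (t - b) + 2) * n.+1%:R).
  have := @is_derive1_comp _ (@ramp R) (fun t => n.+1%:R * t + (2 - n.+1%:R * b)) t _ _
    (smooth1_is_derive _ (@smooth1_ramp R)) (is_derive_affine _ _ _).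
  have -> : @ramp R \o (fun t => n.+1%:R * t + (2 - n.+1%:R * b)) =
    (fun t => ramp (n.+1%:R * (t - b) + 2)) by apply/funext => x /=; congr ramp; ring.
  by rewrite -/(step _); have -> : n.+1%:R * t + (2 - n.+1%:R * b) = n.+1%:R * (t - b) + 2 by ring.
have H := is_derive_mull (n.+1%:R^-1) (is_derive_add (is_derive_add (r a)
  (is_derive_mull (- 2) (r (a + h)))) (r (a + 2 * h))).
have e : hat n a h = fun t => n.+1%:R^-1 * (ramp (n.+1%:R * (t - a) + 2) +
    (- 2) * ramp (n.+1%:R * (t - (a + h)) + 2) + ramp (n.+1%:R * (t - (a + 2 * h)) + 2)).
  by apply/funext => x; rewrite /hat mulrC mulNr !opprD !addrA.
rewrite derive1E e; have [_ ->] := H.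
rewrite /window.
have -> : t - (a + h) - h = t - (a + 2 * h) by ring.
have -> : t - a - h = t - (a + h) by ring.
have n0 : n.+1%:R != 0 :> R by rewrite pnatr_eq0.
move: (n.+1%:R : R) n0 => N n0.
move: (step (N * (t - a) + 2)) (step (N * (t - (a + h)) + 2)) (step (N * (t - (a + 2 * h)) + 2)).
by move=> x y z; field.
Qed.

Definition tent (a h t : R) : R :=
  Num.max (t - a) 0 - 2 * Num.max (t - a - h) 0 + Num.max (t - a - 2 * h) 0.

Definition ind (a h t : R) : R := (a <= t < a + h)%R%:R.

Lemma ramp_approx (n : nat) (s : R) :
  `|ramp (n.+1%:R * s + 2) / n.+1%:R - Num.max s 0| <= 3 / n.+1%:R.
Proof.
have n0 : 0 < n.+1%:R :> R by rewrite ltr0n.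
have -> : ramp (n.+1%:R * s + 2) / n.+1%:R - Num.max s 0 =
   (ramp (n.+1%:R * s + 2) - n.+1%:R * Num.max s 0) / n.+1%:R.
  by rewrite mulrBl [X in _ = _ - X]mulrAC divff ?mul1r// gt_eqF.
rewrite normrM (ger0_norm (x := _^-1)) ?invr_ge0 ?(ltW n0)// ler_pM2r ?invr_gt0//.
have := ramp_bounds (n.+1%:R * s + 2).
have [s0|s0] := leP s 0.
  have : n.+1%:R * s <= 0 by rewrite pmulr_rle0.
  rewrite mulr0 subr0; move: (ramp (n.+1%:R * s + 2)) => v; move: (n.+1%:R * s) => z z0 /andP[v0].
  by rewrite le_max ger0_norm// => /orP[] ?; lra.
have h : 0 < n.+1%:R * s by rewrite mulr_gt0.
rewrite ramp_ge1; last by lra.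
by move=> _; rewrite addrAC subrr add0r ger0_norm; lra.
Qed.

(** [hat] is a second difference with coefficients 1, 2, 1, so the error of [ramp_approx] enters
    four times. *)
Lemma hat_approx n a h t : `|hat n a h t - tent a h t| <= 12 / n.+1%:R.
Proof.
have -> : hat n a h t - tent a h t =
  (ramp (n.+1%:R * (t - a) + 2) / n.+1%:R - Num.max (t - a) 0) -
  2 * (ramp (n.+1%:R * (t - a - h) + 2) / n.+1%:R - Num.max (t - a - h) 0) +
  (ramp (n.+1%:R * (t - a - 2 * h) + 2) / n.+1%:R - Num.max (t - a - 2 * h) 0).
  by rewrite /hat /tent; ring.
have := ramp_approx n (t - a); have := ramp_approx n (t - a - h).
have := ramp_approx n (t - a - 2 * h).
move: (_ - Num.max (t - a) 0) (_ - Num.max (t - a - h) 0) (_ - Num.max (t - a - 2 * h) 0).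
move=> x y z; move: (n.+1%:R^-1) => N; rewrite !ler_norml => /andP[z1 z2] /andP[y1 y2] /andP[x1 x2].
apply/andP; split; lra.
Qed.

Lemma tent_bounds a h t : 0 <= h -> 0 <= tent a h t <= h.
Proof.
move=> h0; rewrite /tent.
have [a0|a0] := leP (t - a) 0; have [a1|a1] := leP (t - a - h) 0;
  have [a2|a2] := leP (t - a - 2 * h) 0; apply/andP; split; lra.
Qed.

Lemma tent_out a h t : 0 <= h -> ~~ (a <= t < a + 2 * h) -> tent a h t = 0.
Proof.
move=> h0; rewrite negb_and -leNgt -ltNge /tent => /orP[ta|ta].
  by rewrite !max_r; lra.
by rewrite !max_l; lra.
Qed.

Lemma nbhs_infty_gtSr (r : R) : \forall n \near \oo, r < n.+1%:R.
Proof. by apply: filterS (nbhs_infty_gtr r) => n /lt_trans; apply; rewrite ltr_nat. Qed.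

(** The offset 2 puts [s = 0] where [step] is already 1, so the limit is right at every point and
    the windows tend to indicators of half-open intervals. *)
Lemma step_cvg (s : R) : step (n.+1%:R * s + 2) @[n --> \oo] --> ((0 <= s)%R%:R : R).
Proof.
have [s0|s0] := leP 0 s.
  have -> : (fun n => step (n.+1%:R * s + 2)) = fun=> (1 : R).
    apply/funext => n; apply: step_gt1.
    have : 0 <= n.+1%:R * s by rewrite mulr_ge0.
    lra.
  exact: cvg_cst.
apply/cvgrPdist_lt => e e0; near=> n.
rewrite step_lt0 ?subr0 ?normr0//.
have : 2 / (- s) < n.+1%:R by near: n; exact: nbhs_infty_gtSr.
rewrite ltr_pdivrMr ?oppr_gt0// mulrN; lra.
Unshelve. all: by end_near.
Qed.

Lemma window_cvg a h t : 0 <= h -> window n a h t @[n --> \oo] --> ind a h t.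
Proof.
move=> h0; have -> : ind a h t = (0 <= t - a)%R%:R - (0 <= t - a - h)%R%:R :> R.
  rewrite /ind !subr_ge0 lerBrDl ltNge.
  by have [h1|h1] := leP a t; have [h2|h2] := leP (a + h) t => //=; rewrite ?subrr ?subr0//; lra.
by apply: cvgB; exact: step_cvg.
Qed.

Lemma hat_cvg a h t : hat n a h t @[n --> \oo] --> tent a h t.
Proof.
apply/cvgrPdist_lt => e e0; near=> n.
rewrite distrC; apply: le_lt_trans (hat_approx n a h t) _.
rewrite ltr_pdivrMr ?ltr0n// mulrC -ltr_pdivrMr//.
by near: n; exact: nbhs_infty_gtSr.
Unshelve. all: by end_near.
Qed.

(* For [2 <= n.+1 * h] the smoothed functions live in the window [a-h, a+2h[. *)
Lemma hat_out n a h t : 0 <= h -> 2 <= n.+1%:R * h -> ~~ (a - h <= t < a + 2 * h) -> hat n a h t = 0.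
Proof.
move=> h0 nh; have n0 : 0 < n.+1%:R :> R by rewrite ltr0n.
rewrite negb_and -leNgt -ltNge /hat => /orP[ta|ta].
  have : n.+1%:R * (t - a + h) <= 0 by rewrite pmulr_rle0//; lra.
  have : n.+1%:R * (t - a) <= n.+1%:R * (t - a + h) by rewrite ler_pM2l//; lra.
  move: nh; rewrite !mulrDr !mulrN => nh h1 h2.
  have h3 : 0 <= n.+1%:R * h by rewrite mulr_ge0.
  have -> : n.+1%:R * (2 * h) = 2 * (n.+1%:R * h) by ring.
  by rewrite !ramp_le0 ?mulr0 ?subr0 ?addr0 ?mul0r//; lra.
have h1 : 0 <= n.+1%:R * (t - a - 2 * h) by rewrite mulr_ge0//; lra.
have h3 : 0 <= n.+1%:R * h by rewrite mulr_ge0.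
have e1 : n.+1%:R * (t - a) = n.+1%:R * (t - a - 2 * h) + 2 * (n.+1%:R * h) by ring.
have e2 : n.+1%:R * (t - a - h) = n.+1%:R * (t - a - 2 * h) + n.+1%:R * h by ring.
rewrite e1 e2; move: h1 h3; move: (n.+1%:R * (_ - _)) (n.+1%:R * h) => p q p0 q0.
rewrite !ramp_ge1; [|lra..].
by rewrite (_ : _ - _ + _ = 0) ?mul0r//; ring.
Qed.

Lemma window_out n a h t : 0 <= h -> 2 < n.+1%:R * h -> ~~ (a - h <= t < a + 2 * h) -> window n a h t = 0.
Proof.
move=> h0 nh; have n0 : 0 < n.+1%:R :> R by rewrite ltr0n.
rewrite negb_and -leNgt -ltNge /window => /orP[ta|ta].
  have : n.+1%:R * (t - a + h) <= 0 by rewrite pmulr_rle0//; lra.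
  move: nh; rewrite !mulrDr !mulrN => nh h1.
  by rewrite !step_lt0 ?subr0//; lra.
have h1 : 0 <= n.+1%:R * (t - a - 2 * h) by rewrite mulr_ge0//; lra.
have h3 : 0 <= n.+1%:R * h by rewrite mulr_ge0.
have e1 : n.+1%:R * (t - a) = n.+1%:R * (t - a - 2 * h) + 2 * (n.+1%:R * h) by ring.
have e2 : n.+1%:R * (t - a - h) = n.+1%:R * (t - a - 2 * h) + n.+1%:R * h by ring.
rewrite e1 e2; move: h1 h3; move: (n.+1%:R * (_ - _)) (n.+1%:R * h) => p q p0 q0.
by rewrite !step_gt1 ?subrr//; lra.
Qed.

End TestFunctions.

(** * Integration over dyadic cubes *)

Section Cubes.
Variables (R : realType) (d : nat).
Local Notation pt := (d.-tuple R).
Local Notation Z := (d.-tuple int).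
Local Notation cube := (@dcube R d).
Implicit Types (x y : pt) (k : Z) (i : 'I_d) (n : int).

Lemma side_gt0 n : 0 < side R n.
Proof. by rewrite /side exprz_gt0. Qed.
Hint Resolve side_gt0 : core.

Lemma sideD n (M : nat) : side R (n + M%:Z) = (2 ^ M)%N%:R * side R n.
Proof. by rewrite /side expfzDr ?pnatr_eq0// mulrC natrX. Qed.

Definition pbox (a b : 'I_d -> R) : set pt :=
  [set y | forall i, a i <= tnth y i < b i].

Definition gidx n y : Z := [tuple Num.floor (tnth y i / side R n) | i < d].

Lemma dcubeE n k y : cube n k y <-> gidx n y = k.
Proof.
have e i : (((tnth k i)%:~R * side R n <= tnth y i < ((tnth k i)%:~R + 1) * side R n) : bool)
    = (tnth (gidx n y) i == tnth k i).
  rewrite tnth_mktuple floor_eq intrD.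
  by rewrite ler_pdivlMr// ltr_pdivrMr.
split=> [h|gk i]; last by rewrite e gk.
by apply: eq_from_tnth => i; apply/eqP; rewrite -e; exact: h.
Qed.

Lemma dcube_cells n (M : nat) k y :
  cube (n + M%:Z) k y <-> gidx n y \in cells M k.
Proof.
have e i : (((tnth k i)%:~R * side R (n + M%:Z) <= tnth y i < ((tnth k i)%:~R + 1) * side R (n + M%:Z)) : bool)
    = (tnth k i * (2 ^ M)%N%:Z <= tnth (gidx n y) i < (tnth k i + 1) * (2 ^ M)%N%:Z).
  rewrite tnth_mktuple floor_ge_int [in RHS]ltNge floor_ge_int -ltNge sideD.
  by rewrite ler_pdivlMr// ltr_pdivrMr// !intrM intrD !mulrA.
split=> [h|/mem_cells h i]; last by rewrite e.
by apply/mem_cells => i; rewrite -e; exact: h.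
Qed.

Lemma measurable_pbox a b : measurable (pbox a b).
Proof.
have -> : pbox a b = \bigcap_(i in [set: 'I_d]) ((fun y => tnth y i) @^-1` `[a i, b i[%classic).
  apply/seteqP; split=> [y h i _|y h i]; first by rewrite /= in_itv /=; exact: h.
  by have := h i I; rewrite /= in_itv.
apply: fin_bigcap_measurable => // i _; rewrite -[X in measurable X]setTI.
exact: (@measurable_tnth _ R d i).
Qed.

Lemma dcube_pbox n k :
  cube n k = pbox (fun i => (tnth k i)%:~R * side R n) (fun i => ((tnth k i)%:~R + 1) * side R n).
Proof. by []. Qed.

Lemma measurable_dcube n k : measurable (cube n k).
Proof. exact: measurable_pbox. Qed.
Hint Resolve measurable_dcube measurable_pbox : core.

Lemma dcube_bigsetU n (M : nat) k :
  cube (n + M%:Z) k = \big[setU/set0]_(x <- cells M k) cube n x.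
Proof.
rewrite -bigcup_seq; apply/seteqP; split=> y.
  by move=> /dcube_cells h; exists (gidx n y) => //; exact/dcubeE.
by move=> [x /= xk /dcubeE gx]; apply/dcube_cells; rewrite gx.
Qed.

Lemma trivIset_dcube n (D : set Z) : trivIset D (cube n).
Proof. by move=> x y _ _ [z [/dcubeE <- /dcubeE <-]]. Qed.

(** * Measure of cubes, local integrability and dominated convergence *)

Section Measure.
Variable mu : {measure set pt -> \bar R}.
Hypothesis mu_leb : is_lebesgue mu.

Lemma mu_pbox a b : (forall i, a i <= b i) -> mu (pbox a b) = (\prod_i (b i - a i))%:E.
Proof.
move=> ab; pose ta := [tuple a i | i < d]; pose tb := [tuple b i | i < d].
have := mu_leb (a := ta) (b := tb).
have -> : [set x | forall i, tnth ta i <= tnth x i < tnth tb i] = pbox a b.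
  by apply/seteqP; split=> y h i; have := h i; rewrite !tnth_mktuple.
move=> ->; last by move=> i; rewrite !tnth_mktuple.
by congr (_%:E); apply: eq_bigr => i _; rewrite !tnth_mktuple.
Qed.

Lemma mu_pbox_fin a b : (mu (pbox a b) < +oo)%E.
Proof.
have [ab|/forallPn[i]] := boolP [forall i, a i <= b i].
  by rewrite mu_pbox ?ltry//; exact/forallP.
rewrite -ltNge => ba; suff -> : pbox a b = set0 by rewrite measure0.
by apply/seteqP; split=> // y /(_ i) /andP[h1 h2]; have := lt_trans (le_lt_trans h1 h2) ba; rewrite ltxx.
Qed.

Lemma mu_dcube n k : mu (cube n k) = (side R n ^+ d)%:E.
Proof.
rewrite dcube_pbox mu_pbox => [|i]; last by rewrite ler_pM2r// lerDl.
congr (_%:E); under eq_bigr do rewrite -mulrBl addrAC subrr add0r mul1r.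
by rewrite big_const_ord iter_mulr_1.
Qed.

Definition locint (f : pt -> R) :=
  measurable_fun setT f /\ forall a b, mu.-integrable (pbox a b) (EFin \o f).

Lemma locint_dcube f n k : locint f -> mu.-integrable (cube n k) (EFin \o f).
Proof. by move=> [_ fi]; exact: fi. Qed.

Lemma integral_dcube_csum (F : pt -> R) n (M : nat) k : measurable_fun setT F ->
  (\int[mu]_(y in cube (n + M%:Z) k) (F y)%:E =
  \sum_(x <- cells M k) \int[mu]_(y in cube n x) (F y)%:E)%E.
Proof.
move=> mF; rewrite dcube_bigsetU integral_bigsetU_EFin//.
- exact: cells_uniq.
- exact: trivIset_dcube.
- by apply/measurable_EFinP; exact: measurable_funS mF.
Qed.

Lemma in_Lp_powR (p : R) (f : pt -> R) : 1 <= p -> in_Lp mu p%:E f ->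
  (\int[mu]_x (`|f x| `^ p)%:E < +oo)%E.
Proof.
move=> p1 [mf fp]; have p0 : 0 < p by apply: lt_le_trans p1.
have := @poweR_Lnorm _ _ _ mu (EFin \o f) p; rewrite gt_eqF// => /(_ isT).
have -> : (\int[mu]_x `|(EFin \o f) x| `^ p = \int[mu]_x (`|f x| `^ p)%:E)%E.
  by apply: eq_integral => x _; rewrite -poweR_EFin.
by move=> <-; rewrite poweR_lty.
Qed.

(** The norm with exponent [+oo] is the essential supremum only on a space of positive measure. *)
Lemma mu_setT_gt0 : (0 < mu [set: pt])%E.
Proof.
apply: (@lt_le_trans _ _ (mu (cube 0 [tuple 0 | i < d]))).
  by rewrite mu_dcube lte_fin exprn_gt0.
by apply: le_measure; rewrite ?inE.
Qed.

(** On a box, which has finite measure, [|f| <= |f|^p + 1]; for exponent [+oo] the function is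
    bounded almost everywhere. *)
Lemma in_Lp_locint (p : \bar R) (f : pt -> R) : (1 <= p)%E -> in_Lp mu p f -> locint f.
Proof.
case: p => [p|_|//].
- rewrite lee_fin => p1 fp; have [mf _] := fp; have fi := in_Lp_powR p1 fp.
  split=> // a b.
  have mfb : measurable_fun (pbox a b) f by exact: measurable_funS mf.
  have mp : measurable_fun (pbox a b) (fun x => (`|f x| `^ p)%:E).
    apply/measurable_EFinP; apply: (@measurableT_comp _ _ _ _ _ _ (fun t => t `^ p)).
      exact: measurable_powR.
    exact: measurableT_comp.
  have ip : mu.-integrable (pbox a b) (fun x => (`|f x| `^ p)%:E).
    apply/integrableP; split => //.
    apply: le_lt_trans fi.
    under eq_integral do rewrite gee0_abs ?lee_fin ?powR_ge0//.
    apply: ge0_subset_integral => //.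
      apply/measurable_EFinP; apply: (@measurableT_comp _ _ _ _ _ _ (fun t => t `^ p)).
        exact: measurable_powR.
      exact: measurableT_comp.
  have i1 : mu.-integrable (pbox a b) (fun=> 1%:E).
    by apply/integrableP; split => //; under eq_integral do rewrite gee0_abs//;
      rewrite integral_cst// mul1e mu_pbox_fin.
  apply: (le_integrable (measurable_pbox a b) _ _ (integrableD (measurable_pbox a b) ip i1)).
    exact/measurable_EFinP.
  move=> x _ /=; rewrite lee_fin [leRHS]ger0_norm ?addr_ge0 ?powR_ge0//.
  have [h|h] := leP `|f x| 1.
    by rewrite (le_trans h)// lerDr powR_ge0.
  rewrite (@le_trans _ _ (`|f x| `^ p))// ?lerDl//.
  by apply: le1r_powR => //; exact: ltW.
- move=> [mf]; rewrite unlock mu_setT_gt0 => fi.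
  split=> // a b.
  have mfb : measurable_fun (pbox a b) f by exact: measurable_funS mf.
  pose K := fine (maxe (ess_sup mu (abse \o (EFin \o f))) 0).
  have i1 : mu.-integrable (pbox a b) (fun=> K%:E).
    apply/integrableP; split => //; rewrite integral_cst//.
    by rewrite lte_mul_pinfty// mu_pbox_fin.
  apply/integrableP; split; first exact/measurable_EFinP.
  case/integrableP: i1 => _; apply: le_lt_trans.
  apply: ae_ge0_le_integral => //.
  + by apply: measurableT_comp => //; exact/measurable_EFinP.
  have := ess_sup_ge mu (abse \o (EFin \o f)).
  apply: filterS => x h _; apply: (le_trans h).
  have K0 : (0 <= maxe (ess_sup mu (abse \o (EFin \o f))) 0)%E by rewrite le_max lexx orbT.
  rewrite gee0_abs ?lee_fin ?fine_ge0// /K fineK ?le_max ?lexx//.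
  by rewrite ge0_fin_numE// /maxe; case: ifP.
Qed.

(** The majorant is [C * |f|] on the common box, which is why local integrability is enough. *)
Lemma cvg_integral_bounded (f : pt -> R) (psi : nat -> pt -> R) (psil : pt -> R) (C : R) a b :
  locint f -> (forall m, measurable_fun setT (psi m)) ->
  (forall y, psi m y @[m --> \oo] --> psil y) ->
  (forall m y, `|psi m y| <= C) ->
  (forall m y, ~ pbox a b y -> psi m y = 0) ->
  (\int[mu]_y (f y * psi m y)%:E)%E @[m --> \oo] --> (\int[mu]_y (f y * psil y)%:E)%E.
Proof.
move=> [mf fi] mpsi cpsi bpsi opsi.
pose g := (fun y => (C * `|f y|)%:E) \_ (pbox a b).
have C0 y : 0 <= C by apply: le_trans (bpsi 0%N y).
have ig : mu.-integrable setT g.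
  have h : mu.-integrable (pbox a b) (fun y => (C * `|f y|)%:E).
    apply: (eq_integrable (measurable_pbox a b) _ _ _
      (integrableZl (measurable_pbox a b) C (integrable_abse (fi a b)))).
    by move=> y _; rewrite /= EFinM.
  exact: (proj1 (integrable_mkcond _ (measurable_pbox a b)) h).
have mpl : measurable_fun setT psil.
  by apply: (measurable_fun_cvg (fun m => mpsi m)) => y _; exact: cpsi.
have [] // := @dominated_convergence _ _ _ mu setT measurableT
  (fun m y => (f y * psi m y)%:E) (fun y => (f y * psil y)%:E) g.
- by move=> m; apply/measurable_EFinP; exact: measurable_funM.
- by apply/measurable_EFinP; exact: measurable_funM.
- apply: aeW => y _; apply: cvg_EFin; first by near=> m.
  by apply: cvgM; [exact: cvg_cst|exact: cpsi].
- apply: aeW => y m _; rewrite /g /patch; case: ifPn => [_|].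
    by rewrite lee_fin normrM mulrC ler_wpM2r.
  by rewrite notin_setE => /opsi ->; rewrite mulr0 abse0.
Unshelve. all: by end_near.
Qed.

End Measure.
End Cubes.

(** * Smoothed tents over pairs of neighbouring cells *)

Section Bumps.
Variables (R : realType) (d : nat) (n : int).
Local Notation pt := (d.-tuple R).
Local Notation Z := (d.-tuple int).
Local Notation cube := (@dcube R d).
Local Notation h := (side R n).
Implicit Types (x : Z) (y : pt) (i j : 'I_d) (m : nat).

Let h_gt0 : 0 < h. Proof. exact: side_gt0. Qed.

Definition corner x j : R := (tnth x j)%:~R * h.

Definition bumpF m x i j : R -> R :=
  if j == i then hat m (corner x j) h else window m (corner x j) h.

Definition cind x y : R := \prod_j ind (corner x j) h (tnth y j).

Definition tentx x i y : R :=
  \prod_j (if j == i then tent (corner x j) h (tnth y j) else ind (corner x j) h (tnth y j)).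

Lemma smooth1_bumpF m x i j : smooth1 (bumpF m x i j).
Proof. by rewrite /bumpF; case: ifP => _; [exact: smooth1_hat|exact: smooth1_window]. Qed.

Lemma cindE x y : cind x y = (y \in cube n x)%:R.
Proof.
rewrite /cind; case: (boolP (y \in cube n x)) => [|] yx.
  rewrite big1// => j _; rewrite /ind /corner.
  by have := set_mem yx j; rewrite mulrDl mul1r => ->.
move: yx; rewrite notin_setE => /existsNP[j /negP hj].
by rewrite (bigD1 j)//= /ind /corner; move: hj; rewrite mulrDl mul1r => /negbTE ->; rewrite mul0r.
Qed.

Lemma tensor_seq_cvg (F : nat -> 'I_d -> R -> R) (G : 'I_d -> R) y :
  (forall j, F m j (tnth y j) @[m --> \oo] --> G j) ->
  tensor (F m) y @[m --> \oo] --> \prod_j G j.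
Proof.
move=> FG; rewrite /tensor; elim: (index_enum _) => [|j s IH].
  by rewrite big_nil; under eq_cvg do rewrite big_nil; exact: cvg_cst.
rewrite big_cons; under eq_cvg do rewrite big_cons.
by apply: cvgM => //; exact: FG.
Qed.

Lemma bump_cvg x i y : tensor (bumpF m x i) y @[m --> \oo] --> tentx x i y.
Proof.
apply: tensor_seq_cvg => j; rewrite /bumpF; case: ifP => _; first exact: hat_cvg.
by apply: window_cvg; exact: ltW.
Qed.

Lemma corner_shift x i : corner (zshift i 1 x) i = corner x i + h.
Proof. by rewrite /corner tnth_zshift eqxx intrD mulrDl mul1r. Qed.

Lemma corner_shift_neq x i j : j != i -> corner (zshift i 1 x) j = corner x j.
Proof. by move=> /negbTE ji; rewrite /corner tnth_zshift ji addr0. Qed.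

Lemma dbump_cvg x i y :
  tensor (dtensor i (bumpF m x i)) y @[m --> \oo] --> cind x y - cind (zshift i 1 x) y.
Proof.
have -> : cind x y - cind (zshift i 1 x) y = \prod_j (if j == i then
    ind (corner x j) h (tnth y j) - ind (corner x j + h) h (tnth y j)
    else ind (corner x j) h (tnth y j)).
  rewrite /cind (bigD1 i)//= (bigD1 (P := xpredT) i)//= [RHS](bigD1 i)//= eqxx mulrBl corner_shift.
  congr (_ * _ - _ * _); apply: eq_bigr => j ji; first by rewrite (negbTE ji).
  by rewrite corner_shift_neq// (negbTE ji).
apply: (@tensor_seq_cvg (fun m => dtensor i (bumpF m x i))) => j.
rewrite /dtensor /bumpF; case: (j == i); last by apply: window_cvg; exact: ltW.
under eq_cvg do rewrite derive1_hat.
by apply: cvgB; apply: window_cvg; exact: ltW.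
Qed.

Lemma tensor_norm_le (F : 'I_d -> R -> R) (C : R) y : 0 <= C ->
  (forall j, `|F j (tnth y j)| <= C) -> `|tensor F y| <= C ^+ d.
Proof.
move=> C0 FC; rewrite /tensor normr_prod.
apply: (@le_trans _ _ (\prod_(j < d) C)).
  by apply: ler_prod => j _; rewrite normr_ge0 FC.
by rewrite big_const_ord iter_mulr_1.
Qed.

Variable B : R.
Hypothesis B1 : 1 <= B.
Hypothesis stepB : forall t : R, `|step t| <= B.

Lemma window_le m a t : `|window m a h t| <= 2 * B.
Proof.
by rewrite (le_trans (ler_normB _ _))// mulr2n mulrDl !mul1r lerD.
Qed.

Lemma dbump_le m x i y : `|tensor (dtensor i (bumpF m x i)) y| <= (4 * B) ^+ d.
Proof.
have B0 : 0 <= B by apply: le_trans B1.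
apply: tensor_norm_le => [|j]; first by rewrite mulr_ge0.
rewrite /dtensor /bumpF; case: (j == i).
  rewrite derive1_hat (le_trans (ler_normB _ _))//.
  have -> : 4 * B = 2 * B + 2 * B by rewrite -mulrDl -natrD.
  by rewrite lerD ?window_le.
by rewrite (le_trans (window_le _ _ _))// ler_wpM2r// ler_nat.
Qed.

(** In direction [i] the tent has height [h] and the smoothing error is at most [12 * h]. The bound
    is thus proportional to [h], as the scaling of [edge_var] requires. *)
Lemma bump_le m x i y : 2 < m.+1%:R * h ->
  `|tensor (bumpF m x i) y| <= 13 * h * (2 * B) ^+ d.
Proof.
move=> mh; have B0 : 0 <= B by apply: le_trans B1.
have m0 : 0 < m.+1%:R :> R by rewrite ltr0n.
rewrite /tensor (bigD1 i)//= normrM; apply: ler_pM => //.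
  rewrite /bumpF eqxx.
  have := hat_approx m (corner x i) h (tnth y i).
  have /andP[] := tent_bounds (corner x i) (tnth y i) (ltW h_gt0).
  have : 12 / m.+1%:R <= 12 * h.
    by rewrite ler_pdivrMr// -mulrA ler_peMr// mulrC; lra.
  move: (hat _ _ _ _) (tent _ _ _) (12 / _) => u v w h1 h2 h3.
  rewrite !ler_norml => /andP[h4 h5]; apply/andP; split; lra.
rewrite normr_prod; apply: (@le_trans _ _ (\prod_(j < d) (2 * B))); last first.
  by rewrite big_const_ord iter_mulr_1.
rewrite [leRHS](bigD1 i)//= -[leLHS]mul1r; apply: ler_pM => //.
- by apply: prodr_ge0.
- by rewrite (le_trans B1)// ler_peMl// ler1n.
apply: ler_prod => j ji; rewrite normr_ge0 /bumpF (negbTE ji); exact: window_le.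
Qed.

(** Large enough for the derivative too: its second window is shifted by [h], hence [3 * h] instead
    of [2 * h]. *)
Definition sbox x : set pt := pbox (fun j => corner x j - h) (fun j => corner x j + 3 * h).

Lemma tensor_out (F : 'I_d -> R -> R) x y :
  (forall j, ~~ (corner x j - h <= tnth y j < corner x j + 3 * h) -> F j (tnth y j) = 0) ->
  ~ sbox x y -> tensor F y = 0.
Proof.
move=> F0 /existsNP[j /negP hj].
by rewrite /tensor (bigD1 j)//= F0// mul0r.
Qed.

Lemma bump_out m x i y : 2 < m.+1%:R * h -> ~ sbox x y -> tensor (bumpF m x i) y = 0.
Proof.
move=> mh; apply: tensor_out => j hj; rewrite /bumpF.
have hj' : ~~ (corner x j - h <= tnth y j < corner x j + 2 * h).
  by move: hj; rewrite !negb_and -!leNgt -!ltNge => /orP[->//|hj]; apply/orP; right; have := h_gt0; lra.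
by case: ifP => _; [exact: (hat_out (ltW h_gt0) (ltW mh))|exact: (window_out (ltW h_gt0) mh)].
Qed.

Lemma dbump_out m x i y : 2 < m.+1%:R * h -> ~ sbox x y ->
  tensor (dtensor i (bumpF m x i)) y = 0.
Proof.
move=> mh; apply: tensor_out => j hj; rewrite /dtensor /bumpF.
have hj' : ~~ (corner x j - h <= tnth y j < corner x j + 2 * h).
  by move: hj; rewrite !negb_and -!leNgt -!ltNge => /orP[->//|hj]; apply/orP; right; have := h_gt0; lra.
case: (j == i); last exact: (window_out (ltW h_gt0) mh).
rewrite derive1_hat !window_out ?subrr ?(ltW h_gt0)//.
move: hj; rewrite !negb_and -!leNgt -!ltNge => /orP[hj|hj]; apply/orP; [left|right];
  have := h_gt0; lra.
Qed.

Lemma sbox_box x y : sbox x y ->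
  x \in box [tuple tnth (gidx n y) j - 2 | j < d] 4.
Proof.
move=> hx; apply/mem_box => j; rewrite tnth_mktuple.
have /andP[h1 h2] := hx j.
have /dcubeE := erefl (gidx n y); move=> /(_ j) /andP[h3 h4].
have e1 : (tnth x j)%:~R < (tnth (gidx n y) j + 2)%:~R :> R.
  rewrite -(ltr_pM2r h_gt0) intrD mulrDl.
  by move: h1 h2 h3 h4; rewrite /corner mulrDl mul1r; lra.
have e2 : (tnth (gidx n y) j)%:~R < (tnth x j + 3)%:~R :> R.
  rewrite -(ltr_pM2r h_gt0) intrD mulrDl.
  by move: h1 h2 h3 h4; rewrite /corner mulrDl mul1r; lra.
move: e1 e2; rewrite !ltr_int; lia.
Qed.

(** By [sbox_box] at most [4 ^ d] bumps are nonzero at a point, so the bound does not depend on the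
    number of cells. This allows all cells to be tested at once against the variation. *)
Lemma combo_bump_le m (s : seq Z) (c : Z -> R) i y : 2 < m.+1%:R * h -> uniq s ->
  (forall x, `|c x| <= 1) ->
  `|combo s c (fun x => bumpF m x i) y| <= 13 * h * (2 * B) ^+ d * (4 ^ d)%N%:R.
Proof.
move=> mh us c1; have B0 : 0 <= B by apply: le_trans B1.
pose K := 13 * h * (2 * B) ^+ d.
have K0 : 0 <= K by rewrite !mulr_ge0 ?(ltW h_gt0) ?exprn_ge0 ?mulr_ge0.
rewrite /combo (le_trans (ler_norm_sum _ _ _))//.
pose bx := box [tuple tnth (gidx n y) j - 2 | j < d] 4.
apply: (@le_trans _ _ (\sum_(x <- s | x \in bx) K)).
  rewrite [leRHS]big_mkcond; apply: ler_sum => x _; case: ifP => [_|/negP nx].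
    rewrite normrM -[leRHS]mul1r; apply: ler_pM => //; exact: bump_le.
  by rewrite bump_out ?mulr0 ?normr0// => /sbox_box.
rewrite -big_filter big_const_seq count_predT iter_addr_0 -[leLHS]mulr_natr.
rewrite ler_wpM2l// ler_nat -(size_box [tuple tnth (gidx n y) j - 2 | j < d]).
apply: uniq_leq_size; first exact: filter_uniq.
by move=> x; rewrite mem_filter => /andP[].
Qed.

Lemma test_fun_combo m (s : seq Z) (c : Z -> R) i : 2 < m.+1%:R * h ->
  test_fun (combo s c (fun x => bumpF m x i)).
Proof.
move=> mh; split; first by apply: smooth_combo => p j; exact: smooth1_bumpF.
pose L := \sum_(x <- s) \sum_j (`|corner x j| + 3 * h).
exists L => y [j hj]; rewrite /combo big_seq big1// => x xs.
rewrite bump_out ?mulr0// => /(_ j) /andP[h1 h2].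
have : `|corner x j| + 3 * h <= L.
  rewrite /L (big_rem _ xs)/= (bigD1 j)//= -addrA lerDl addr_ge0//.
    by apply: sumr_ge0 => l _; rewrite addr_ge0// mulr_ge0// ltW.
  by apply: sumr_ge0 => w _; apply: sumr_ge0 => l _; rewrite addr_ge0// mulr_ge0// ltW.
rewrite leNgt => /negP; apply; apply: lt_le_trans hj _.
have := ler_norm (corner x j); have := ler_norm (- corner x j); rewrite normrN => h3 h4.
by rewrite ler_norml; apply/andP; split; have := h_gt0; lra.
Qed.

(** * Integrals against the bumps and their limits *)

Section Measure.
Variable mu : {measure set pt -> \bar R}.
Hypothesis mu_leb : is_lebesgue mu.
Local Notation locint := (locint mu).

Definition cint (f : pt -> R) x : R := \int[mu]_(y in cube n x) f y.

Lemma integrable_cind f x : locint f -> mu.-integrable setT (fun y => (f y * cind x y)%:E).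
Proof.
move=> fl; have := proj1 (integrable_mkcond _ (measurable_dcube n x)) (locint_dcube n x fl).
apply: eq_integrable => // y _; rewrite /patch cindE; case: ifP => _ /=; first by rewrite mulr1.
by rewrite mulr0.
Qed.

Lemma integral_cind f x : locint f -> (\int[mu]_y (f y * cind x y)%:E = (cint f x)%:E)%E.
Proof.
move=> fl; rewrite /cint /Rintegral fineK; last first.
  by apply: integrable_fin_num; [exact: measurable_dcube|exact: (locint_dcube n x fl)].
rewrite [RHS]integral_mkcond; apply: eq_integral => y _.
by rewrite /patch cindE; case: ifP => _ /=; rewrite ?mulr1 ?mulr0.
Qed.

Lemma integral_combo_cind f (s : seq Z) (c : Z -> R) i : locint f ->
  (\int[mu]_y (f y * \sum_(x <- s) c x * (cind x y - cind (zshift i 1 x) y))%:E =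
   (\sum_(x <- s) c x * (cint f x - cint f (zshift i 1 x)))%:E)%E.
Proof.
move=> fl.
pose G x y : \bar R := ((c x)%:E * ((f y * cind x y)%:E - (f y * cind (zshift i 1 x) y)%:E))%E.
have iG x : mu.-integrable setT (G x).
  by apply: integrableZl => //; apply: integrableB => //; exact: integrable_cind.
transitivity (\int[mu]_y (\sum_(x <- s) G x y))%E.
  apply: eq_integral => y _; rewrite mulr_sumr -sumEFin; apply: eq_bigr => x _.
  by rewrite /G -EFinB -EFinM; congr (_%:E); ring.
rewrite integral_sum// -sumEFin; apply: eq_bigr => x _.
rewrite /G integralZl//; last by apply: integrableB => //; exact: integrable_cind.
by rewrite integralB ?integral_cind ?EFinM ?EFinB//; exact: integrable_cind.
Qed.

Lemma sbox_cover (s : seq Z) : exists a b : 'I_d -> R, forall x, x \in s -> sbox x `<=` pbox a b.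
Proof.
pose L := \sum_(x <- s) \sum_j (`|corner x j| + 3 * h).
exists (fun=> - L), (fun=> L) => x xs y hy j; have /andP[h1 h2] := hy j.
have : `|corner x j| + 3 * h <= L.
  rewrite /L (big_rem _ xs)/= (bigD1 j)//= -addrA lerDl addr_ge0//.
    by apply: sumr_ge0 => l _; rewrite addr_ge0// mulr_ge0// ltW.
  by apply: sumr_ge0 => w _; apply: sumr_ge0 => l _; rewrite addr_ge0// mulr_ge0// ltW.
have := ler_norm (corner x j); have := ler_norm (- corner x j); rewrite normrN => h3 h4 h5.
apply/andP; split; have := h_gt0; lra.
Qed.

(** The bounds on size and support hold once [2 < m.+1 * h]; starting the sequences at [m0] makes
    them hold for every index. *)
Variable m0 : nat.
Hypothesis m0h : forall m, 2 < (m + m0).+1%:R * h.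

Lemma cvg_combo_deriv f (s : seq Z) (c : Z -> R) i : locint f ->
  (\int[mu]_y (f y * partial i (combo s c (fun x => bumpF (m + m0) x i)) y)%:E)%E @[m --> \oo]
  --> (\sum_(x <- s) c x * (cint f x - cint f (zshift i 1 x)))%:E.
Proof.
move=> fl; rewrite -integral_combo_cind//.
have [a [b sab]] := sbox_cover s.
have pE m : partial i (combo s c (fun x => bumpF (m + m0) x i)) =
    combo s c (fun x => dtensor i (bumpF (m + m0) x i)).
  by apply: partial_combo => p j; exact: smooth1_bumpF.
under eq_cvg do rewrite pE.
apply: (@cvg_integral_bounded _ _ mu _ _ _ (\sum_(x <- s) `|c x| * (4 * B) ^+ d) a b) => //.
- by move=> m; apply: measurable_combo => p; apply: smooth1_dtensor => j; exact: smooth1_bumpF.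
- move=> y; rewrite /combo; elim: s {sab pE} => [|x s IH].
    by rewrite big_nil; under eq_cvg do rewrite big_nil; exact: cvg_cst.
  rewrite big_cons; under eq_cvg do rewrite big_cons.
  apply: cvgD => //; apply: cvgM; first exact: cvg_cst.
  by rewrite (cvg_shiftn m0 (fun m => tensor (dtensor i (bumpF m x i)) y)); exact: dbump_cvg.
- move=> m y; rewrite /combo (le_trans (ler_norm_sum _ _ _))//; apply: ler_sum => x _.
  by rewrite normrM ler_wpM2l//; exact: dbump_le.
- move=> m y hy; rewrite /combo big_seq big1// => x xs.
  by rewrite dbump_out ?mulr0// => /(sab _ xs).
Qed.

Lemma cvg_bump g x i : locint g ->
  (\int[mu]_y (g y * combo [:: x] (fun=> 1) (fun x => bumpF (m + m0) x i) y)%:E)%E @[m --> \oo]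
  --> (\int[mu]_y (g y * tentx x i y)%:E)%E.
Proof.
move=> gl; have [a [b sab]] := sbox_cover [:: x].
have cE m y : combo [:: x] (fun=> 1) (fun x => bumpF (m + m0) x i) y = tensor (bumpF (m + m0) x i) y.
  by rewrite /combo big_seq1 mul1r.
apply: (@cvg_integral_bounded _ _ mu _ _ _ (13 * h * (2 * B) ^+ d) a b) => //.
- by move=> m; apply: measurable_combo => p j; exact: smooth1_bumpF.
- move=> y; have -> : (fun m => combo [:: x] (fun=> 1) (fun x => bumpF (m + m0) x i) y) =
      (fun m => tensor (bumpF (m + m0) x i) y) by apply/funext => m.
  by rewrite (cvg_shiftn m0 (fun m => tensor (bumpF m x i) y)); exact: bump_cvg.
- by move=> m y; rewrite cE; exact: bump_le.
- by move=> m y hy; rewrite cE bump_out// => /(sab x (mem_head _ _)).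
Qed.

Lemma tentx_bounds x i y : 0 <= tentx x i y <= h * (cind x y + cind (zshift i 1 x) y).
Proof.
rewrite /tentx (bigD1 i)//= eqxx.
have -> : \prod_(j | j != i) (if j == i then tent (corner x j) h (tnth y j)
   else ind (corner x j) h (tnth y j)) = \prod_(j | j != i) ind (corner x j) h (tnth y j).
  by apply: eq_bigr => j /negbTE ->.
set P := \prod_(_ | _) _.
have P0 : 0 <= P by apply: prodr_ge0 => j _; rewrite /ind.
have -> : cind x y = ind (corner x i) h (tnth y i) * P by rewrite /cind (bigD1 i).
have -> : cind (zshift i 1 x) y = ind (corner x i + h) h (tnth y i) * P.
  rewrite /cind (bigD1 i)//= corner_shift; congr (_ * _).
  by apply: eq_bigr => j ji; rewrite corner_shift_neq.
have /andP[t0 th] := tent_bounds (corner x i) (tnth y i) (ltW h_gt0).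
rewrite mulr_ge0//= -mulrDl mulrA ler_wpM2r//.
have [hin|hout] := boolP (corner x i <= tnth y i < corner x i + 2 * h).
  apply: (le_trans th); rewrite -[leLHS]mulr1 ler_wpM2l ?(ltW h_gt0)//.
  rewrite /ind -natrD ler1n; case/andP: hin => h1 h2.
  have [h3|h3] := ltP (tnth y i) (corner x i + h); first by rewrite h1.
  by rewrite andbF add0n; have -> : tnth y i < corner x i + h + h by lra.
by rewrite (tent_out (ltW h_gt0) hout) mulr_ge0 ?(ltW h_gt0)// addr_ge0// /ind.
Qed.

End Measure.
End Bumps.

(** * Differences of neighbouring cell integrals *)

Section Edges.
Variables (R : realType) (d : nat).
Local Notation pt := (d.-tuple R).
Local Notation Z := (d.-tuple int).
Local Notation cube := (@dcube R d).

Lemma shift_index n : exists m0 : nat, forall m, 2 < (m + m0).+1%:R * side R n.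
Proof.
have h0 := side_gt0 R n.
exists (Num.truncn (2 / side R n)) => m.
rewrite -ltr_pdivrMr//; apply: (lt_le_trans (truncnS_gt _)).
by rewrite ler_nat ltnS leq_addl.
Qed.

(** Testing with one bump and passing to the limit shows that the difference is the integral of
    [g i] against the tent, which is at most the side length and vanishes off the two cells. *)
Lemma edge_weak_grad (mu : {measure set pt -> \bar R}) (f : pt -> R) (g : 'I_d -> pt -> R) n x i :
  is_lebesgue mu -> locint mu f -> locint mu (g i) -> weak_grad mu f g ->
  `|cint n mu f (zshift i 1 x) - cint n mu f x| <=
  side R n * (cint n mu (fun y => `|g i y|) x + cint n mu (fun y => `|g i y|) (zshift i 1 x)).
Proof.
move=> leb fl gl wg.
have [B B1 stepB] := step_bounded R.
have [m0 m0h] := shift_index n.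
have c1 := cvg_combo_deriv B1 stepB m0h (s := [:: x]) (c := fun=> 1) (i := i) fl.
have c2 := cvg_bump B1 stepB m0h (x := x) (i := i) gl.
have e : (\sum_(x <- [:: x]) 1 * (cint n mu f x - cint n mu f (zshift i 1 x)))%:E =
  (- \int[mu]_y (g i y * tentx n x i y)%:E)%E.
  rewrite -(cvg_lim (@ereal_hausdorff R) c1); apply: (cvg_lim (@ereal_hausdorff R)).
  rewrite (_ : (fun m => _) = (fun m => - \int[mu]_y
    (g i y * combo [:: x] (fun=> 1) (fun x => bumpF n (m + m0) x i) y)%:E)%E).
    exact: cvgeN c2.
  apply/funext => m; rewrite wg//; exact: test_fun_combo.
move: e; rewrite big_seq1 mul1r => e.
have h0 := side_gt0 R n.
have gal : locint mu (fun y => `|g i y|).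
  split; first by apply: measurableT_comp => //; case: gl.
  by move=> a b; exact: (integrable_abse (gl.2 a b)).
have mt : measurable_fun setT (tentx n x i : pt -> R).
  have mb m : measurable_fun setT (tensor (bumpF n m x i) : pt -> R).
    by apply: measurable_tensor => j; exact: smooth1_bumpF.
  exact: (@measurable_fun_cvg _ _ _ setT _ (tentx n x i) mb (fun y _ => @bump_cvg R d n x i y)).
have mg : measurable_fun setT (g i) by case: gl.
pose G y := (side R n * (`|g i y| * cind n x y) + side R n * (`|g i y| * cind n (zshift i 1 x) y))%R.
have iG : (\int[mu]_y (G y)%:E = (side R n * (cint n mu (fun y => `|g i y|) x +
    cint n mu (fun y => `|g i y|) (zshift i 1 x)))%:E)%E.
  have i1 := integrableZl measurableT (side R n) (integrable_cind n x gal).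
  have i2 := integrableZl measurableT (side R n) (integrable_cind n (zshift i 1 x) gal).
  transitivity (\int[mu]_y ((side R n)%:E * (`|g i y| * cind n x y)%:E +
     (side R n)%:E * (`|g i y| * cind n (zshift i 1 x) y)%:E))%E.
    by apply: eq_integral => y _; rewrite /G EFinD !EFinM.
  rewrite integralD// !integralZl ?integral_cind//; try exact: integrable_cind.
  by rewrite mulrDr EFinD !EFinM.
have mc z : measurable_fun setT (cind n z : pt -> R).
  have -> : cind n z = \1_(cube n z) :> (pt -> R).
    by apply/funext => y; rewrite cindE indicE.
  by apply: measurable_indic; exact: measurable_dcube.
have mga : measurable_fun setT (fun y => `|g i y|) by case: gal.
rewrite distrC -lee_fin -abse_EFin e abseN -iG.
have mgt : measurable_fun setT (fun y => (g i y * tentx n x i y)%:E).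
  by apply/measurable_EFinP; exact: measurable_funM.
apply: (le_trans (le_abse_integral mu measurableT mgt)).
apply: ge0_le_integral => //.
- apply/measurable_EFinP; apply: measurableT_comp => //; exact: measurable_funM.
- apply/measurable_EFinP.
  have mS z : measurable_fun setT (fun y => side R n * (`|g i y| * cind n z y)).
    by apply: measurable_funM => //; exact: measurable_funM.
  exact: (measurable_funD (mS x) (mS (zshift i 1 x))).
- move=> y _; rewrite /= lee_fin normrM.
have /andP[t0 th] := tentx_bounds n x i y.
rewrite (ger0_norm t0) /G -!mulrDr mulrCA ler_wpM2l//.
Qed.

(** All edges in direction [i] are tested together, each bump carrying the sign of its difference.
    By bounded overlap the field has length at most 1 after division by [K], a fixed multiple of the
    side length. *)
Lemma edge_var : exists2 C : R, 0 <= C & forall (mu : {measure set pt -> \bar R}) (f : pt -> R) n (X : seq Z) i,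
  is_lebesgue mu -> locint mu f -> uniq X ->
  ((\sum_(x <- X) `|cint n mu f (zshift i 1 x) - cint n mu f x|)%:E <=
   (C * side R n)%:E * var mu f)%E.
Proof.
have [B B1 stepB] := step_bounded R.
have B0 : 0 < B by apply: lt_le_trans B1.
pose C : R := 13 * (2 * B) ^+ d * (4 ^ d)%N%:R.
have C0 : 0 < C by rewrite !mulr_gt0 ?exprn_gt0 ?mulr_gt0// ltr0n expn_gt0.
exists C; first exact: ltW.
move=> mu f n X i leb fl uX.
have h0 := side_gt0 R n.
have [m0 m0h] := shift_index n.
pose K := C * side R n.
have K0 : 0 < K by exact: mulr_gt0.
pose c x : R := Num.sg (cint n mu f x - cint n mu f (zshift i 1 x)).
pose c' x : R := K^-1 * c x.
have c1 := cvg_combo_deriv B1 stepB m0h (s := X) (c := c') (i := i) fl.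
have le m : (\int[mu]_y (f y * partial i (combo X c' (fun x => bumpF n (m + m0) x i)) y)%:E <= var mu f)%E.
  (* Only the [i]-th component of the field is nonzero, so its divergence is one partial
     derivative. *)
  apply: ereal_sup_ubound; pose phi j := combo X (fun x => if j == i then c' x else 0) (fun x => bumpF n (m + m0) x i).
  have phi_i : phi i = combo X c' (fun x => bumpF n (m + m0) x i).
    by apply/funext => y; apply: eq_bigr => x _; rewrite eqxx.
  have phi0 j : j != i -> phi j = fun=> 0.
    move=> /negbTE ji; apply/funext => y; rewrite /phi /combo big1// => x _.
    by rewrite ji mul0r.
  exists phi.
    split; first by move=> j; apply: test_fun_combo.
    move=> y; rewrite (bigD1 i)//= big1 ?addr0; last by move=> j ji; rewrite phi0// expr0n.
    rewrite phi_i -real_normK ?num_real// -[leRHS](expr1n _ 2) lerXn2r ?nnegrE//.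
    have -> : combo X c' (fun x => bumpF n (m + m0) x i) y =
        K^-1 * combo X c (fun x => bumpF n (m + m0) x i) y.
      by rewrite /combo mulr_sumr; apply: eq_bigr => x _; rewrite mulrA.
    rewrite normrM (ger0_norm (x := K^-1)) ?invr_ge0 ?(ltW K0)// mulrC ler_pdivrMr// mul1r.
    rewrite (le_trans (combo_bump_le B1 stepB i y (m0h m) uX _))//.
      by move=> x; rewrite /c normr_sg; case: (_ == _).
    by rewrite /K /C le_eqVlt; apply/orP; left; apply/eqP; ring.
  apply: eq_integral => y _; congr (_ * _)%:E; rewrite /divergence (bigD1 i)//= big1 ?addr0 ?phi_i//.
  by move=> j ji; rewrite phi0// /partial derive1_cst.
have h1 : ((\sum_(x <- X) c' x * (cint n mu f x - cint n mu f (zshift i 1 x)))%:E <= var mu f)%E.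
  by apply: (cvge_to_le c1); exact: nearW.
have -> : \sum_(x <- X) `|cint n mu f (zshift i 1 x) - cint n mu f x| =
   K * \sum_(x <- X) c' x * (cint n mu f x - cint n mu f (zshift i 1 x)).
  rewrite mulr_sumr; apply: eq_bigr => x _.
  by rewrite /c' !mulrA mulfV ?gt_eqF// mul1r /c distrC normrEsg.
by rewrite EFinM lee_pmul2l// lte_fin.
Qed.

End Edges.

(** * Recovering the mass of |f| from cell integrals *)

Section Approximation.
Variables (R : realType) (d : nat).
Local Notation pt := (d.-tuple R).
Local Notation Z := (d.-tuple int).
Local Notation cube := (@dcube R d).
Variable mu : {measure set pt -> \bar R}.
Hypothesis mu_leb : is_lebesgue mu.
Variables (f : pt -> R) (n : int) (k : Z).
Hypothesis f_loc : locint mu f.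
Local Notation Q := (cube n k).

Let mf : measurable_fun setT f. Proof. by case: f_loc. Qed.
Let mQ : measurable Q. Proof. exact: measurable_dcube. Qed.
Let iQ : mu.-integrable Q (EFin \o f). Proof. exact: locint_dcube. Qed.

(* The distance of [A] and [B] in the measure [|f| dmu] on [Q].  The sets that unions
   of grid cells approximate for this distance form a sigma-algebra, and applying
   this to [f > 0] shows that cell integrals recover the mass of [|f|]. *)
Definition err (A B : set pt) : \bar R :=
  (\int[mu]_(y in Q) (`|f y| * `|\1_A y - \1_B y|)%:E)%E.

Let merr A B : measurable A -> measurable B ->
  measurable_fun Q (fun y => (`|f y| * `|\1_A y - \1_B y|)%:E).
Proof.
move=> mA mB; apply/measurable_EFinP; apply: measurable_funM.
  by apply: measurableT_comp => //; exact: measurable_funS mf.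
by apply: measurableT_comp => //; apply: measurable_funB; exact: measurable_indic.
Qed.

Let le_err (A B A1 B1 A2 B2 : set pt) :
  measurable A -> measurable B -> measurable A1 -> measurable B1 ->
  measurable A2 -> measurable B2 ->
  (forall y, `|\1_A y - \1_B y| <= `|\1_A1 y - \1_B1 y| + `|\1_A2 y - \1_B2 y| :> R) ->
  (err A B <= err A1 B1 + err A2 B2)%E.
Proof.
move=> mA mB mA1 mB1 mA2 mB2 h; rewrite /err -ge0_integralD//; [|exact: merr..].
apply: ge0_le_integral => //.
- exact: merr.
- by apply: emeasurable_funD; exact: merr.
- by move=> y _; rewrite -EFinD lee_fin -mulrDr ler_wpM2l.
Qed.

Definition gset (N : nat) (L : set Z) : set pt := [set y | L (gidx (n - N%:Z) y)].

Lemma measurable_gset N L : measurable (gset N L).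
Proof.
have -> : gset N L = \bigcup_(z : Z) (if z \in L then cube (n - N%:Z) z else set0).
  apply/seteqP; split=> y.
    move=> Ly; exists (gidx (n - N%:Z) y) => //.
    by rewrite mem_set//; exact/dcubeE.
  move=> [z _]; case: ifPn => // zL /dcubeE gz.
  by rewrite /gset /= gz; exact: set_mem.
apply: countable_bigcupT_measurable => [|z]; first exact: countableP.
by case: ifP => _ //; exact: measurable_dcube.
Qed.
Hint Resolve measurable_gset : core.

Lemma gset_refine N M L : exists L', gset N L = gset (N + M) L'.
Proof.
exists [set z | exists2 x, L x & z \in cells M x].
have e : n - N%:Z = (n - (N + M)%N%:Z) + M%:Z by rewrite PoszD; ring.
apply/seteqP; split=> y.
  move=> Ly; exists (gidx (n - N%:Z) y) => //.
  by apply/dcube_cells; rewrite -e; exact/dcubeE.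
move=> [x Lx /dcube_cells]; rewrite -e => /dcubeE gx.
by rewrite /gset /= gx.
Qed.

Lemma gset_common N1 L1 N2 L2 : exists N L1' L2', gset N1 L1 = gset N L1' /\ gset N2 L2 = gset N L2'.
Proof.
exists (N1 + N2)%N.
have [L1' ->] := gset_refine N1 N2 L1; have [L2' ->] := gset_refine N2 N1 L2.
by exists L1', L2'; rewrite (addnC N2).
Qed.

Definition apx (A : set pt) : Prop :=
  measurable A /\ forall eps : R, 0 < eps -> exists N L, (err A (gset N L) <= eps%:E)%E.

Let err_refl A : err A A = 0%E.
Proof.
by rewrite /err; apply: integral0_eq => y _; rewrite subrr normr0 mulr0.
Qed.

Lemma apx_gset N L : apx (gset N L).
Proof.
by split => // eps e0; exists N, L; rewrite err_refl lee_fin ltW.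
Qed.

Lemma apxC A : apx A -> apx (~` A).
Proof.
move=> [mA hA]; split; first exact: measurableC.
move=> eps e0; have [N [L h]] := hA _ e0; exists N, (~` L).
apply: le_trans h; rewrite le_eqVlt; apply/orP; left; apply/eqP.
apply: eq_integral => y _; congr (_ * _)%:E.
have -> : gset N (~` L) = ~` gset N L by [].
rewrite !indicE !in_setC -[RHS]normrN; congr `|_|.
by case: (y \in A); case: (y \in gset N L) => /=; ring.
Qed.

Lemma apxU A B : apx A -> apx B -> apx (A `|` B).
Proof.
move=> [mA hA] [mB hB]; split; first exact: measurableU.
move=> eps e0; have e2 : 0 < eps / 2 by rewrite divr_gt0.
have [N1 [L1 h1]] := hA _ e2; have [N2 [L2 h2]] := hB _ e2.
have [N [L1' [L2' [e1 e3]]]] := gset_common N1 L1 N2 L2.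
exists N, (L1' `|` L2').
have -> : gset N (L1' `|` L2') = gset N1 L1 `|` gset N2 L2 by rewrite e1 e3.
rewrite [eps]splitr EFinD; apply: (le_trans _ (leeD h1 h2)).
apply: le_err => //; try exact: measurableU.
move=> y; rewrite !indicE !in_setU.
by case: (y \in A); case: (y \in B); case: (y \in gset N1 L1); case: (y \in gset N2 L2) => /=;
  rewrite ?subrr ?subr0 ?sub0r ?normrN ?normr1 ?normr0; lra.
Qed.

(** The pieces may need ever finer grids. By dominated convergence a finite union is already close
    to the whole one, and a finite union has a common grid. *)
Lemma apx_bigcup (F : (set pt)^nat) : (forall m, apx (F m)) -> apx (\bigcup_m F m).
Proof.
move=> aF.
have mF m : measurable (F m) by case: (aF m).
have mU : measurable (\bigcup_m F m) by exact: bigcupT_measurable.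
split=> // eps e0.
pose U m := \big[setU/set0]_(i < m) F i.
have aU m : apx (U m).
  rewrite /U; elim: m => [|m IH]; last by rewrite big_ord_recr; exact: apxU.
  by rewrite big_ord0; exact: (apx_gset 0 set0).
have mUm m : measurable (U m) by case: (aU m).
have c : (err (\bigcup_m F m) (U m))%E @[m --> \oo] --> 0%E.
  have -> : 0%E = (\int[mu]_(y in Q) (cst 0 y))%E by rewrite integral0.
  have [] // := @dominated_convergence _ _ _ mu Q mQ
    (fun m y => (`|f y| * `|\1_(\bigcup_m F m) y - \1_(U m) y|)%:E) (cst 0%E) (abse \o (EFin \o f)).
  - by move=> m; exact: merr.
  - apply: aeW => y _; apply: cvg_near_cst.
    have [[m0 _ Fy]|nF] := pselect ((\bigcup_m F m) y).
      near=> m; rewrite !indicE mem_set; last by exists m0.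
      rewrite mem_set ?subrr ?normr0 ?mulr0//.
      rewrite /U -bigcup_mkord; exists m0 => //=; near: m; exact: nbhs_infty_gt.
    near=> m; rewrite !indicE memNset// memNset ?subrr ?normr0 ?mulr0//.
    by rewrite /U -bigcup_mkord => -[i _ Fi]; apply: nF; exists i.
  - exact: integrable_abse.
  - apply: aeW => y m _; rewrite /= lee_fin normrM !normr_id ler_piMr//.
    by rewrite !indicE; case: (_ \in _); case: (_ \in _) => /=;
      rewrite ?subrr ?subr0 ?sub0r ?normrN ?normr1 ?normr0.
have e2 : 0 < eps / 2 by rewrite divr_gt0.
have [m hm] : exists m, (err (\bigcup_m F m) (U m) <= (eps / 2)%:E)%E.
  have /fine_cvgP[_ /cvgrPdist_le /(_ _ e2) [m _ hm]] := c.
  have /fine_cvgP[[m1 _ fm] _] := c.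
  exists (maxn m m1).
  have := hm _ (leq_maxl m m1); rewrite /= sub0r normrN => h.
  rewrite -[leLHS]fineK; last exact: fm (leq_maxr m m1).
  by rewrite lee_fin (le_trans (ler_norm _)).
have [N [L hL]] := (aU m).2 _ e2.
exists N, L; rewrite [eps]splitr EFinD; apply: (le_trans _ (leeD hm hL)).
apply: le_err => // y.
rewrite (_ : \1_(\bigcup_m F m) y - \1_(gset N L) y =
  (\1_(\bigcup_m F m) y - \1_(U m) y) + (\1_(U m) y - \1_(gset N L) y)); last by ring.
exact: ler_normD.
Unshelve. all: by end_near.
Qed.

(** The cells whose lower corner lies in the half-space fill it up, since the distance of a point to
    that corner is less than the side in each coordinate. *)
Lemma apx_halfspace i (a : R) : apx ((fun y : pt => tnth y i) @^-1` `]a, +oo[%classic).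
Proof.
have -> : ((fun y : pt => tnth y i) @^-1` `]a, +oo[%classic) =
   \bigcup_N gset N [set z | a < (tnth z i)%:~R * side R (n - N%:Z)].
  apply/seteqP; split=> y.
    rewrite /= in_itv /= andbT => ay.
    have [N hN] : exists N : nat, side R (n - N%:Z) < tnth y i - a.
      have := @nbhs_infty_gtr R (side R n / (tnth y i - a)) => -[N _ /(_ N (leqnn _)) hN].
      exists N; have : side R n / (tnth y i - a) < (2 ^ N)%N%:R.
        by apply: lt_trans hN _; rewrite ltr_nat ltn_expl.
      rewrite ltr_pdivrMr ?subr_gt0// -[n in side R n](subrK N%:Z n) sideD.
      by rewrite mulrC [ltRHS]mulrC ltr_pM2r// ltr0n expn_gt0.
    exists N => //; rewrite /gset /=.
    have /dcubeE := erefl (gidx (n - N%:Z) y); move=> /(_ i) /andP[h3 h4].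
    by move: h4 hN; rewrite mulrDl mul1r; lra.
  move=> [N _]; rewrite /gset /= in_itv /= andbT => h.
  have /dcubeE := erefl (gidx (n - N%:Z) y); move=> /(_ i) /andP[h3 _].
  exact: lt_le_trans h h3.
apply: apx_bigcup => N; exact: apx_gset.
Qed.

Lemma apx_measurable A : measurable A -> apx A.
Proof.
have sa : sigma_algebra setT apx.
  split; first exact: (apx_gset 0 set0).
    by move=> B aB; rewrite setTD; exact: apxC.
  exact: apx_bigcup.
apply: smallest_sub => //.
rewrite -bigcup_seq => B [i _] [C mC <-]; rewrite setTI.
(* The product sigma-algebra is generated by coordinate preimages; for one coordinate, the sets with
   approximable preimage form a sigma-algebra, and it contains the open rays that generate the Borel
   sets. *)
have sC : sigma_algebra setT (fun C : set R => apx ((fun y : pt => tnth y i) @^-1` C)).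
  split; first by rewrite preimage_set0; exact: (apx_gset 0 set0).
    by move=> D aD; rewrite setTD preimage_setC; exact: apxC.
  by move=> F aF; rewrite preimage_bigcup; exact: apx_bigcup.
have E : <<s @ocitv R >> = <<s @RGenOInfty.G R >> := RGenOInfty.measurableE R.
have : <<s @ocitv R >> C by exact: mC.
have hG : @RGenOInfty.G R `<=` (fun C : set R => apx ((fun y : pt => tnth y i) @^-1` C)).
  by move=> _ [a ->]; exact: apx_halfspace.
by rewrite E; exact: (smallest_sub sC hG).
Qed.

(** The factor of [f] is a constant sign on each cell, so each cell contributes at most the absolute
    value of its integral. *)
Let csum_cint N (L : set Z) :
  ((\int[mu]_(y in Q) (f y * (2 * \1_(gset N L) y - 1))%:E) <=
   (csum N k (fun x => `|cint (n - N%:Z) mu f x|))%:E)%E.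
Proof.
have mt : measurable_fun setT (fun y => f y * (2 * \1_(gset N L) y - 1)).
  apply: measurable_funM => //; apply: measurable_funB => //.
  by apply: measurable_funM => //; exact: measurable_indic.
have e : n = n - N%:Z + N%:Z by rewrite subrK.
rewrite {1}e integral_dcube_csum// /csum -sumEFin; apply: lee_sum => x _.
have -> : (\int[mu]_(y in cube (n - N%:Z) x) (f y * (2 * \1_(gset N L) y - 1))%:E =
   (\int[mu]_(y in cube (n - N%:Z) x) ((2 * (x \in L)%:R - 1)%:E * (f y)%:E)))%E.
  apply: eq_integral => y /set_mem /dcubeE gy.
  have -> : \1_(gset N L) y = (x \in L)%:R :> R.
    by rewrite indicE; congr (nat_of_bool _)%:R; apply/idP/idP => /set_mem h; apply: mem_set;
      move: h; rewrite /gset /= gy.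
  by rewrite -EFinM mulrC.
have ix : mu.-integrable (cube (n - N%:Z) x) (EFin \o f) by exact: locint_dcube.
rewrite integralZl//; last exact: measurable_dcube.
rewrite /cint /Rintegral -[(\int[_]_(_ in _) _)%E]fineK ?integrable_fin_num//;
  try exact: measurable_dcube.
rewrite -EFinM lee_fin (le_trans (ler_norm _))// normrM ler_piMl//.
by case: (x \in L); rewrite ?mulr1 ?mulr0 ?sub0r ?normrN ?normr1// ger0_norm; lra.
Qed.

(** For [A = {f > 0}] and the sign [t] given by a grid set, [|f|] is at most [f * t] plus [2 * |f|]
    where the sign is wrong. Hence [A] is approximated up to [eps / 2]. *)
Lemma abs_integral_approx eps : 0 < eps -> exists N,
  (\int[mu]_(y in Q) (`|f y|)%:E <=
   (csum N k (fun x => `|cint (n - N%:Z) mu f x|) + eps)%:E)%E.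
Proof.
move=> e0; pose A := [set y | 0 < f y].
have mA : measurable A.
  have -> : A = f @^-1` `]0, +oo[%classic.
    by apply/seteqP; split=> y; rewrite /A /= in_itv /= andbT.
  by rewrite -[X in measurable X]setTI; apply: mf.
have e2 : 0 < eps / 2 by rewrite divr_gt0.
have [N [L hL]] := (apx_measurable mA).2 _ e2.
exists N; rewrite EFinD; apply: le_trans (leeD (csum_cint N L) (lexx eps%:E)).
set t := fun y : pt => 2 * \1_(gset N L) y - 1 : R.
have t1 y : `|t y| <= 1.
  rewrite /t indicE; case: (y \in _); rewrite ?mulr1 ?mulr0 ?sub0r ?normrN ?normr1// ger0_norm; lra.
have mt : measurable_fun setT t.
  apply: measurable_funB => //.
  by apply: measurable_funM => //; exact: measurable_indic.
have ift : mu.-integrable Q (fun y => (f y * t y)%:E).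
  apply: (le_integrable mQ _ _ (integrable_abse iQ)).
    by apply/measurable_EFinP; apply: measurable_funS (measurable_funM mf mt).
  move=> y _; rewrite /= lee_fin normrM !normr_id ler_piMr//.
have ierr : mu.-integrable Q (fun y => (2 * (`|f y| * `|\1_A y - \1_(gset N L) y|))%:E).
  apply: (le_integrable mQ _ _ (integrableZl mQ 2 (integrable_abse iQ))).
    apply/measurable_EFinP; apply: measurable_funM => //; apply/measurable_EFinP.
    by apply: merr.
  move=> y _; rewrite /= lee_fin !normrM !normr_id ler_wpM2l// ler_piMr//.
  rewrite !indicE; case: (_ \in _); case: (_ \in _) => /=;
      by rewrite ?subrr ?subr0 ?sub0r ?normrN ?normr1 ?normr0.
have herr : (\int[mu]_(y in Q) (2 * (`|f y| * `|\1_A y - \1_(gset N L) y|))%:E <= eps%:E)%E.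
  under eq_integral do rewrite EFinM.
  rewrite ge0_integralZl//; last exact: merr.
  have -> : eps = 2 * (eps / 2) by rewrite mulrC divfK.
  by rewrite EFinM lee_pmul2l.
apply: le_trans (leeD2l _ herr); rewrite -integralD//.
apply: le_integral => //.
- exact: (integrable_abse iQ).
- exact: (integrableD mQ ift ierr).
move=> y _; rewrite -EFinD lee_fin -/(t y).
have -> : `|\1_A y - \1_(gset N L) y| = `|\1_A y - (t y + 1) / 2| :> R.
  by rewrite /t subrK mulrC mulKf.
have ht : t y = 1 \/ t y = -1.
  by rewrite /t indicE; case: (_ \in _) => /=; [left|right]; rewrite ?mulr1 ?mulr0; ring.
have hA : (0 < f y /\ \1_A y = 1 :> R) \/ (f y <= 0 /\ \1_A y = 0 :> R).
  rewrite indicE; have [h|h] := ltP 0 (f y); [left|right]; split => //.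
    by rewrite mem_set.
  by rewrite memNset// /A /= => /lt_le_trans/(_ h); rewrite ltxx.
case: ht => ->; case: hA => -[hf ->].
- rewrite (_ : 1 - (1 + 1) / 2 = 0 :> R) ?normr0; last by field.
  by rewrite gtr0_norm//; lra.
- rewrite (_ : 0 - (1 + 1) / 2 = - 1 :> R); last by field.
  by rewrite normrN normr1 ler0_norm//; lra.
- rewrite (_ : 1 - (-1 + 1) / 2 = 1 :> R); last by field.
  by rewrite normr1 gtr0_norm//; lra.
- rewrite (_ : 0 - (-1 + 1) / 2 = 0 :> R); last by field.
  by rewrite normr0 ler0_norm//; lra.
Qed.

End Approximation.

(** * Averages at different scales *)

Section Scales.
Variables (R : realType) (d : nat).
Local Notation pt := (d.-tuple R).
Local Notation Z := (d.-tuple int).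
Local Notation cube := (@dcube R d).
Implicit Types (x k K : Z) (n l : int) (M : nat).

Lemma cells_nested M M' k k' x : (M <= M')%N -> x \in cells M k -> x \in cells M' k' ->
  {subset cells M k <= cells M' k'}.
Proof.
move=> /subnKC <-; elim: (M' - M)%N k' => [|j IH] k' xk.
  by rewrite addn0 => /(cells_inj xk) ->.
rewrite addnS => /mem_cellsS[b xb] y yk.
exact: mem_cells_child (IH _ xk xb _ yk).
Qed.

Lemma child_of k : exists K b, k = child K b.
Proof.
exists [tuple (tnth k i %/ 2)%Z | i < d], [ffun i => (tnth k i %% 2)%Z == 1].
apply: eq_from_tnth => i; rewrite !tnth_mktuple ffunE.
have := divz_eq (tnth k i) 2; have := modz_ge0 (tnth k i) (d := 2) isT.
have := ltz_pmod (tnth k i) (d := 2) isT.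
move: (tnth k i %/ 2)%Z (tnth k i %% 2)%Z => a b b2 b0 ->.
by case: b b2 b0 => [[|[|m]]|m] //= _ _; rewrite mulrC.
Qed.

Lemma csum_add M j k (v : Z -> R) : csum (M + j) k v = csum M k (fun x => csum j x v).
Proof.
elim: M k => [|M IH] k; first by rewrite csum0.
by rewrite addSn !csumS; apply: eq_bigr => b _; rewrite IH.
Qed.

Lemma side_powR n M (a : R) :
  side R (n + M%:Z) `^ a = (2 `^ a) ^+ M * side R n `^ a.
Proof.
rewrite sideD natrX powRM ?exprn_ge0 ?(ltW (side_gt0 _ _))//; congr (_ * _).
by rewrite -(powR_mulrn M (ler0n R 2)) -(powR_mulrn M (powR_ge0 2 a)) powRAC.
Qed.

Variable mu : {measure set pt -> \bar R}.
Hypothesis mu_leb : is_lebesgue mu.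
Hypothesis d_gt0 : (0 < d)%N.

(** The volumes differ because [d] is positive. The definition of [Qalpha] compares cubes as sets,
    so their inequality has to be proved for sets. *)
Lemma dcube_neq n M k k' : cube n k <> cube (n + M.+1%:Z) k'.
Proof.
move=> /(congr1 mu); rewrite !mu_dcube// sideD exprMn => -[].
have h0 : 0 < side R n ^+ d by rewrite exprn_gt0// side_gt0.
move/eqP; rewrite eq_sym -[X in _ == X]mul1r (inj_eq (mulIf (lt0r_neq0 h0))).
rewrite -natrX pnatr_eq1 -expnM => /eqP h.
have := ltn_expl (M.+1 * d) (ltnSn 1); rewrite h ltnS leqn0 muln_eq0 /= => /eqP d0.
by move: d_gt0; rewrite d0.
Qed.

Lemma locint_abs (f : pt -> R) : locint mu f -> locint mu (fun y => `|f y|).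
Proof.
move=> fl; split; first by apply: measurableT_comp => //; case: fl.
by move=> a b; exact: (integrable_abse (fl.2 a b)).
Qed.

Lemma cint_EFin (f : pt -> R) n k : locint mu f ->
  (\int[mu]_(y in cube n k) (f y)%:E)%E = (cint n mu f k)%:E.
Proof.
move=> fl; rewrite /cint /Rintegral fineK//.
by apply: integrable_fin_num; [exact: measurable_dcube|exact: (locint_dcube n k fl)].
Qed.

Lemma cintD (f : pt -> R) l M k : locint mu f ->
  cint (l + M%:Z) mu f k = csum M k (cint l mu f).
Proof.
move=> fl; apply: EFin_inj; rewrite -cint_EFin// integral_dcube_csum//; last by case: fl.
by rewrite /csum -sumEFin; apply: eq_bigr => x _; rewrite cint_EFin.
Qed.

Lemma cint_ge0 (f : pt -> R) n k : (forall y, 0 <= f y) -> 0 <= cint n mu f k.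
Proof. by move=> f0; apply: Rintegral_ge0. Qed.

Lemma cint_abs (f : pt -> R) n k : locint mu f ->
  `|cint n mu f k| <= cint n mu (fun y => `|f y|) k.
Proof.
move=> fl; apply: le_normr_Rintegral; first exact: measurable_dcube.
exact: (locint_dcube n k fl).
Qed.

Definition cav (f : pt -> R) n k : R := (side R n ^+ d)^-1 * cint n mu (fun y => `|f y|) k.

Lemma avgE f n k : locint mu f -> avg mu f n k = (cav f n k)%:E.
Proof.
move=> fl; rewrite /avg cint_EFin ?EFinM//; exact: locint_abs.
Qed.

Lemma cav_ge0 f n k : 0 <= cav f n k.
Proof. by rewrite mulr_ge0 ?cint_ge0// invr_ge0 exprn_ge0// ltW// side_gt0. Qed.

Definition ulev (f : pt -> R) l x : R := `|cint l mu f x|.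

Lemma sideXd l M : side R (l + M%:Z) ^+ d = (2 ^+ d) ^+ M * side R l ^+ d.
Proof. by rewrite sideD exprMn natrX -!exprM mulnC. Qed.

Lemma cavg_ulev_le f l M k : locint mu f ->
  cavg M k (ulev f l) <= side R l ^+ d * cav f (l + M%:Z) k.
Proof.
move=> fl; rewrite /cavg /cav sideXd ler_pdivrMr ?exprn_gt0//.
have h0 : 0 < side R l ^+ d by rewrite exprn_gt0// side_gt0.
have w0 : 0 < (2 ^+ d) ^+ M :> R by rewrite !exprn_gt0.
have -> : side R l ^+ d * (((2 ^+ d) ^+ M * side R l ^+ d)^-1 * cint (l + M%:Z) mu (fun y => `|f y|) k)
   * (2 ^+ d) ^+ M = cint (l + M%:Z) mu (fun y => `|f y|) k.
  move: h0 w0; move: (side R l ^+ d) ((2 ^+ d) ^+ M) => a b a0 b0.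
  by field; rewrite !gt_eqF.
rewrite cintD; last exact: locint_abs.
by apply: ler_sum => x _; exact: cint_abs.
Qed.

(* Integrating [f] over the cells of side [2 ^ l] loses mass by cancellation; at a
   good level at least the fraction [th] of it survives. *)
Definition good_level f (th : R) n k l : Prop :=
  exists M, n = l + M%:Z /\ th * cint n mu (fun y => `|f y|) k <= csum M k (ulev f l).

(** Refining the grid only increases the sum of the absolute cell integrals, by the triangle
    inequality. Finitely many cubes therefore share a good level, the minimum of theirs. *)
Lemma good_level_down f th n k l (j : nat) : locint mu f ->
  good_level f th n k l -> good_level f th n k (l - j%:Z).
Proof.
move=> fl [M [-> h]]; exists (M + j)%N; split; first by rewrite PoszD; ring.
apply: (le_trans h); rewrite csum_add; apply: ler_sum => x _.
have -> : ulev f l x = `|csum j x (cint (l - j%:Z) mu f)|.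
  by rewrite -cintD// /ulev subrK.
exact: ler_norm_sum.
Qed.

Lemma good_level_exists f th n k : locint mu f -> th < 1 ->
  0 < cint n mu (fun y => `|f y|) k -> exists l, good_level f th n k l.
Proof.
move=> fl th1 J0; set J := cint n mu _ k in J0 *.
have e0 : 0 < (1 - th) * J by rewrite mulr_gt0// subr_gt0.
have [N] := abs_integral_approx n k fl e0.
rewrite cint_EFin; last exact: locint_abs.
rewrite lee_fin -/J => h; exists (n - N%:Z), N; split; first by rewrite subrK.
by move: h; rewrite /ulev -/J; move: (csum _ _ _) => c; lra.
Qed.

Lemma good_level_common f th (F : seq (int * Z)) : locint mu f -> th < 1 ->
  (forall Q, Q \in F -> 0 < cint Q.1 mu (fun y => `|f y|) Q.2) ->
  exists l, forall Q, Q \in F -> good_level f th Q.1 Q.2 l.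
Proof.
move=> fl th1; elim: F => [|Q F IH] hF; first by exists 0.
have [l1 h1] := IH (fun Q' h => hF Q' (mem_behead (s := Q :: F) h)).
have [l2 h2] := good_level_exists fl th1 (hF Q (mem_head _ _)).
pose l := Num.min l1 l2.
have e1 : l = l1 - `|l1 - l|%N%:Z.
  by rewrite gez0_abs ?subr_ge0 ?ge_min ?lexx//; ring.
have e2 : l = l2 - `|l2 - l|%N%:Z.
  by rewrite gez0_abs ?subr_ge0 ?ge_min ?lexx ?orbT//; ring.
exists l => Q'; rewrite inE => /orP[/eqP ->|Q'F].
  by rewrite e2; exact: good_level_down.
by rewrite e1; apply: good_level_down => //; exact: h1.
Qed.

End Scales.

(** * Finite sums over Qalpha *)

Section FiniteSums.
Variables (R : realType) (d : nat).
Local Notation pt := (d.-tuple R).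
Local Notation Z := (d.-tuple int).
Local Notation cube := (@dcube R d).
Local Notation W := (2 ^+ d : R).
Hypothesis d_gt0 : (0 < d)%N.
Variable alpha : R.
Hypothesis alpha_gt0 : 0 < alpha.

(** The gain [T] per level is the square of [A0]: one factor pays for the mass lost at a level that
    is good for [A0^-1], the other is the gap that [discrete_energy] asks for. *)
Local Notation T := (2 `^ alpha).
Local Notation A0 := (2 `^ (alpha / 2)).

Let T_gt0 : 0 < T. Proof. exact: powR_gt0. Qed.
Let A0_gt1 : 1 < A0.
Proof.
by rewrite /powR pnatr_eq0 /= -[ltLHS]expR0 ltr_expR mulr_gt0// ?ln_gt0 ?ltr1n// divr_gt0.
Qed.
Let A0_gt0 : 0 < A0. Proof. exact: lt_trans A0_gt1. Qed.
Let TE : T = A0 * A0.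
Proof. by rewrite -powRD -?splitr// pnatr_eq0 implybT. Qed.
Let T_gt1 : 1 < T.
Proof. by rewrite TE -[ltLHS]mulr1 ltr_pM. Qed.
Let W_gt0 : 0 < W. Proof. by rewrite exprn_gt0. Qed.

Section Function.
Variable mu : {measure set pt -> \bar R}.
Hypothesis mu_leb : is_lebesgue mu.
Variable f : pt -> R.
Hypothesis fl : locint mu f.

Lemma Qalpha_lt n k m k' : Qalpha mu alpha f (n, k) ->
  cube n k `<=` cube m k' -> cube n k <> cube m k' ->
  side R m `^ alpha * cav mu f m k' < side R n `^ alpha * cav mu f n k.
Proof.
by move=> /(_ m k') h s ns; have := h s ns; rewrite /= !avgE// -!EFinM lte_fin.
Qed.

Lemma dcube_sub l M M' k k' : {subset cells M k <= cells M' k'} ->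
  cube (l + M%:Z) k `<=` cube (l + M'%:Z) k'.
Proof. by move=> s y /dcube_cells/s h; exact/dcube_cells. Qed.

Lemma Qalpha_nested l M M' k k' : Qalpha mu alpha f (l + M%:Z, k) -> (M < M')%N ->
  {subset cells M k <= cells M' k'} ->
  T ^+ (M' - M) * cav mu f (l + M'%:Z) k' < cav mu f (l + M%:Z) k.
Proof.
move=> hQ MM' s; have := Qalpha_lt hQ (@dcube_sub l M M' k k' s).
have -> : l + M'%:Z = l + M%:Z + (M' - M.+1).+1%:Z by lia.
move=> /(_ (@dcube_neq R d mu mu_leb d_gt0 _ _ _ _)).
rewrite side_powR -(subnSK MM') mulrAC.
have sa : 0 < side R (l + M%:Z) `^ alpha by rewrite powR_gt0// side_gt0.
by rewrite mulrC ltr_pM2l.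
Qed.

(** The comparison with the parent is strict and its smaller side is nonnegative. *)
Lemma Qalpha_cint_gt0 n k : Qalpha mu alpha f (n, k) -> 0 < cint n mu (fun y => `|f y|) k.
Proof.
have [K [b ->]] := child_of k; rewrite -(addr0 n) => hQ.
have s : {subset cells 0 (child K b) <= cells 1 K} by move=> x; exact: mem_cells_child.
have := Qalpha_nested (M := 0) hQ (ltnSn 0) s.
move=> h; have : 0 < cav mu f (n + 0%N%:Z) (child K b).
  by apply: le_lt_trans h; rewrite mulr_ge0 ?cav_ge0// exprn_ge0// ltW.
by rewrite /cav pmulr_rgt0// invr_gt0 exprn_gt0// side_gt0.
Qed.

Lemma good_cavg l M k : good_level mu f A0^-1 (l + M%:Z) k l ->
  side R l ^+ d * cav mu f (l + M%:Z) k <= A0 * cavg M k (ulev mu f l).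
Proof.
move=> [M2 [/addrI [<-] h]].
have h0 : 0 < side R l ^+ d by rewrite exprn_gt0// side_gt0.
have w0 : 0 < W ^+ M by rewrite !exprn_gt0.
rewrite /cav sideXd /cavg mulrA ler_pdivlMr//.
move: h; rewrite mulrC ler_pdivrMr// mulrC => h; apply: le_trans h.
rewrite le_eqVlt; apply/orP; left; apply/eqP.
move: h0 w0; move: (side R l ^+ d) (W ^+ M) => a b a0 b0.
by field; rewrite !gt_eqF.
Qed.

(** Only the smaller cube needs a good level: the discrete average of the larger one never exceeds
    its true average, by [cavg_ulev_le]. *)
Lemma cavg_nested l M M' k k' : Qalpha mu alpha f (l + M%:Z, k) ->
  good_level mu f A0^-1 (l + M%:Z) k l -> (M < M')%N ->
  {subset cells M k <= cells M' k'} ->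
  T ^+ (M' - M) * cavg M' k' (ulev mu f l) <= A0 * cavg M k (ulev mu f l).
Proof.
move=> hQ hg MM' s; apply: le_trans (good_cavg hg).
have h0 : 0 < side R l ^+ d by rewrite exprn_gt0// side_gt0.
apply: (@le_trans _ _ (T ^+ (M' - M) * (side R l ^+ d * cav mu f (l + M'%:Z) k'))).
  by rewrite ler_wpM2l ?exprn_ge0 ?(ltW T_gt0)//; exact: cavg_ulev_le.
by rewrite mulrCA ler_pM2l// ltW//; exact: Qalpha_nested hQ MM' s.
Qed.

End Function.

Lemma map_exists (S S' : eqType) (q : S' -> S) (F : seq S) :
  (forall Q, Q \in F -> exists t, Q = q t) -> exists D, F = map q D.
Proof.
elim: F => [|Q F IH] h; first by exists [::].
have [D ->] := IH (fun Q' hQ => h Q' (mem_behead (s := Q :: F) hQ)).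
by have [t ->] := h Q (mem_head _ _); exists (t :: D).
Qed.

Lemma sum_parents_le (D : seq (nat * Z * {ffun 'I_d -> bool})) (g : nat * Z -> R) :
  uniq D -> (forall P, 0 <= g P) ->
  \sum_(t <- D) g t.1 <= W * \sum_(P <- undup (map fst D)) g P.
Proof.
move=> uD g0; set Ps := undup _.
apply: (@le_trans _ _ (\sum_(t <- [seq (P, b) | P <- Ps, b <- enum {ffun 'I_d -> bool}]) g t.1)).
  apply: le_sum_subseq => // -[P b] tD.
  apply/allpairsP; exists (P, b); rewrite mem_enum; split => //=.
  by rewrite mem_undup; apply/mapP; exists (P, b).
rewrite big_allpairs mulr_sumr le_eqVlt; apply/orP; left; apply/eqP.
by apply: eq_bigr => P _; rewrite big_enum /= sum_children_const.
Qed.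

(** The exponent of [side R l] collects [d - p] from the weights and [- d * p] from turning averages
    into cell integrals. The grid depends on [F], the constant does not. Weak gradient and variation
    enter only later, through the differences on the right. *)
Lemma finite_sum_bound (p : R) : 1 <= p -> exists C : R, 0 <= C /\
  forall (mu : {measure set pt -> \bar R}) (f : pt -> R) (F : seq (int * Z)),
    is_lebesgue mu -> locint mu f -> uniq F ->
    (forall Q, Q \in F -> Qalpha mu alpha f Q) ->
    exists l X, uniq X /\
      \sum_(Q <- F) side R Q.1 `^ (d%:R - p) * cav mu f Q.1 Q.2 `^ p <=
      C * side R l `^ (d%:R - p - d%:R * p) *
        \sum_(x <- X) \sum_i `|cint l mu f (zshift i 1 x) - cint l mu f x| `^ p.
Proof.
move=> p1; have p0 : 0 < p by exact: lt_le_trans p1.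
have l0 : 0 < T^-1 by rewrite invr_gt0.
have l1 : T^-1 < 1 by rewrite invf_lt1.
(* Averages decay by [T^-1] per level; the constant [A0 * W] is lost to the grid and in passing from
   a child to its parent. *)
have [Cd [Cd0 HCd]] := discrete_energy d_gt0 (A0 * W) A0_gt1 p1 l0 l1.
(* The first factor bounds the true average of a child by the discrete one of its parent, the second
   accounts for the doubled side. *)
pose c1 := (A0 * W) `^ p * 2 `^ (p - d%:R).
have c10 : 0 <= c1 by rewrite mulr_ge0 ?powR_ge0.
exists (c1 * (W * Cd)); split; first by rewrite !mulr_ge0// ltW.
move=> mu f F leb fl uF hF.
have th1 : A0^-1 < 1 by rewrite invf_lt1.
have posF Q : Q \in F -> 0 < cint Q.1 mu (fun y => `|f y|) Q.2.
  by case: Q => n k /hF; exact: Qalpha_cint_gt0.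
have [l hl] := good_level_common fl th1 posF.
pose q (t : nat * Z * {ffun 'I_d -> bool}) := (l + t.1.1%:Z, child t.1.2 t.2).
have [D FD] : exists D, F = map q D.
  apply: map_exists => -[n k] /hl[M /= [-> _]]; have [K [b ->]] := child_of k.
  by exists ((M, K), b).
have uD : uniq D by apply: (@map_uniq _ _ q); rewrite -FD.
have DQ t : t \in D -> Qalpha mu alpha f (q t) /\ good_level mu f A0^-1 (q t).1 (q t).2 l.
  move=> tD; have tF : q t \in F by rewrite FD map_f.
  by split; [exact: (hF _ tF)|exact: (hl _ tF)].
pose u := ulev mu f l.
have u0 x : 0 <= u x by exact: normr_ge0.
pose Ps := undup (map fst D).
have PsD P : P \in Ps -> exists b, (P, b) \in D.
  by rewrite mem_undup => /mapP[[P' b] tD ->]; exists b.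
pose X := undup (flatten [seq cells P.1.+1 P.2 | P <- Ps]).
exists l, X; split; first exact: undup_uniq.
have H0 : 0 < side R l ^+ d by rewrite exprn_gt0// side_gt0.
have subch M (K : Z) b : {subset cells M (child K b) <= cells M.+1 K}.
  by move=> x; exact: mem_cells_child.
have h1 M (K : Z) b : ((M, K), b) \in D -> A0 * cavg M.+1 K u <= cavg M (child K b) u.
  move=> /DQ[/= hQ hg].
  have := cavg_nested leb fl hQ hg (ltnSn M) (@subch M K b).
  by rewrite subSnn expr1 TE -mulrA ler_pM2l.
have pos M (K : Z) b : ((M, K), b) \in D -> 0 < cavg M (child K b) u.
  move=> tD; have [/= hQ hg] := DQ _ tD.
  have J0 := Qalpha_cint_gt0 leb fl hQ.
  have := good_cavg hg; rewrite -(pmulr_rgt0 _ A0_gt0); apply: lt_le_trans.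
  by rewrite mulr_gt0// mulr_gt0// invr_gt0 exprn_gt0// side_gt0.
have hCd := HCd u Ps X u0 (undup_uniq _) (undup_uniq _).
have {}hCd : \sum_(P <- Ps) (2 ^+ P.1.+1) `^ (d%:R - p) * cavg P.1.+1 P.2 u `^ p <=
    Cd * \sum_(x <- X) \sum_i diffi u i x `^ p.
  apply: hCd.
  - move=> P Pin x xP; rewrite mem_undup; apply/flatten_mapP; by exists P.
  - move=> [M K] /PsD[b tD].
    have := pos _ _ _ tD; have := cavg_child_le M K b u0.
    by move=> /[swap] /lt_le_trans /[apply]; rewrite pmulr_rgt0.
  - by move=> [M K] /PsD[b tD]; exists b; exact: h1.
  - move=> [M K] [M' K'] /PsD[b tD] _ /= MM' x xP xP'.
    have [/= hQ hg] := DQ _ tD.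
    (* The child belongs to [Qalpha], its parent need not. Comparing the child with the larger
       parent gives one power of [T] more than required. *)
    have s : {subset cells M (child K b) <= cells M'.+1 K'}.
      move=> y /subch; apply: (cells_nested _ xP xP'); exact: leqW.
    have := cavg_nested leb fl hQ hg (leqW MM') s.
    have := cavg_child_le M K b u0.
    rewrite exprVn.
    have Tj : 0 < T ^+ (M' - M) by rewrite exprn_gt0.
    have : T ^+ (M' - M) <= T ^+ (M'.+1 - M) by rewrite ler_weXn2l ?(ltW T_gt1)// leq_sub2r.
    have := cavg_ge0 M'.+1 K' u0.
    move: (cavg M'.+1 K' u) (cavg M (child K b) u) (cavg M.+1 K u) => a b' c' a0 T1 h2 h3.
    have -> : A0 * W / T ^+ (M' - M) * c' = (A0 * (W * c')) / T ^+ (M' - M) by ring.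
    rewrite ler_pdivlMr//.
    apply: (@le_trans _ _ (A0 * b')); last by rewrite ler_pM2l.
    by apply: le_trans h3; rewrite mulrC ler_wpM2r.
rewrite FD big_map.
apply: (@le_trans _ _ (\sum_(t <- D) c1 * side R l `^ (d%:R - p - d%:R * p) *
    ((2 ^+ t.1.1.+1) `^ (d%:R - p) * cavg t.1.1.+1 t.1.2 u `^ p))).
  rewrite big_seq [leRHS]big_seq; apply: ler_sum => -[[M K] b] tD /=.
  have [/= hQ hg] := DQ _ tD.
  have hc : cav mu f (l + M%:Z) (child K b) <= (side R l ^+ d)^-1 * (A0 * W * cavg M.+1 K u).
    rewrite mulrC ler_pdivlMr// mulrC (le_trans (good_cavg hg))//.
    by rewrite -mulrA ler_pM2l//; exact: cavg_child_le.
  have c0 := cavg_ge0 M.+1 K u0.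
  have hp : cav mu f (l + M%:Z) (child K b) `^ p <=
      (side R l ^+ d)^-1 `^ p * ((A0 * W) `^ p * cavg M.+1 K u `^ p).
    have w0 : 0 <= A0 * W by rewrite mulr_ge0// ltW.
    have i0 : 0 <= (side R l ^+ d)^-1 by rewrite invr_ge0 ltW.
    rewrite -(powRM p w0 c0) -(powRM p i0 (mulr_ge0 w0 c0)).
    by apply: le_powR => //; [exact: ltW|exact: cav_ge0].
  apply: (@le_trans _ _ (side R (l + M%:Z) `^ (d%:R - p) * ((side R l ^+ d)^-1 `^ p * ((A0 * W) `^ p * cavg M.+1 K u `^ p)))).
    by rewrite ler_wpM2l ?powR_ge0.
  have sl := side_gt0 R l.
  have e1 : side R (l + M%:Z) `^ (d%:R - p) =
      2 `^ (p - d%:R) * (2 ^+ M.+1) `^ (d%:R - p) * side R l `^ (d%:R - p).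
    rewrite sideD natrX powRM ?exprn_ge0 ?(ltW sl)//; congr (_ * _).
    rewrite exprS powRM ?exprn_ge0// mulrA -powRD ?pnatr_eq0 ?implybT//.
    by rewrite (_ : p - d%:R + (d%:R - p) = 0) ?powRr0 ?mul1r//; ring.
  have e2 : (side R l ^+ d)^-1 `^ p = side R l `^ (- (d%:R * p)).
    rewrite -(powR_mulrn d (ltW sl)) -powRN -powRrM; congr (_ `^ _); ring.
  have e3 : side R l `^ (d%:R - p - d%:R * p) = side R l `^ (d%:R - p) * side R l `^ (- (d%:R * p)).
    by rewrite -powRD// (gt_eqF sl) implybT.
  rewrite e1 e2 e3 /c1 le_eqVlt; apply/orP; left; apply/eqP.
  move: (_ `^ p) (2 `^ _) ((2 ^+ _) `^ _) (side R l `^ _) (side R l `^ _) => *; ring.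
rewrite -mulr_sumr.
have S0 : 0 <= side R l `^ (d%:R - p - d%:R * p) by exact: powR_ge0.
apply: (@le_trans _ _ (c1 * side R l `^ (d%:R - p - d%:R * p) *
   (W * (Cd * \sum_(x <- X) \sum_i diffi u i x `^ p)))).
  rewrite ler_wpM2l ?mulr_ge0//.
  apply: (le_trans (@sum_parents_le D (fun P => (2 ^+ P.1.+1) `^ (d%:R - p) * cavg P.1.+1 P.2 u `^ p) uD _)).
    by move=> P; rewrite mulr_ge0 ?powR_ge0.
  by rewrite ler_pM2l.
have -> : c1 * (W * Cd) * side R l `^ (d%:R - p - d%:R * p) = c1 * side R l `^ (d%:R - p - d%:R * p) * (W * Cd).
  by ring.
rewrite [W * (Cd * _)]mulrA !mulrA ler_wpM2l ?mulr_ge0 ?(ltW W_gt0)//.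
apply: ler_sum => x _; apply: ler_sum => i _.
(* [u] is an absolute value, so its differences are at most those of the signed cell integrals. *)
apply: le_powR; [exact: ltW|exact: normr_ge0|exact: ler_dist_dist].
Qed.

(** No sum over scales arises here. The averages of child and parent differ by at most a multiple of
    [cosc], and the parent's is at most [A0^-1] times the child's; hence the child's average is
    bounded by a multiple of [cosc]. *)
Lemma pointwise_bound : exists C : R, 0 <= C /\
  forall (mu : {measure set pt -> \bar R}) (f : pt -> R) (Q : int * Z) (r : R),
    is_lebesgue mu -> locint mu f ->
    (forall n x i, `|cint n mu f (zshift i 1 x) - cint n mu f x| <= side R n * side R n ^+ d * r) ->
    Qalpha mu alpha f Q -> cav mu f Q.1 Q.2 <= C * side R Q.1 * r.
Proof.
have a1 : 0 < 1 - A0^-1 by rewrite subr_gt0 invf_lt1.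
exists (A0 / (1 - A0^-1) * (d%:R * (W / 2)) * (d%:R * 2)); split.
  by rewrite !mulr_ge0 ?invr_ge0 ?(ltW A0_gt0) ?(ltW W_gt0) ?(ltW a1).
move=> mu f [n k] r leb fl hr hQ /=.
have th1 : A0^-1 < 1 by rewrite invf_lt1.
have [l hg] := good_level_exists fl th1 (Qalpha_cint_gt0 leb fl hQ).
have [M [nE _]] := hg; have [K [b kE]] := child_of k; subst n k.
pose u := ulev mu f l.
have s : {subset cells M (child K b) <= cells M.+1 K} by move=> x; exact: mem_cells_child.
have := cavg_nested leb fl hQ hg (ltnSn M) s.
rewrite subSnn expr1 TE -mulrA ler_pM2l// => h1.
have h2 := good_cavg hg.
have h3 := le_trans (ler_norm _) (cavg_child_diff M K b u).
have H0 : 0 < side R l ^+ d by rewrite exprn_gt0// side_gt0.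
have h4 : cosc M.+1 K u <= d%:R * 2 * side R (l + M%:Z) * r * side R l ^+ d.
  have ho x : osc u x <= d%:R * (side R l * side R l ^+ d * r).
    have -> : d%:R * (side R l * side R l ^+ d * r) = \sum_(i < d) (side R l * side R l ^+ d * r).
      by rewrite sumr_const card_ord mulr_natl.
    by apply: ler_sum => i _; apply: le_trans (hr l x i); exact: ler_dist_dist.
  have Wn : 0 < W ^+ M.+1 by rewrite exprn_gt0.
  apply: (@le_trans _ _ (2 ^+ M.+1 / W ^+ M.+1 * csum M.+1 K (fun=> d%:R * (side R l * side R l ^+ d * r)))).
    by rewrite ler_wpM2l ?divr_ge0 ?exprn_ge0 ?(ltW W_gt0)//; apply: ler_sum => x _.
  rewrite csum_const sideD natrX exprS le_eqVlt; apply/orP; left; apply/eqP.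
  move: Wn; move: (W ^+ M.+1) => w w0; field; exact: lt0r_neq0.
have h5 : (1 - A0^-1) * cavg M (child K b) u <= d%:R * (W / 2) * cosc M.+1 K u.
  apply: le_trans h3; rewrite mulrBl mul1r lerD2l lerN2 ler_pdivlMl//.
rewrite -(ler_pM2l H0); apply: (le_trans h2).
have c0 : 0 <= d%:R * (W / 2) by rewrite mulr_ge0 ?divr_ge0 ?(ltW W_gt0).
have h6 : (1 - A0^-1) * cavg M (child K b) u <=
    d%:R * (W / 2) * (d%:R * 2 * side R (l + M%:Z) * r * side R l ^+ d).
  by apply: (le_trans h5); rewrite ler_wpM2l.
rewrite -ler_pdivlMl// in h6.
apply: (@le_trans _ _ (A0 * ((1 - A0^-1)^-1 *
   (d%:R * (W / 2) * (d%:R * 2 * side R (l + M%:Z) * r * side R l ^+ d))))).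
  by rewrite ler_pM2l.
rewrite le_eqVlt; apply/orP; left; apply/eqP.
move: (A0) (_^-1) W (side R l ^+ d) (side R _) => *; ring.
Qed.

End FiniteSums.

(** * Cell differences of Sobolev functions *)

Section Sobolev.
Variables (R : realType) (d : nat).
Local Notation pt := (d.-tuple R).
Local Notation Z := (d.-tuple int).
Local Notation cube := (@dcube R d).

Section Measure.
Variable mu : {measure set pt -> \bar R}.
Hypothesis mu_leb : is_lebesgue mu.

Lemma integrable_powR (p : R) (g : pt -> R) : 1 <= p -> in_Lp mu p%:E g ->
  mu.-integrable setT (fun y => (`|g y| `^ p)%:E).
Proof.
move=> p1 gp; have [mg _] := gp; apply/integrableP; split.
  by apply/measurable_EFinP; apply: (@measurableT_comp _ _ _ _ _ _ (@powR R ^~ p)) => //; exact: measurableT_comp.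
under eq_integral do rewrite gee0_abs ?lee_fin ?powR_ge0//.
exact: in_Lp_powR.
Qed.

Lemma integrable_locint (w : pt -> R) : mu.-integrable setT (EFin \o w) -> locint mu w.
Proof.
move=> wi; split; first by apply/measurable_EFinP; case/integrableP: wi.
by move=> a b; apply: integrableS wi => //; exact: measurable_pbox.
Qed.

Lemma sum_cint_le (w : pt -> R) n (X : seq Z) : (forall y, 0 <= w y) ->
  mu.-integrable setT (EFin \o w) -> uniq X ->
  \sum_(x <- X) cint n mu w x <= \int[mu]_y w y.
Proof.
move=> w0 wi uX; have [mw _] := integrableP _ _ _ wi.
rewrite -lee_fin /Rintegral fineK; last exact: integrable_fin_num.
rewrite -sumEFin; under eq_bigr => x _ do rewrite -(cint_EFin _ _ (integrable_locint wi)).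
rewrite -(ge0_integral_bigsetU _ (@measurable_dcube R d n) uX).
- apply: ge0_subset_integral => //; last by move=> x _; rewrite lee_fin.
  by apply: bigsetU_measurable => x _; exact: measurable_dcube.
- exact: trivIset_dcube.
- exact: measurable_funS mw.
- by move=> x _; rewrite lee_fin.
Qed.

Lemma cint_powR_le (p : R) (g : pt -> R) n x : 1 <= p -> in_Lp mu p%:E g ->
  cint n mu (fun y => `|g y|) x `^ p <=
  2 `^ p * (side R n ^+ d) `^ (p - 1) * cint n mu (fun y => `|g y| `^ p) x.
Proof.
move=> p1 gp.
have gl : locint mu (fun y => `|g y|).
  by apply/locint_abs/(in_Lp_locint mu_leb _ gp); rewrite lee_fin.
have pl := integrable_locint (integrable_powR p1 gp).
have mc := @measurable_dcube R d n x.
apply: jensen_of_young => //; first exact: cint_ge0.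
  by rewrite exprn_gt0// side_gt0.
move=> s s0.
have ci : mu.-integrable (cube n x) (fun=> s%:E).
  apply/integrableP; split=> //; rewrite integral_cst// mu_dcube//.
  by rewrite -EFinM ltry.
have i1 := locint_dcube n x gl; have i2 := locint_dcube n x pl.
have i3 : mu.-integrable (cube n x) (EFin \o (fun y => s `^ (1 - p) * `|g y| `^ p)).
  exact: (integrableZl mc _ i2).
have -> : s `^ (1 - p) * cint n mu (fun y => `|g y| `^ p) x + s * side R n ^+ d =
    \int[mu]_(y in cube n x) (s `^ (1 - p) * `|g y| `^ p + s).
  rewrite RintegralD//; congr (_ + _); first by rewrite RintegralZl.
  by rewrite /Rintegral integral_cst// mu_dcube.
apply: le_Rintegral => //; first exact: (integrableD mc i3 ci).
by move=> y _; exact: young_shift.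
Qed.

(** In [4^p], one [2^p] comes from the sum over two cells and one from Jensen's inequality. The
    factor 2 is there because a cell can be the lower end of one edge and the upper end of
    another. *)
Lemma sum_diffi_weak_grad (p : R) (f : pt -> R) (g : 'I_d -> pt -> R) n (X : seq Z) i :
  1 <= p -> W1p mu p%:E f g -> uniq X ->
  \sum_(x <- X) `|cint n mu f (zshift i 1 x) - cint n mu f x| `^ p <=
  2 * 4 `^ p * side R n `^ p * (side R n ^+ d) `^ (p - 1) * \int[mu]_y (`|g i y| `^ p).
Proof.
move=> p1 [fp [gp wg]] uX; have p0 : 0 <= p by exact: le_trans p1.
have ep1 : (1 <= p%:E)%E by rewrite lee_fin.
have h0 := ltW (side_gt0 R n).
have fl := in_Lp_locint mu_leb ep1 fp; have gl := in_Lp_locint mu_leb ep1 (gp i).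
pose a x := cint n mu (fun y => `|g i y|) x.
pose b x := cint n mu (fun y => `|g i y| `^ p) x.
have a0 x : 0 <= a x by exact: cint_ge0.
pose c := 4 `^ p * side R n `^ p * (side R n ^+ d) `^ (p - 1).
have c0 : 0 <= c by rewrite !mulr_ge0 ?powR_ge0.
apply: (@le_trans _ _ (\sum_(x <- X) (c * (b x + b (zshift i 1 x))))).
  apply: ler_sum => x _.
  have := edge_weak_grad n x mu_leb fl gl wg; rewrite -/(a _) -/(a _) => h.
  have hp : (side R n * (a x + a (zshift i 1 x))) `^ p <= c * (b x + b (zshift i 1 x)).
    rewrite powRM ?addr_ge0//.
    apply: (@le_trans _ _ (side R n `^ p * (2 `^ p * a x `^ p + 2 `^ p * a (zshift i 1 x) `^ p))).
      rewrite ler_wpM2l ?powR_ge0//.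
      by have := @powR_add_le _ (a x) (a (zshift i 1 x)) p 1 ltr01 p0 (a0 _) (a0 _); rewrite invr1.
    have q x' : a x' `^ p <= 2 `^ p * (side R n ^+ d) `^ (p - 1) * b x'.
      exact: cint_powR_le.
    apply: (@le_trans _ _ (side R n `^ p * (2 `^ p * (2 `^ p * (side R n ^+ d) `^ (p - 1) * b x) +
       2 `^ p * (2 `^ p * (side R n ^+ d) `^ (p - 1) * b (zshift i 1 x))))).
      by rewrite ler_wpM2l ?powR_ge0// lerD// ler_wpM2l ?powR_ge0.
    rewrite /c; have -> : 4 `^ p = 2 `^ p * 2 `^ p :> R.
      by rewrite -powRM//; congr (_ `^ _); rewrite -natrM.
    rewrite le_eqVlt; apply/orP; left; apply/eqP.
    move: (b _) (b _) (2 `^ p) (_ `^ _) (_ `^ _) => *; ring.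
  by apply: le_trans hp; apply: le_powR.
rewrite -mulr_sumr big_split /= -(big_map (zshift i 1) xpredT b).
have -> : 2 * 4 `^ p * side R n `^ p * (side R n ^+ d) `^ (p - 1) * \int[mu]_y (`|g i y| `^ p)
    = c * (\int[mu]_y (`|g i y| `^ p) + \int[mu]_y (`|g i y| `^ p)).
  by rewrite /c; move: (Rintegral _ _ _) (_ `^ _) (_ `^ _) (_ `^ _) => *; ring.
have gi := integrable_powR p1 (gp i).
have w0 y : 0 <= `|g i y| `^ p by exact: powR_ge0.
rewrite ler_wpM2l// lerD//; apply: sum_cint_le => //.
by rewrite map_inj_uniq//; exact: zshift_inj.
Qed.

End Measure.
End Sobolev.

(** * The three parts of the theorem *)

Section Extended.
Variables (R : realType) (d : nat).
Local Notation pt := (d.-tuple R).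
Local Notation Z := (d.-tuple int).
Local Notation cube := (@dcube R d).

Lemma esum_le_seq (T : choiceType) (S : set T) (a : T -> \bar R) (B : \bar R) :
  (forall F : seq T, uniq F -> (forall x, x \in F -> S x) -> (\sum_(x <- F) a x <= B)%E) ->
  (\esum_(x in S) a x <= B)%E.
Proof.
move=> h; apply: ge_ereal_sup => _ [A [fA AS] <-]; rewrite fsbig_finite//.
by apply: h => [|x]; [exact: finmap.fset_uniq|rewrite in_fset_set// inE => /AS].
Qed.

Lemma gradnorm_ge (g : 'I_d -> pt -> R) i y : `|g i y| <= gradnorm g y.
Proof.
rewrite -sqrtr_sqr ler_wsqrtr// (bigD1 i)//= lerDl.
by apply: sumr_ge0 => j _; exact: sqr_ge0.
Qed.

Lemma gradnorm_ge0 (g : 'I_d -> pt -> R) y : 0 <= gradnorm g y.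
Proof. exact: sqrtr_ge0. Qed.

Lemma measurable_gradnorm (g : 'I_d -> pt -> R) :
  (forall i, measurable_fun setT (g i)) -> measurable_fun setT (gradnorm g).
Proof.
move=> mg; apply: (@measurableT_comp _ _ _ _ _ _ (@Num.sqrt R)).
  by apply: continuous_measurable_fun; exact: sqrt_continuous.
by apply: measurable_sum => i; apply: measurable_funX.
Qed.

Section Grad.
Hypothesis d_gt0 : (0 < d)%N.
Variable alpha : R.
Hypothesis alpha_gt0 : 0 < alpha.

Lemma finite_sum_weak_grad (p : R) : 1 <= p -> exists C : R, 0 <= C /\
  forall (mu : {measure set pt -> \bar R}) (f : pt -> R) (g : 'I_d -> pt -> R) (F : seq (int * Z)),
    is_lebesgue mu -> W1p mu p%:E f g -> uniq F ->
    (forall Q, Q \in F -> Qalpha mu alpha f Q) ->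
    \sum_(Q <- F) side R Q.1 `^ (d%:R - p) * cav mu f Q.1 Q.2 `^ p <=
    C * \sum_i \int[mu]_y (`|g i y| `^ p).
Proof.
move=> p1; have [C [C0 hC]] := finite_sum_bound d_gt0 alpha_gt0 p1.
exists (C * (2 * 4 `^ p)); split; first by rewrite !mulr_ge0 ?powR_ge0.
move=> mu f g F leb fg uF hF; have [fp _] := fg.
have fl : locint mu f by apply: (in_Lp_locint leb _ fp); rewrite lee_fin.
have [l [X [uX h]]] := hC mu f F leb fl uF hF.
apply: (le_trans h); rewrite -!mulrA ler_wpM2l//.
have sl := side_gt0 R l.
(* The mesh size disappears: [(d - p - d p) + p + d (p - 1) = 0]. *)
have e : side R l `^ (d%:R - p - d%:R * p) * (side R l `^ p * (side R l ^+ d) `^ (p - 1)) = 1.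
  have -> : (side R l ^+ d) `^ (p - 1) = side R l `^ (d%:R * (p - 1)).
    by rewrite -(powR_mulrn d (ltW sl)) -powRrM.
  rewrite -!powRD ?(gt_eqF sl) ?implybT//.
  by rewrite [X in _ `^ X](_ : _ = 0) ?powRr0//; ring.
rewrite exchange_big /=.
apply: (@le_trans _ _ (side R l `^ (d%:R - p - d%:R * p) *
  \sum_i (2 * 4 `^ p * side R l `^ p * (side R l ^+ d) `^ (p - 1) * \int[mu]_y (`|g i y| `^ p)))).
  rewrite ler_wpM2l ?powR_ge0//; apply: ler_sum => i _.
  exact: (sum_diffi_weak_grad leb l i p1 fg uX).
rewrite -mulr_sumr le_eqVlt; apply/orP; left; apply/eqP.
move: e; move: (side R l `^ (_ - _)) (side R l `^ p) (_ `^ (p - 1)) (4 `^ p) (\sum_i _) => a b c q S e.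
by rewrite -[RHS]mul1r -e; ring.
Qed.

Lemma W1p_part (p : R) : 1 <= p -> exists C : R,
  forall (mu : {measure set pt -> \bar R}), is_lebesgue mu ->
  forall (f : pt -> R) (g : 'I_d -> pt -> R), W1p mu p%:E f g ->
    (poweR (\esum_(nk in Qalpha mu alpha f)
       poweR ((powR (side R nk.1) (d%:R / p - 1))%:E * avg mu f nk.1 nk.2) p) p^-1
     <= C%:E * 'N[mu]_(p%:E)[EFin \o gradnorm g])%E.
Proof.
move=> p1; have p0 : 0 < p by exact: lt_le_trans p1.
have [C [C0 hC]] := finite_sum_weak_grad p1.
exists ((C * d%:R) `^ p^-1) => mu leb f g fg; have [fp [gp _]] := fg.
have fl : locint mu f by apply: (in_Lp_locint leb _ fp); rewrite lee_fin.
pose I := (\int[mu]_y (gradnorm g y `^ p)%:E)%E.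
have I0 : (0 <= I)%E by apply: integral_ge0 => y _; rewrite lee_fin powR_ge0.
have -> : ('N[mu]_(p%:E)[EFin \o gradnorm g] = poweR I p^-1)%E.
  have e : (\int[mu]_y poweR `|(EFin \o gradnorm g) y| p = I)%E.
    by apply: eq_integral => y _ /=; rewrite ger0_norm ?gradnorm_ge0.
  by rewrite unlock /Lnorm e.
have Cd0 : 0 <= C * d%:R by rewrite mulr_ge0.
rewrite -poweR_EFin -poweRM ?lee_fin//.
have E0 : (0 <= \esum_(nk in Qalpha mu alpha f)
     poweR ((powR (side R nk.1) (d%:R / p - 1))%:E * avg mu f nk.1 nk.2) p)%E.
  by apply: esum_ge0 => x _; exact: poweR_ge0.
apply: gt0_ler_poweR; rewrite ?invr_ge0 ?(ltW p0)// ?in_itv /= ?leey ?andbT//.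
  by rewrite mule_ge0// lee_fin.
apply: esum_le_seq => F uF hF.
have := hC mu f g F leb fg uF hF; rewrite -lee_fin => h.
apply: le_trans (le_trans h _).
  rewrite -sumEFin le_eqVlt; apply/orP; left; apply/eqP; apply: eq_bigr => -[n k] _ /=.
  have s0 := side_gt0 R n.
  rewrite avgE// -EFinM poweR_EFin powRM ?powR_ge0 ?cav_ge0// -powRrM.
  by rewrite mulrBl mul1r divfK ?gt_eqF.
(* Each [|g i|] is at most [gradnorm g], so the directions together cost the factor [d]. *)
rewrite EFinM [in leRHS]EFinM -muleA lee_wpmul2l ?lee_fin// -sumEFin.
have mg : measurable_fun setT (gradnorm g) by apply: measurable_gradnorm => i; case: (gp i).
have h1 i : ((\int[mu]_y (`|g i y| `^ p))%:E <= I)%E.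
  have gi := integrable_powR p1 (gp i).
  rewrite /Rintegral fineK; last by apply: integrable_fin_num gi.
  apply: ge0_le_integral => //.
  - by case/integrableP: gi.
  - by apply/measurable_EFinP; apply: (@measurableT_comp _ _ _ _ _ _ (@powR R ^~ p)).
  - by move=> y _; rewrite lee_fin; apply: le_powR; rewrite ?gradnorm_ge ?(ltW p0).
have -> : d%:R%:E = (\sum_(i < d) 1%:E)%E :> \bar R by rewrite sumEFin sumr_const card_ord.
rewrite ge0_sume_distrl; last by move=> i _; rewrite lee_fin.
by apply: lee_sum => i _; rewrite mul1e.
Qed.

Lemma W1oo_part : exists C : R,
  forall (mu : {measure set pt -> \bar R}), is_lebesgue mu ->
  forall (f : pt -> R) (g : 'I_d -> pt -> R), W1p mu +oo%E f g ->
    (ereal_sup [set ((side R nk.1)^-1)%:E * avg mu f nk.1 nk.2 | nk in Qalpha mu alpha f]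
     <= C%:E * 'N[mu]_(+oo%E)[EFin \o gradnorm g])%E.
Proof.
have [C [C0 hC]] := pointwise_bound d_gt0 alpha_gt0.
(* The 2 counts the cells of an edge; the added 1 makes the constant positive, so the right side is
   [+oo] whenever the norm is. *)
exists (C * 2 + 1) => mu leb f g [fp [gp wg]].
have fl : locint mu f by exact: (in_Lp_locint leb (leey _) fp).
have gl i : locint mu (g i) by exact: (in_Lp_locint leb (leey _) (gp i)).
have D0 : 0 < C * 2 + 1 by rewrite ltr_wpDl// mulr_ge0.
have NE : ('N[mu]_(+oo)[EFin \o gradnorm g])%E = ess_sup mu (abse \o (EFin \o gradnorm g)).
  by rewrite unlock mu_setT_gt0.
have N0 := Lnorm_ge0 mu +oo%E (EFin \o gradnorm g).
have Nge := ess_sup_ge mu (abse \o (EFin \o gradnorm g)).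
rewrite -NE in Nge.
case: ('N[mu]_(+oo%E)[EFin \o gradnorm g])%E N0 Nge => [r| |]// r0 hr; last first.
  by rewrite gt0_muley ?lte_fin// leey.
rewrite lee_fin in r0.
apply: ge_ereal_sup => _ [[n k] hQ <-] /=.
rewrite avgE// -!EFinM lee_fin.
have ga m x i : cint m mu (fun y => `|g i y|) x <= r * side R m ^+ d.
  have gi := locint_abs (gl i).
  rewrite -lee_fin -cint_EFin//.
  have -> : ((r * side R m ^+ d)%:E = \int[mu]_(y in cube m x) r%:E)%E.
    by rewrite integral_cst ?mu_dcube//; exact: measurable_dcube.
  have mc := @measurable_dcube R d m x.
  apply: ae_ge0_le_integral => //.
  - apply/measurable_EFinP; apply: measurable_funS (proj1 gi) => //.
  - apply: filterS hr => y /= h _; apply: le_trans h.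
    by rewrite lee_fin; apply: (le_trans (gradnorm_ge g i y)); exact: ler_norm.
have hd m x i : `|cint m mu f (zshift i 1 x) - cint m mu f x| <= side R m * side R m ^+ d * (2 * r).
  apply: (le_trans (edge_weak_grad m x leb fl (gl i) wg)).
  have := ga m x i; have := ga m (zshift i 1 x) i.
  rewrite -mulrA ler_pM2l ?side_gt0//.
  move: (cint _ _ _ _) (cint _ _ _ _) (_ ^+ _) => a b c h1 h2.
  by rewrite mulrCA mulrA mulr2n mulrDl mulrDl mul1r [c * r]mulrC lerD.
have := hC mu f (n, k) (2 * r) leb fl hd hQ => /= h.
rewrite ler_pdivrMl ?side_gt0//; apply: (le_trans h).
have s0 := side_gt0 R n.
have : 0 <= side R n * r by rewrite mulr_ge0// ltW.
move: (side R n) => s sr.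
have -> : s * ((C * 2 + 1) * r) = C * s * (2 * r) + s * r by ring.
by rewrite lerDl.
Qed.

Lemma BV_part : exists C : R,
  forall (mu : {measure set pt -> \bar R}), is_lebesgue mu ->
  forall f : pt -> R, BV mu f ->
    (\esum_(nk in Qalpha mu alpha f) ((powR (side R nk.1) (d%:R - 1))%:E * avg mu f nk.1 nk.2)
     <= C%:E * var mu f)%E.
Proof.
have [C [C0 hC]] := finite_sum_bound d_gt0 alpha_gt0 (lexx 1).
have [K K0 hK] := edge_var R d.
exists (C * d%:R * K) => mu leb f [f1 _].
have fl : locint mu f by exact: (in_Lp_locint leb (lexx _) f1).
apply: esum_le_seq => F uF hF.
have [l [X [uX]]] := hC mu f F leb fl uF hF.
have s0 := side_gt0 R l.
rewrite -lee_fin => h; apply: le_trans (le_trans h _).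
  rewrite -sumEFin le_eqVlt; apply/orP; left; apply/eqP; apply: eq_bigr => -[n k] _ /=.
  by rewrite avgE// -EFinM powRr1 ?cav_ge0.
(* The resulting factor [(side R l)^-1] cancels the side length in [edge_var]. *)
have -> : d%:R - 1 - d%:R * 1 = -1 :> R by ring.
rewrite powR_inv1 ?(ltW s0)// exchange_big /=.
have CK : (C * d%:R * K)%:E = ((C / side R l)%:E * (\sum_(i < d) (K * side R l)%:E))%E.
  rewrite sumEFin -EFinM sumr_const card_ord -mulr_natl; congr (_%:E).
  by field; rewrite gt_eqF.
have c0 : 0 <= C / side R l by rewrite divr_ge0// ltW.
rewrite CK -muleA EFinM lee_wpmul2l ?lee_fin//.
rewrite ge0_sume_distrl => [|i _]; last by rewrite lee_fin mulr_ge0// ltW.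
rewrite -sumEFin; apply: lee_sum => i _.
apply: le_trans (hK mu f l X i leb fl uX); rewrite lee_fin.
by apply: ler_sum => x _; rewrite powRr1.
Qed.

End Grad.
End Extended.

Theorem theorem1p4 (R : realType) (d : nat) (alpha : R) :
  0 < alpha -> alpha < d%:R ->
  (* 1 <= p < oo, f in W^{1,p} *)
  (forall p : R, 1 <= p -> exists C : R,
     forall (mu : {measure set (d.-tuple R) -> \bar R}), is_lebesgue mu ->
     forall (f : d.-tuple R -> R) (g : 'I_d -> d.-tuple R -> R),
       W1p mu p%:E f g ->
       (poweR (\esum_(nk in Qalpha mu alpha f)
                 poweR ((powR (side R nk.1) (d%:R / p - 1))%:E * avg mu f nk.1 nk.2) p)
              p^-1
        <= C%:E * 'N[mu]_(p%:E)[EFin \o gradnorm g])%E)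
  /\
  (* p = 1, f in BV *)
  (exists C : R,
     forall (mu : {measure set (d.-tuple R) -> \bar R}), is_lebesgue mu ->
     forall f : d.-tuple R -> R, BV mu f ->
       (\esum_(nk in Qalpha mu alpha f)
           ((powR (side R nk.1) (d%:R - 1))%:E * avg mu f nk.1 nk.2)
        <= C%:E * var mu f)%E)
  /\
  (* p = oo, f in W^{1,oo} *)
  (exists C : R,
     forall (mu : {measure set (d.-tuple R) -> \bar R}), is_lebesgue mu ->
     forall (f : d.-tuple R -> R) (g : 'I_d -> d.-tuple R -> R),
       W1p mu +oo%E f g ->
       (ereal_sup [set ((side R nk.1)^-1)%:E * avg mu f nk.1 nk.2 |
                   nk in Qalpha mu alpha f]
        <= C%:E * 'N[mu]_(+oo%E)[EFin \o gradnorm g])%E).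
Proof.
move=> a0 ad; have d_gt0 : (0 < d)%N by rewrite -(ltr0n R) (lt_trans a0).
split; first by move=> p p1; exact: (W1p_part d_gt0 a0 p1).
by split; [exact: (BV_part d_gt0 a0)|exact: (W1oo_part d_gt0 a0)].
Qed.
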